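(* Let $m>d\ge0$ be integers. Let $\mathbf f$ be a non-uniform spline of degree $d$ on $[-1,1]$ written as $$\mathbf f=\mathbf 1_{[-1,t_1)}\mathbf P_0+\mathbf 1_{[t_1,t_2)}\mathbf P_1+\dots+\mathbf 1_{[t_{s-1},t_s)}\mathbf P_{s-1}+\mathbf 1_{[t_s,1]}\mathbf P_s,$$ where each $\mathbf P_k$ is a real polynomial of degree at most $d$, and assume that $\mathbf T=\{-1,t_1,\dots,t_s,1\}$ satisfies $$\min\{\Delta(\mathbf T),\,2\epsilon(\mathbf T)\}\ge\frac{5\pi}{m}.$$ Let $\mathbf b=(\mathbf P_0(-1),\dots,\mathbf P_0^{(d-1)}(-1),\mathbf P_0^{(d)}(-1),\mathbf P_s(1),\dots,\mathbf P_s^{(d-1)}(1),\mathbf P_s^{(d)}(1))$ and let $P$ be a random polynomial of degree at most $m-d-1$ such that $\Theta(P)\sim\mathcal N(\mathbf p(\mathbf f),\sigma^2\,\mathrm{Id}_{m-d})$. Let $\alpha>0$ and $$\lambda=4\sigma\,[2(1+\alpha)(m-d)\log(5(m+d+1))]^{1/2}.$$ Then, with probability greater than $1-\big[\frac1{5(m+d)}\big]^{\alpha}$, any output $$\hat{\mathbf f}=\mathbf 1_{[-1,\hat t_1)}\hat{\mathbf P}_0+\mathbf 1_{[\hat t_1,\hat t_2)}\hat{\mathbf P}_1+\dots+\mathbf 1_{[\hat t_{\hat s-1},\hat t_{\hat s})}\hat{\mathbf P}_{\hat s-1}+\mathbf 1_{[\hat t_{\hat s},1]}\hat{\mathbf P}_{\hat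 s}$$ of the recovery procedure described in the context satisfies: 1. (Global control) $$\sum_{k=1}^{\hat s}\big|\hat{\mathbf P}_k^{(d)}-\hat{\mathbf P}_{k-1}^{(d)}\big|\min\Big\{m^2\min_{t\in\mathbf T}\rho(t,\hat t_k)^2;\ c_0^2\Big\}\le c_1\lambda.$$ 2. (Large discontinuity localization) For every $i=1,\dots,s$ such that $|\mathbf P_i^{(d)}-\mathbf P_{i-1}^{(d)}|>c_2\lambda$, there exists $\hat t\in\{\hat t_1,\dots,\hat t_{\hat s}\}$ such that $$\rho(t_i,\hat t)\le\left[\frac{c_1\lambda}{|\mathbf P_i^{(d)}-\mathbf P_{i-1}^{(d)}|-c_2\lambda}\right]^{1/2}\frac1m.$$ Here $c_0=1.0361$, $c_1=235.85$, $c_2=220.72$.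
   Context: Distance on $[-1,1]$: $\rho(u,v)=|\arccos u-\arccos v|$. For a finite $\mathbf T\subset[-1,1]$, $\Delta(\mathbf T)$ is the minimum of $|x-x'|$ over pairs of distinct points $x\ne x'$ of the set $\arccos(\mathbf T)+\pi\mathbb Z$, and $\epsilon(\mathbf T)=\min\{\min(\rho(t,1),\rho(t,-1)):t\in\mathbf T\setminus\{-1,1\}\}$. A non-uniform spline of degree $d$ over the knots $-1<t_1<\dots<t_s<1$ is a function of class $C^{d-1}$ on $[-1,1]$ (no continuity required if $d=0$) that is piecewise polynomial as displayed. Its $(d+1)$-th distributional derivative is the discrete measure $\mathbf f^{(d+1)}=\sum_{k=1}^s(\mathbf P_k^{(d)}-\mathbf P_{k-1}^{(d)})\delta_{t_k}$, where $\mathbf P_k^{(d)}\in\mathbb R$ is the (constant) $d$-th derivative. $\varphi_0=1$, $\varphi_k=\sqrt2\,T_k$ for $1\le k\le m$, with $T_k(t)=\cos(k\arccos t)$. For a finite signed measure $\mu$ on $[-1,1]$: $c_k(\mu)=\int\varphi_k\,d\mu$, $\mathbf c(\mu)=(c_k(\mu))_{k=0}^m$, $\|\mu\|_{TV}$ is the total variation norm, and $\mathbf C_d(\mathbf f^{(d+1)})$ is the set of finite signed measures $\mu$ on $[-1,1]$ with $c_k(\mu)=c_k(\mathbf f^{(d+1)})$ for $k=0,\dots,d$. Write $\langle g,h\rangle=\int_{-1}^1g(t)h(t)\,dt$. Then $\mathbf p(\mathbf f)=(\langle\mathbf f,\varphi_{d+1}^{(d+1)}\rangle,\dots,\langle\mathbf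 f,\varphi_m^{(d+1)}\rangle)$ and $\Theta(P)=(\langle P,\varphi_{d+1}^{(d+1)}\rangle,\dots,\langle P,\varphi_m^{(d+1)}\rangle)$; $\sigma>0$. Recovery procedure (inputs: $\mathbf b$, $P$, $\sigma$, $\alpha$). Step 1. Form $\mathbf y=(y_0,\dots,y_m)\in\mathbb R^{m+1}$ by, with $\mathbf w_{k,l}=\mathbf 1_{\{k\ge l\}}\prod_{j=0}^{l-1}\frac{k^2-j^2}{2j+1}$: $y_0=\mathbf P_s^{(d)}(1)-\mathbf P_0^{(d)}(-1)$; for $1\le k\le d$, $$y_k=\sqrt2\sum_{l=0}^{k}(-1)^l\mathbf w_{k,l}\mathbf P_s^{(d-l)}(1)+(-1)^{k+1}\sqrt2\sum_{l=0}^{k}\mathbf w_{k,l}\mathbf P_0^{(d-l)}(-1);$$ for $d<k\le m$, $$y_k=\sqrt2\sum_{l=0}^{d}(-1)^l\mathbf w_{k,l}\mathbf P_s^{(d-l)}(1)+(-1)^{k+1}\sqrt2\sum_{l=0}^{d}\mathbf w_{k,l}\mathbf P_0^{(d-l)}(-1)+(-1)^{d+1}\langle P,\varphi_k^{(d+1)}\rangle.$$ Step 2. With $\lambda$ as in the claim, take a solution with finite support $\hat{\mathbf x}=\sum_{k=1}^{\hat s}\hat a_k\delta_{\hat t_k}$ ($\hat t_1<\dots<\hat t_{\hat s}$) of $$\min_{\mu\in\mathbf C_d(\mathbf f^{(d+1)})}\tfrac12\|\mathbf c(\mu)-\mathbf y\|_2^2+\lambda\|\mu\|_{TV}.$$ Step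 3. Output the unique spline $\hat{\mathbf f}$ of degree $d$ with knots $\hat t_k$ and polynomial pieces $\hat{\mathbf P}_0,\dots,\hat{\mathbf P}_{\hat s}$ (of degree at most $d$) such that $\hat{\mathbf f}^{(d+1)}=\hat{\mathbf x}$ (i.e. $\hat{\mathbf P}_k-\hat{\mathbf P}_{k-1}=\frac{\hat a_k}{d!}(X-\hat t_k)^d$, so $\hat{\mathbf P}_k^{(d)}-\hat{\mathbf P}_{k-1}^{(d)}=\hat a_k$) and with the same boundary conditions $\mathbf b$, i.e. $\hat{\mathbf P}_0^{(j)}(-1)=\mathbf P_0^{(j)}(-1)$ and $\hat{\mathbf P}_{\hat s}^{(j)}(1)=\mathbf P_s^{(j)}(1)$ for $0\le j\le d$. *)

(* Defs.v *)
From HB Require Import structures.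
From mathcomp Require Import all_boot all_order all_algebra.
From mathcomp Require Import all_classical all_reals all_analysis.
Import Order.TTheory GRing.Theory Num.Theory.
Import numFieldNormedType.Exports.

Set Implicit Arguments.
Unset Strict Implicit.
Unset Printing Implicit Defensive.

Local Open Scope classical_set_scope.
Local Open Scope ring_scope.

(* Knots and polynomial pieces are families [t : nat -> R] (only t 1, ..., t s
   are relevant) and [P : nat -> {poly R}] (only P 0, ..., P s are relevant);
   values at other indices are never used. *)

Section Separation.
Context {R : realType}.
Implicit Types (T : set R) (t : nat -> R).

Definition rho (u v : R) : R := `|acos u - acos v|.

Definition knot_set (s : nat) t : set R :=
  [set -1; 1] `|` [set t k | k in [set k | (1 <= k <= s)%N]].

Definition acos_lift T : set R :=
  [set x | exists2 u, T u & exists z : int, x = acos u + z%:~R * pi].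

(* For finite T this infimum is attained. *)
Definition Delta T : \bar R :=
  ereal_inf [set `|p.1 - p.2|%:E |
    p in [set p : R * R | [/\ acos_lift T p.1, acos_lift T p.2 & p.1 <> p.2]]].

(* The minimum over the empty set (T = {-1, 1}) is +oo. *)
Definition epsilon T : \bar R :=
  ereal_inf [set (Num.min (rho u 1) (rho u (-1)))%:E | u in T `\` [set -1; 1]].

(* min_(u in T) rho(u, v); attained when T is finite and nonempty. *)
Definition dist_to T (v : R) : R := inf [set rho u v | u in T].

End Separation.

Section Splines.
Context {R : realType}.
Implicit Types (d s k : nat) (t : nat -> R) (P : nat -> {poly R}) (p : {poly R}).

(* The k-th interval: [-1, t_1[ for k = 0, [t_k, t_(k+1)[ for 0 < k < s,
   [t_s, 1] for k = s, and [-1, 1] when s = 0. *)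
Definition piece_itv s t k : interval R :=
  Interval (BLeft (if k == 0%N then -1 else t k))
           (if k == s then BRight 1 else BLeft (t k.+1)).

Definition piecewise s t P (x : R) : R :=
  \sum_(0 <= k < s.+1) \1_[set` piece_itv s t k] x * (P k).[x].

(* Class C^n on a subset A of the line: restriction to A of a C^n function. *)
Definition class_C (n : nat) (A : set R) (f : R -> R) : Prop :=
  exists g : R -> R,
    [/\ forall x, A x -> f x = g x,
        forall j x, (j < n)%N -> derivable (derive1n j g) x 1
      & continuous (derive1n n g)].

Definition is_spline d s t P : Prop :=
  [/\ forall k, (1 <= k <= s)%N -> -1 < t k < 1,
      forall k, (1 <= k < s)%N -> t k < t k.+1,
      forall k, (k <= s)%N -> (size (P k) <= d.+1)%N
    & (0 < d)%N -> class_C d.-1 `[-1, 1] (piecewise s t P)].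

(* When deg p <= d, the d-th derivative of p is constant; this is its value. *)
Definition top_deriv d p : R := (derivn d p).[0].

Definition jump d P k : R := top_deriv d (P k) - top_deriv d (P k.-1).

End Splines.

Section SignedMeasures.
Context {R : realType}.
Implicit Types (nu : {charge set R -> \bar R}).

Definition hahn_pos nu : set R := sval (cid (Hahn_decomposition nu)).
Definition hahn_neg nu : set R :=
  sval (cid (svalP (cid (Hahn_decomposition nu)))).
Definition hahn_choice nu : hahn_decomposition nu (hahn_pos nu) (hahn_neg nu) :=
  svalP (cid (svalP (cid (Hahn_decomposition nu)))).

Definition charge_integral nu (D : set R) (f : R -> R) : R :=
  Rintegral (jordan_pos (hahn_choice nu)) D f -
  Rintegral (jordan_neg (hahn_choice nu)) D f.

Definition tv_norm nu : R := fine (charge_variation (hahn_choice nu) setT).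

(* Finite signed measures on [-1, 1] are the charges on R concentrated there. *)
Definition on_interval nu : Prop :=
  forall A : set R, measurable A -> A `&` `[-1, 1] = set0 -> nu A = 0%E.

Definition charge_add (nu1 nu2 : {charge set R -> \bar R}) :
  {charge set R -> \bar R} := cadd nu1 nu2.

Definition charge_scale (a : R) (nu : {charge set R -> \bar R}) :
  {charge set R -> \bar R} := cscale a nu.

Definition charge_zero : {charge set R -> \bar R} := czero.

Definition dirac_charge (u : R) : {charge set R -> \bar R} :=
  charge_of_finite_measure (dirac u).

Definition discrete_charge (s : nat) (t a : nat -> R) :
    {charge set R -> \bar R} :=
  \big[charge_add/charge_zero]_(1 <= k < s.+1)
    (charge_scale (a k) (dirac_charge (t k))).

(* The (d+1)-th distributional derivative of the spline with knots t and
   pieces P. *)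
Definition spline_deriv (d s : nat) (t : nat -> R) (P : nat -> {poly R}) :
    {charge set R -> \bar R} :=
  discrete_charge s t (jump d P).

End SignedMeasures.

Section Recovery.
Context {R : realType}.
Implicit Types (d m s k : nat) (t : nat -> R) (P : nat -> {poly R}).
Implicit Types (nu mu : {charge set R -> \bar R}).

Definition phi k (x : R) : R :=
  if k == 0%N then 1 else Num.sqrt 2 * cos (k%:R * acos x).

Definition moment k nu : R := charge_integral nu `[-1, 1] (phi k).

Definition inner (g h : R -> R) : R :=
  Rintegral lebesgue_measure `[-1, 1] (fun x => g x * h x).

(* <g, phi_k^(d+1)>. The iterated derivative of phi_k is the expected
   polynomial on ]-1, 1[; its values at -1 and 1, where acos has no two-sided
   derivative, do not affect the integral. *)
Definition theta d k (g : R -> R) : R := inner g (derive1n d.+1 (phi k)).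

Definition w k (l : nat) : R :=
  (l <= k)%N%:R * \prod_(j < l) ((k%:R ^+ 2 - j%:R ^+ 2) / (2 * j%:R + 1)).

(* [bl j] and [br j] are the j-th derivatives of the spline at -1 and 1. *)
Definition observation d (bl br : nat -> R) (Q : {poly R}) k : R :=
  if k == 0%N then br d - bl d
  else if (k <= d)%N then
    Num.sqrt 2 * (\sum_(l < k.+1) (-1) ^+ l * w k l * br (d - l)%N)
    + (-1) ^+ k.+1 * Num.sqrt 2 * (\sum_(l < k.+1) w k l * bl (d - l)%N)
  else
    Num.sqrt 2 * (\sum_(l < d.+1) (-1) ^+ l * w k l * br (d - l)%N)
    + (-1) ^+ k.+1 * Num.sqrt 2 * (\sum_(l < d.+1) w k l * bl (d - l)%N)
    + (-1) ^+ d.+1 * theta d k (fun x => Q.[x]).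

(* The constraint set C_d(nu). *)
Definition constraint_set d nu : set ({charge set R -> \bar R})%R :=
  [set mu | on_interval mu /\
            forall k, (k <= d)%N -> moment k mu = moment k nu].

Definition objective m (y : nat -> R) (lam : R) mu : R :=
  2^-1 * (\sum_(k < m.+1) (moment k mu - y k) ^+ 2) + lam * tv_norm mu.

Definition is_solution d m nu (y : nat -> R) (lam : R) mu : Prop :=
  constraint_set d nu mu /\
  forall mu', constraint_set d nu mu' -> objective m y lam mu <= objective m y lam mu'.

Definition left_data P (j : nat) : R := (derivn j (P 0%N)).[-1].
Definition right_data s P (j : nat) : R := (derivn j (P s)).[1].

(* (s', t', P') is an output of the procedure run, with regularization
   parameter lam, on the boundary data of the spline (s, t, P) and on Q. The
   solution of the minimization problem may have atoms at -1 or 1. *)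
Definition recovery_output d m s t P (Q : {poly R}) (lam : R)
    (s' : nat) (t' : nat -> R) (P' : nat -> {poly R}) : Prop :=
  exists a' : nat -> R,
  [/\ (forall k, (1 <= k <= s')%N -> -1 <= t' k <= 1) /\
      (forall k, (1 <= k < s')%N -> t' k < t' k.+1),
      is_solution d m (spline_deriv d s t P)
        (observation d (left_data P) (right_data s P) Q) lam
        (discrete_charge s' t' a'),
      forall k, (k <= s')%N -> (size (P' k) <= d.+1)%N,
      forall k, (1 <= k <= s')%N ->
        P' k - P' k.-1 = (a' k / (d`!)%:R) *: ('X - (t' k)%:P) ^+ d
    & forall j, (j <= d)%N ->
        left_data P' j = left_data P j /\ right_data s' P' j = right_data s P j].

Definition lambda_of d m (sigma alpha : R) : R :=
  4 * sigma *
  Num.sqrt (2 * (1 + alpha) * (m - d)%:R * ln (5 * (m + d + 1)%:R)).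

(* 1.0361, 235.85 and 220.72 *)
Definition c0 : R := 1 + 361 / 10 ^+ 4.
Definition c1 : R := 235 + 85 / 100.
Definition c2 : R := 220 + 72 / 100.

End Recovery.

(* The law of (X_0, ..., X_(n-1)) is N(mean, sigma^2 Id_n), i.e. the product of
   the laws N(mean i, sigma^2); a probability on R^n is determined by its
   values on measurable boxes. *)
Definition isotropic_gaussian {R : realType} {disp : measure_display}
    {Omega : measurableType disp} (Pr : probability Omega R) (n : nat)
    (X : 'I_n -> Omega -> R) (mean : 'I_n -> R) (sigma : R) : Prop :=
  (forall i, measurable_fun setT (X i)) /\
  forall A : 'I_n -> set R, (forall i, measurable (A i)) ->
    Pr [set omega | forall i, A i (X i omega)] =
    (\prod_(i < n) fine (normal_prob (mean i) sigma (A i)))%:E.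

(* Main.v *)
Require Import Defs.
From HB Require Import structures.
From mathcomp Require Import all_boot all_order all_algebra.
From mathcomp Require Import all_classical all_reals all_analysis.
From mathcomp Require Import measurable_realfun.
From mathcomp Require Import zify ring lra.
Import Order.TTheory GRing.Theory Num.Theory.
Import numFieldNormedType.Exports.

Set Implicit Arguments.
Unset Strict Implicit.
Unset Printing Implicit Defensive.

Local Open Scope classical_set_scope.
Local Open Scope ring_scope.

(** Let [c] be the vector of moments of the true measure (the jumps of the [d]-th
    derivative, sitting at the knots) and [c'] the one of the estimate.

    Integrating by parts [d + 1] times on every piece ([spline_byparts]) shows that, for
    [d < k], the observation [y_k] is the moment [c_k] plus or minus the Gaussian
    error in the [k]-th integral ([observation_moment]): smoothness kills the lower
    order terms at the knots and Chebyshev's equation identifies the boundary terms. For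
    [k <= d] the constraint forces [c'_k = c_k], so these data cancel. Gaussian tails
    bound all the errors at once by a level [u] for which the noise has norm at most
    [lam / 4] ([gaussian_box], [gaussian_level]); the rest is deterministic.

    The main tool is a dual certificate: for any signs at the knots, a polynomial [G] of
    degree at most [m] that takes these signs at the knots, satisfies [|G| <= 1] on the
    interval, and leaves a gap [1 - |G|] of order [m^2 rho^2] next to a knot and bounded
    below elsewhere ([knot_certificate]). After the change of variable [x = cos th] the
    knots and their reflections are points of the circle separated by [5 pi / m]. There
    [G] is sought as a combination of translates of the Jackson kernel (the square of a
    Fejer kernel) and of its product with [sin], with prescribed values and vanishing
    derivatives at the nodes. These kernels decay fast enough for the linear system to be
    diagonally dominant ([interpolation]) and for the contribution of the other nodes to
    be negligible, which gives the profile of [G] ([interpolant_near],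
    [interpolant_far]); averaging over [th] and [- th] makes it a polynomial in [cos th]
    ([angle_certificate]). As [|G| <= 1], discrete orthogonality at the Chebyshev nodes
    bounds the norm of the coefficients of [G] by [1] ([cheb_coef_le]).

    Comparing the objective at the estimate and at the truth and completing a square
    with the coefficients of [G] ([bregman_bound]) gives
    [sum |a'_k| (1 - |G (t'_k)|) <= 25/32 lam] and [|c' - c| <= 5/2 lam]. With the lower
    bound on the gap, the first estimate is the global control. For the localization of
    a large jump, half the difference of the certificates for two sign patterns that
    differ only at the [i]-th knot isolates its amplitude: paired with [c' - c] it is at
    most [5/2 lam], while without an atom of the estimate near the knot it is bounded, at
    all the atoms, by a multiple of the gap. *)


(** * Differential calculus on the line *)
Section Calculus.
Context {R : realType}.
Implicit Types (f g : R -> R) (x y z a b c B : R).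

Lemma der_eq f x a b : a = b -> is_derive x 1 f a -> is_derive x 1 f b.
Proof. by move->. Qed.

Lemma derM f g x a b : is_derive x 1 f a -> is_derive x 1 g b ->
  is_derive x 1 (fun y => f y * g y) (a * g x + f x * b).
Proof.
move=> df dg; have := is_deriveM df dg.
by rewrite [_ + _]addrC /GRing.scale /= [g x * a]mulrC.
Qed.

Lemma derD f g x a b : is_derive x 1 f a -> is_derive x 1 g b ->
  is_derive x 1 (fun y => f y + g y) (a + b).
Proof. exact: is_deriveD. Qed.

Lemma derB f g x a b : is_derive x 1 f a -> is_derive x 1 g b ->
  is_derive x 1 (fun y => f y - g y) (a - b).
Proof. exact: is_deriveB. Qed.

Lemma derN f x a : is_derive x 1 f a -> is_derive x 1 (fun y => - f y) (- a).
Proof. exact: is_deriveN. Qed.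

Lemma derZ c f x a : is_derive x 1 f a ->
  is_derive x 1 (fun y => c * f y) (c * a).
Proof. exact: is_deriveZ. Qed.

Lemma derX n f x a : is_derive x 1 f a ->
  is_derive x 1 (fun y => f y ^+ n) (n%:R * f x ^+ n.-1 * a).
Proof. by move=> df; have := is_deriveX n df; rewrite exprfctE. Qed.

Lemma der_lin c x : is_derive x 1 (fun y => c * y) c.
Proof. by have := derZ c (is_derive_id x (1 : R)); rewrite mulr1. Qed.

Lemma der_sinM c x : is_derive x 1 (fun y => sin (c * y)) (c * cos (c * x)).
Proof.
by rewrite mulrC; apply: (is_derive1_comp (is_derive_sin _) (der_lin c x)).
Qed.

Lemma der_cosM c x : is_derive x 1 (fun y => cos (c * y)) (- (c * sin (c * x))).
Proof.
rewrite mulrC -mulNr.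
exact: (is_derive1_comp (is_derive_cos _) (der_lin c x)).
Qed.

Lemma der_sum (I : Type) (r : seq I) (P : pred I) (F : I -> R -> R)
    (dF : I -> R) x :
  (forall i, P i -> is_derive x 1 (F i) (dF i)) ->
  is_derive x 1 (fun y => \sum_(i <- r | P i) F i y) (\sum_(i <- r | P i) dF i).
Proof.
move=> h; rewrite (_ : (fun y => _) = \sum_(i <- r | P i) F i); last first.
  by apply/funext => y; rewrite fct_sumE.
elim/big_ind2 : _ => // [|f a g b]; first exact: is_derive_cst.
exact: is_deriveD.
Qed.

Lemma der_shift f x c a :
  is_derive (x - c) 1 f a -> is_derive x 1 (fun y => f (y - c)) a.
Proof.
move=> df.
have ds : is_derive x 1 (fun y => y - c) 1.
  by have := derB (is_derive_id x (1 : R)) (is_derive_cst c x 1); rewrite subr0.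
by have := @is_derive1_comp _ f (fun y => y - c) x a 1 df ds; rewrite mulr1.
Qed.

Lemma der_shiftr f x c a :
  is_derive (c + x) 1 f a -> is_derive x 1 (fun y => f (c + y)) a.
Proof.
move=> df; have -> : (fun y => f (c + y)) = (fun y => f (y - - c)).
  by apply/funext => y; rewrite opprK addrC.
by apply: der_shift; rewrite opprK addrC.
Qed.

Lemma der_opp f x a :
  is_derive (- x) 1 f a -> is_derive x 1 (fun y => f (- y)) (- a).
Proof.
move=> df.
have := is_derive1_comp df (is_deriveNid x 1 : is_derive x 1 (fun y => - y) _).
by rewrite mulrN1.
Qed.

Lemma der_ge0_le f (df : R -> R) a b : a <= b ->
  (forall x, a <= x <= b -> is_derive x 1 f (df x)) ->
  (forall x, a <= x <= b -> 0 <= df x) -> f a <= f b.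
Proof.
move=> ab hd h0.
have [||c cab e] := @MVT_segment _ f df a b ab.
- by move=> x; rewrite in_itv /= => /andP[ax xb]; apply: hd; rewrite !ltW.
- apply: derivable_within_continuous => x; rewrite in_itv /= => xab.
  by have [] := hd _ xab.
rewrite -subr_ge0 e mulr_ge0 ?subr_ge0//; apply: h0.
by move: cab; rewrite in_itv.
Qed.

Lemma der_ge0_le0 f (df : R -> R) : (forall x, is_derive x 1 f (df x)) ->
  (forall x, 0 <= x -> 0 <= df x) -> f 0 = 0 -> forall x, 0 <= x -> 0 <= f x.
Proof.
move=> hd h0 f0 x x0; rewrite -f0; apply: (der_ge0_le x0) => // y.
by move=> /andP[y0 _]; exact: h0.
Qed.

(** One-sided second order Taylor bound: only an upper bound on the second
    derivative is used, so that it serves for both signs of the remainder. *)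
Lemma taylor2_ub f (f1 f2 : R -> R) B a : 0 <= a ->
  (forall x, 0 <= x <= a -> is_derive x 1 f (f1 x)) ->
  (forall x, 0 <= x <= a -> is_derive x 1 f1 (f2 x)) ->
  (forall x, 0 <= x <= a -> f2 x <= B) ->
  f a <= f 0 + a * f1 0 + B * a ^+ 2 / 2.
Proof.
move=> a0 d1 d2 hB.
have step x : 0 <= x <= a -> 0 <= f1 0 + B * x - f1 x.
  move=> /andP[x0 xa].
  pose g y := B * y - f1 y.
  have : g 0 <= g x.
    apply: (@der_ge0_le g (fun y => B - f2 y)) => // y /andP[y0 yx].
      by apply: derB; [exact: der_lin|apply: d2; rewrite y0 (le_trans yx)].
    by rewrite subr_ge0; apply: hB; rewrite y0 (le_trans yx).
  rewrite /g; lra.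
pose h y := f1 0 * y + B / 2 * y ^+ 2 - f y.
have hd y : 0 <= y <= a -> is_derive y 1 h (f1 0 + B * y - f1 y).
  move=> y0a; apply: derB; last exact: d1.
  apply: derD; first exact: der_lin.
  apply: (der_eq _ (derZ (B / 2) (derX 2 (is_derive_id y (1 : R))))).
  by rewrite /=; field.
have := der_ge0_le a0 hd step.
by rewrite /h; lra.
Qed.

Lemma taylor2_norm f (f1 f2 : R -> R) B a x : `|x| <= a ->
  (forall y, `|y| <= a -> is_derive y 1 f (f1 y)) ->
  (forall y, `|y| <= a -> is_derive y 1 f1 (f2 y)) ->
  (forall y, `|y| <= a -> `|f2 y| <= B) ->
  `|f x - f 0 - x * f1 0| <= B * x ^+ 2 / 2.
Proof.
move=> xa d1 d2 hB.
wlog x0 : f f1 f2 x xa d1 d2 hB / 0 <= x.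
  move=> wl; have [|x0] := leP 0 x; first exact: wl.
  have := wl (fun y => f (- y)) (fun y => - f1 (- y)) (fun y => f2 (- y)) (- x).
  rewrite normrN sqrrN opprK oppr0 mulrNN; apply => //.
  - by move=> y ya; apply: der_opp; apply: d1; rewrite normrN.
  - move=> y ya; rewrite -[f2 _]opprK.
    by apply: derN; apply: der_opp; apply: d2; rewrite normrN.
  - by move=> y ya; apply: hB; rewrite normrN.
  - lra.
have xle y : 0 <= y <= x -> `|y| <= a.
  by move=> /andP[y0 yx]; rewrite ger0_norm// (le_trans yx)// -(ger0_norm x0).
have hB1 y : 0 <= y <= x -> f2 y <= B.
  by move=> /xle /hB; rewrite ler_norml => /andP[].
have hB2 y : 0 <= y <= x -> - f2 y <= B.
  by move=> /xle /hB; rewrite ler_norml => /andP[]; lra.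
have e1 y : 0 <= y <= x -> is_derive y 1 f (f1 y) by move=> /xle; exact: d1.
have e2 y : 0 <= y <= x -> is_derive y 1 f1 (f2 y) by move=> /xle; exact: d2.
have ub := taylor2_ub x0 e1 e2 hB1.
have lb := taylor2_ub x0 (fun y h => derN (e1 y h)) (fun y h => derN (e2 y h)) hB2.
by rewrite ler_norml; apply/andP; split; lra.
Qed.

Let der_mono (n : nat) c y :
  is_derive y 1 (fun z => z ^+ n / c) (n%:R / c * y ^+ n.-1).
Proof.
have := derZ c^-1 (derX n (is_derive_id y (1 : R))).
rewrite (_ : (fun z => _) = (fun z => z ^+ n / c)); last first.
  by apply/funext => z; rewrite mulrC.
by move=> /is_derive_eq; apply; rewrite /= mulr1 mulrA [c^-1 * _]mulrC.
Qed.

(** The alternating Taylor bounds for [sin] and [cos], each obtained from the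
    previous one by integration from [0]. *)
Lemma sin_le_id x : 0 <= x -> sin x <= x.
Proof.
move=> x0; rewrite -subr_ge0.
have hd y : is_derive y 1 (fun y => y - sin y) (1 - cos y) by exact: derB.
apply: (der_ge0_le0 hd) x0 => [y _|]; last by rewrite sin0 subr0.
by rewrite subr_ge0 cos_le1.
Qed.

Lemma cos_ge_quad x : 0 <= x -> 1 - x ^+ 2 / 2 <= cos x.
Proof.
move=> x0; rewrite -subr_ge0.
have hd y : is_derive y 1 (fun y => cos y - (1 - y ^+ 2 / 2)) (y - sin y).
  apply: (der_eq _ (derB (is_derive_cos y) (derB (is_derive_cst (1 : R) y 1) (der_mono 2 2 y)))).
  by rewrite /=; field.
apply: (der_ge0_le0 hd) x0 => [y y0|]; first by rewrite subr_ge0 sin_le_id.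
by rewrite cos0 expr0n /=; lra.
Qed.

Lemma sin_ge_cubic x : 0 <= x -> x - x ^+ 3 / 6 <= sin x.
Proof.
move=> x0; rewrite -subr_ge0.
have hd y : is_derive y 1 (fun y => sin y - (y - y ^+ 3 / 6))
    (cos y - (1 - y ^+ 2 / 2)).
  apply: (der_eq _ (derB (is_derive_sin y) (derB (is_derive_id y (1 : R)) (der_mono 3 6 y)))).
  by rewrite /=; field.
apply: (der_ge0_le0 hd) x0 => [y y0|]; first by rewrite subr_ge0 cos_ge_quad.
by rewrite sin0 expr0n /=; lra.
Qed.

Lemma cos_le_quartic x : 0 <= x -> cos x <= 1 - x ^+ 2 / 2 + x ^+ 4 / 24.
Proof.
move=> x0; rewrite -subr_ge0.
have hd y : is_derive y 1 (fun y => 1 - y ^+ 2 / 2 + y ^+ 4 / 24 - cos y)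
    (sin y - (y - y ^+ 3 / 6)).
  apply: (der_eq _ (derB (derD (derB (is_derive_cst (1 : R) y 1) (der_mono 2 2 y))
                   (der_mono 4 24 y)) (is_derive_cos y))).
  by rewrite /=; field.
apply: (der_ge0_le0 hd) x0 => [y y0|]; first by rewrite subr_ge0 sin_ge_cubic.
by rewrite cos0 !expr0n /=; lra.
Qed.

Lemma sin_le_quintic x : 0 <= x -> sin x <= x - x ^+ 3 / 6 + x ^+ 5 / 120.
Proof.
move=> x0; rewrite -subr_ge0.
have hd y : is_derive y 1 (fun y => y - y ^+ 3 / 6 + y ^+ 5 / 120 - sin y)
    (1 - y ^+ 2 / 2 + y ^+ 4 / 24 - cos y).
  apply: (der_eq _ (derB (derD (derB (is_derive_id y (1 : R)) (der_mono 3 6 y))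
                   (der_mono 5 120 y)) (is_derive_sin y))).
  by rewrite /=; field.
apply: (der_ge0_le0 hd) x0 => [y y0|]; first by rewrite subr_ge0 cos_le_quartic.
by rewrite sin0 !expr0n /=; lra.
Qed.

Lemma cos_ge_sextic x : 0 <= x ->
  1 - x ^+ 2 / 2 + x ^+ 4 / 24 - x ^+ 6 / 720 <= cos x.
Proof.
move=> x0; rewrite -subr_ge0.
have hd y : is_derive y 1
    (fun y => cos y - (1 - y ^+ 2 / 2 + y ^+ 4 / 24 - y ^+ 6 / 720))
    (y - y ^+ 3 / 6 + y ^+ 5 / 120 - sin y).
  apply: (der_eq _ (derB (is_derive_cos y) (derB (derD (derB (is_derive_cst (1 : R) y 1)
             (der_mono 2 2 y)) (der_mono 4 24 y)) (der_mono 6 720 y)))).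
  by rewrite /=; field.
apply: (der_ge0_le0 hd) x0 => [y y0|]; first by rewrite subr_ge0 sin_le_quintic.
by rewrite cos0 !expr0n /=; lra.
Qed.

(** The sextic lower bound is positive at [156/100], so the zero [pi / 2] of [cos] lies
    beyond. *)
Lemma pi_gt_312 : 312 / 100 < pi :> R.
Proof.
have [h|//] := leP pi (312 / 100 : R).
have p2 := pi_ge2 R.
have c0 : 0 < cos (156 / 100 : R).
  by apply: lt_le_trans (cos_ge_sextic _); lra.
have : cos (156 / 100 : R) <= cos (pi / 2).
  have [->//|ne] := eqVneq (156 / 100 : R) (pi / 2).
  rewrite ltW// ltr_cos ?in_itv /=; lra.
by rewrite cos_pihalf => /(lt_le_trans c0); rewrite ltxx.
Qed.

(** Jordan's inequality. If it failed at [y], the mean value theorem on both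
    sides of [y] would make [cos] larger to the right of [y] than to the left. *)
Lemma jordan_sin y : 0 <= y <= pi / 2 -> 2 / pi * y <= sin y.
Proof.
move=> /andP[y0 yp]; have p0 := @pi_gt0 R.
have [//|h] := leP (2 / pi * y) (sin y).
have yn0 : 0 < y.
  by rewrite lt_neqAle y0 andbT; apply/eqP => e; move: h; rewrite -e sin0 mulr0 ltxx.
have ynp : y < pi / 2.
  rewrite lt_neqAle yp andbT; apply/eqP => e; move: h.
  by rewrite e sin_pihalf (_ : 2 / pi * (pi / 2) = 1) ?ltxx//; field; lra.
have mvt a b : a < b -> exists2 c, a < c < b & sin b - sin a = cos c * (b - a).
  move=> ab; have [|c] := @MVT _ (@sin R) (@cos R) a b ab (fun x _ => is_derive_sin x).
    by apply: continuous_subspaceT => x; exact: continuous_sin.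
  by rewrite in_itv /=; exists c.
have [c1 /andP[c1a c1b] e1] := mvt _ _ yn0.
have [c2 /andP[c2a c2b] e2] := mvt _ _ ynp.
have lt12 : cos c2 < cos c1 by rewrite ltr_cos ?in_itv /=; lra.
have pp : 2 / pi * pi = 2 :> R by field; lra.
move: e1 e2; rewrite sin0 sin_pihalf !subr0 => e1 e2.
have h1 : cos c1 < 2 / pi by rewrite -(ltr_pM2r yn0) -e1.
have h2 : 2 / pi < cos c2.
  have yy : 0 < pi / 2 - y by lra.
  rewrite -(ltr_pM2r yy) -e2; nra.
lra.
Qed.

End Calculus.

(** * Trigonometric polynomials *)
Section TrigPoly.
Context {R : realType}.
Implicit Types (f g : R -> R) (x y a b c : R) (n k M : nat).

Definition trigpoly n f := exists a b : nat -> R, forall x,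
  f x = \sum_(k < n.+1) (a k * cos (k%:R * x) + b k * sin (k%:R * x)).

Lemma trigpolyD n f g :
  trigpoly n f -> trigpoly n g -> trigpoly n (fun x => f x + g x).
Proof.
move=> [a [b hf]] [a' [b' hg]].
exists (fun k => a k + a' k), (fun k => b k + b' k) => x.
by rewrite hf hg -big_split; apply: eq_bigr => k _ /=; ring.
Qed.

Lemma trigpolyZ n c f : trigpoly n f -> trigpoly n (fun x => c * f x).
Proof.
move=> [a [b hf]]; exists (fun k => c * a k), (fun k => c * b k) => x.
by rewrite hf mulr_sumr; apply: eq_bigr => k _ /=; ring.
Qed.

Lemma trigpoly0 n : trigpoly n (fun=> 0).
Proof.
exists (fun=> 0), (fun=> 0) => x; rewrite big1// => k _; ring.
Qed.

Lemma trigpoly_sum n (I : Type) (r : seq I) (F : I -> R -> R) :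
  (forall i, trigpoly n (F i)) -> trigpoly n (fun x => \sum_(i <- r) F i x).
Proof.
move=> h; elim: r => [|i r ih].
  by under eq_fun do rewrite big_nil; exact: trigpoly0.
by under eq_fun do rewrite big_cons; exact: trigpolyD.
Qed.

Lemma trigpoly_cos n k : (k <= n)%N -> trigpoly n (fun x => cos (k%:R * x)).
Proof.
move=> kn; exists (fun j => (j == k)%:R), (fun=> 0) => x.
rewrite (bigD1 (Ordinal (kn : k < n.+1)%N))//= eqxx big1 ?addr0.
  by rewrite mul1r mul0r addr0.
by move=> i; rewrite -val_eqE /= => /negPf ->; rewrite !mul0r addr0.
Qed.

Lemma trigpoly_sin n k : (k <= n)%N -> trigpoly n (fun x => sin (k%:R * x)).
Proof.
move=> kn; exists (fun=> 0), (fun j => (j == k)%:R) => x.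
rewrite (bigD1 (Ordinal (kn : k < n.+1)%N))//= eqxx big1 ?addr0.
  by rewrite mul1r mul0r add0r.
by move=> i; rewrite -val_eqE /= => /negPf ->; rewrite !mul0r addr0.
Qed.

Lemma trigpoly_cst n c : trigpoly n (fun=> c).
Proof.
have := trigpolyZ c (trigpoly_cos (leq0n n)).
by under eq_fun do rewrite mul0r cos0 mulr1.
Qed.

(* The four products are stated for the difference of the smaller frequency
   from the larger one, as natural numbers have no negative differences. *)
Let trigpolyM_basis n k j : (k + j <= n)%N ->
  [/\ trigpoly n (fun x => cos (k%:R * x) * cos (j%:R * x)),
      trigpoly n (fun x => sin (k%:R * x) * sin (j%:R * x))
    & trigpoly n (fun x => sin (k%:R * x) * cos (j%:R * x))].
Proof.
have eqf f g : f =1 g -> trigpoly n f -> trigpoly n g by move=> /funext ->.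
wlog kj : k j / (j <= k)%N.
  move=> wl h; have [|jk] := leqP j k; first by move/wl; exact.
  have [||c s sc] := wl j k; [exact: ltnW|by rewrite addnC|].
  split; [move: c|move: s|].
  - by apply: eqf => x; rewrite mulrC.
  - by apply: eqf => x; rewrite mulrC.
  - apply: (eqf (fun x => sin ((k + j)%:R * x) + (-1) * (sin (j%:R * x) * cos (k%:R * x)))).
      by move=> x; rewrite natrD mulrDl sinD; ring.
    by apply: trigpolyD; [exact: trigpoly_sin|exact: trigpolyZ].
move=> h.
have hd : (k - j <= n)%N by rewrite (leq_trans (leq_subr _ _))// (leq_trans _ h)// leq_addr.
have ed x : (k - j)%:R * x = k%:R * x - j%:R * x by rewrite natrB// mulrBl.
have es x : (k + j)%:R * x = k%:R * x + j%:R * x by rewrite natrD mulrDl.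
split.
- apply: (eqf (fun x => 2^-1 * (cos ((k + j)%:R * x) + cos ((k - j)%:R * x)))).
    by move=> x; rewrite ed es cosB cosD; field.
  by apply: trigpolyZ; apply: trigpolyD; exact: trigpoly_cos.
- apply: (eqf (fun x => 2^-1 * (cos ((k - j)%:R * x) + (-1) * cos ((k + j)%:R * x)))).
    by move=> x; rewrite ed es cosB cosD; field.
  apply: trigpolyZ; apply: trigpolyD; first exact: trigpoly_cos.
  by apply: trigpolyZ; exact: trigpoly_cos.
- apply: (eqf (fun x => 2^-1 * (sin ((k + j)%:R * x) + sin ((k - j)%:R * x)))).
    by move=> x; rewrite ed es sinB sinD; field.
  by apply: trigpolyZ; apply: trigpolyD; exact: trigpoly_sin.
Qed.

Lemma trigpolyM n1 n2 f g : trigpoly n1 f -> trigpoly n2 g ->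
  trigpoly (n1 + n2) (fun x => f x * g x).
Proof.
move=> [a [b hf]] [a' [b' hg]].
have -> : (fun x => f x * g x) = (fun x =>
    \sum_(k < n1.+1) \sum_(j < n2.+1)
      ((a k * a' j) * (cos (k%:R * x) * cos (j%:R * x)) +
       (b k * b' j) * (sin (k%:R * x) * sin (j%:R * x)) +
       (b k * a' j) * (sin (k%:R * x) * cos (j%:R * x)) +
       (a k * b' j) * (sin (j%:R * x) * cos (k%:R * x)))).
  apply/funext => x; rewrite hf hg mulr_suml; apply: eq_bigr => k _.
  by rewrite mulr_sumr; apply: eq_bigr => j _; ring.
apply: trigpoly_sum => k; apply: trigpoly_sum => j.
have kj : (k + j <= n1 + n2)%N by rewrite leq_add// -ltnS.
have [c s sc] := trigpolyM_basis kj.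
have [|_ _ cs] := @trigpolyM_basis (n1 + n2) j k; first by rewrite addnC.
by do 3 (apply: trigpolyD; last exact: trigpolyZ); exact: trigpolyZ.
Qed.

Lemma trigpoly_shift n f c : trigpoly n f -> trigpoly n (fun x => f (x - c)).
Proof.
move=> [a [b hf]].
exists (fun k => a k * cos (k%:R * c) - b k * sin (k%:R * c)),
       (fun k => a k * sin (k%:R * c) + b k * cos (k%:R * c)) => x.
rewrite hf; apply: eq_bigr => k _.
by rewrite mulrBr cosB sinB; ring.
Qed.

Lemma trigpoly_widen n1 n2 f : (n1 <= n2)%N -> trigpoly n1 f -> trigpoly n2 f.
Proof.
move=> h [a [b hf]]; have -> : f = (fun x => \sum_(k < n1.+1)
    (a k * cos (k%:R * x) + b k * sin (k%:R * x))) by apply/funext.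
apply: trigpoly_sum => k; have kn : (k <= n2)%N by rewrite (leq_trans _ h)// -ltnS.
by apply: trigpolyD; apply: trigpolyZ; [exact: trigpoly_cos|exact: trigpoly_sin].
Qed.

(** Reflection changes the sign of the sines only, so that they average out. *)
Lemma trigpoly_even n f : trigpoly n f -> exists a : nat -> R, forall x,
  (f x + f (- x)) / 2 = \sum_(k < n.+1) a k * cos (k%:R * x).
Proof.
move=> [a [b hf]]; exists a => x; rewrite !hf -big_split mulr_suml.
by apply: eq_bigr => k _ /=; rewrite mulrN cosN sinN; field.
Qed.

Lemma cos_periodic_int n (z : int) x :
  cos (n%:R * (x + z%:~R * (pi *+ 2))) = cos (n%:R * x).
Proof.
have h (j : nat) y : cos (y + (pi *+ 2) *+ j) = cos y.
  by rewrite (periodicn (@cosD2pi R)).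
have e (j : nat) : n%:R * (j%:R * (pi *+ 2)) = (pi *+ 2) *+ (n * j) :> R.
  by rewrite -[RHS]mulr_natl natrM mulrA.
rewrite mulrDr; case: z => j; first by rewrite -pmulrn e h.
rewrite -[in LHS](h (n * j.+1)%N) NegzE mulrNz -pmulrn -e; congr cos; ring.
Qed.

(** * The Fejer kernel *)
Definition dirichlet j x : R := 1 + 2 * \sum_(i < j) cos (i.+1%:R * x).
(** Normalized to be [1] at [0]. *)
Definition fejer M x : R := (M%:R ^+ 2)^-1 * \sum_(j < M) dirichlet j x.

Lemma trigpoly_fejer M : trigpoly M.-1 (fejer M).
Proof.
apply: trigpolyZ; apply: trigpoly_sum => j.
apply: trigpolyD; first exact: trigpoly_cst.
apply: trigpolyZ; apply: trigpoly_sum => i; apply: trigpoly_cos.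
by rewrite -ltnS (ltn_predK (ltn_ord j)) (leq_ltn_trans (ltn_ord i)).
Qed.

Lemma fejer_periodic M (z : int) x : fejer M (x + z%:~R * (pi *+ 2)) = fejer M x.
Proof.
congr (_ * _); apply: eq_bigr => j _; congr (_ + _ * _).
by apply: eq_bigr => i _; rewrite cos_periodic_int.
Qed.

Lemma sin_dirichlet j x :
  sin (2^-1 * x) * dirichlet j x = sin ((2 * j%:R + 1) * (2^-1 * x)).
Proof.
elim: j => [|j ih]; first by rewrite /dirichlet big_ord0 !mulr0 addr0 mulr1 add0r mul1r.
rewrite /dirichlet big_ord_recr /= !mulrDr addrA -mulrDr -/(dirichlet j x) ih.
set y := 2^-1 * x.
have -> : (2 * j.+1%:R + 1) * y = j.+1%:R * x + y by rewrite /y; field.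
have -> : (2 * j%:R + 1) * y = j.+1%:R * x - y by rewrite /y -natr1; field.
by rewrite sinB sinD; ring.
Qed.

(** The closed form of the Fejer kernel, multiplied out so that it holds at the
    zeros of the denominator too. *)
Lemma sin2_fejer M x : (0 < M)%N ->
  (M%:R * sin (2^-1 * x)) ^+ 2 * fejer M x = sin (M%:R * (2^-1 * x)) ^+ 2.
Proof.
move=> M0; rewrite /fejer; set y := 2^-1 * x.
have Mn0 : M%:R != 0 :> R by rewrite pnatr_eq0 -lt0n.
rewrite exprMn mulrACA divff ?expf_neq0// mul1r expr2 -mulrA mulr_sumr.
elim: M {M0 Mn0} => [|M ih]; first by rewrite big_ord0 mulr0 mul0r sin0 expr0n.
rewrite big_ord_recr mulrDr ih /= sin_dirichlet -/y.
have -> : M.+1%:R * y = M%:R * y + y by rewrite -natr1; ring.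
have -> : (2 * M%:R + 1) * y = M%:R * y + (M%:R * y + y) by ring.
rewrite (sinD (M%:R * y) (_ + _)) sinD cosD.
apply/eqP; rewrite -subr_eq0.
set S := sin (M%:R * y); set C := cos (M%:R * y).
rewrite (_ : _ - _ = S ^+ 2 * (1 - (cos y ^+ 2 + sin y ^+ 2))); last by ring.
by rewrite cos2Dsin2 subrr mulr0.
Qed.

Lemma sum_dirichlet1 M : \sum_(j < M) (1 + 2 * j%:R) = M%:R ^+ 2 :> R.
Proof.
elim: M => [|M ih]; first by rewrite big_ord0 expr0n.
by rewrite big_ord_recr ih /= -natr1; ring.
Qed.

(** This is [- M^2] times the second derivative of the Fejer kernel at [0]. *)
Lemma sum_dirichlet2 M :
  \sum_(j < M) (2 * \sum_(i < j) i.+1%:R ^+ 2) = M%:R ^+ 2 * (M%:R ^+ 2 - 1) / 6 :> R.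
Proof.
have h (j : nat) : \sum_(i < j) i.+1%:R ^+ 2 = j%:R * (j%:R + 1) * (2 * j%:R + 1) / 6 :> R.
  elim: j => [|j ih]; first by rewrite big_ord0 !mul0r.
  by rewrite big_ord_recr ih /= -natr1; field.
elim: M => [|M ih]; first by rewrite big_ord0 expr0n !mul0r.
by rewrite big_ord_recr ih h /= -natr1; field.
Qed.

Lemma fejer_norm_le1 M x : (0 < M)%N -> `|fejer M x| <= 1.
Proof.
move=> M0; have Mp : 0 < M%:R ^+ 2 :> R by rewrite exprn_gt0// ltr0n.
rewrite normrM gtr0_norm ?invr_gt0// mulrC ler_pdivrMr// mul1r -sum_dirichlet1.
apply: (le_trans (ler_norm_sum _ _ _)); apply: ler_sum => j _.
apply: (le_trans (ler_normD _ _)); rewrite normr1 lerD2l normrM ger0_norm//.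
apply: ler_wpM2l => //; apply: (le_trans (ler_norm_sum _ _ _)).
by apply: (@le_trans _ _ (\sum_(i < j) 1)); [apply: ler_sum => i _; exact: cos_max|
  rewrite sumr_const card_ord].
Qed.

(** Both bounds at the peak come from the Taylor bounds of [cos], applied to each
    frequency; all frequencies are at most [M]. *)
Lemma fejer_ge M x : (0 < M)%N ->
  1 - (M%:R ^+ 2 - 1) / 12 * x ^+ 2 <= fejer M x.
Proof.
move=> M0; have Mp : 0 < M%:R ^+ 2 :> R by rewrite exprn_gt0// ltr0n.
rewrite /fejer [_^-1 * _]mulrC ler_pdivlMr//.
have -> : (1 - (M%:R ^+ 2 - 1) / 12 * x ^+ 2) * M%:R ^+ 2 =
  \sum_(j < M) (1 + 2 * j%:R) -
    x ^+ 2 / 2 * \sum_(j < M) (2 * \sum_(i < j) i.+1%:R ^+ 2).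
  by rewrite sum_dirichlet1 sum_dirichlet2; field.
rewrite mulr_sumr -sumrB; apply: ler_sum => j _; rewrite -addrA lerD2l.
have -> : 2 * j%:R = 2 * \sum_(i < j) 1 :> R by rewrite sumr_const card_ord.
rewrite !mulr_sumr -sumrB; apply: ler_sum => i _.
have := cos_ge_quad (normr_ge0 (i.+1%:R * x)).
rewrite cos_norm real_normK ?num_real//; lra.
Qed.

Lemma fejer_le M x : (0 < M)%N ->
  fejer M x <= 1 - (M%:R ^+ 2 - 1) / 12 * x ^+ 2 * (1 - M%:R ^+ 2 * x ^+ 2 / 12).
Proof.
move=> M0; have Mp : 0 < M%:R ^+ 2 :> R by rewrite exprn_gt0// ltr0n.
rewrite /fejer [_^-1 * _]mulrC ler_pdivrMr//.
have -> : (1 - (M%:R ^+ 2 - 1) / 12 * x ^+ 2 * (1 - M%:R ^+ 2 * x ^+ 2 / 12))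
    * M%:R ^+ 2 =
  \sum_(j < M) (1 + 2 * j%:R) -
    x ^+ 2 / 2 * (1 - M%:R ^+ 2 * x ^+ 2 / 12) *
      \sum_(j < M) (2 * \sum_(i < j) i.+1%:R ^+ 2).
  by rewrite sum_dirichlet1 sum_dirichlet2; field.
rewrite mulr_sumr -sumrB; apply: ler_sum => j _; rewrite -addrA lerD2l.
have -> : 2 * j%:R = 2 * \sum_(i < j) 1 :> R by rewrite sumr_const card_ord.
rewrite !mulr_sumr -sumrB; apply: ler_sum => i _.
have := cos_le_quartic (normr_ge0 (i.+1%:R * x)).
have -> : `|i.+1%:R * x| ^+ 4 = (i.+1%:R * x) ^+ 2 * (i.+1%:R * x) ^+ 2.
  by rewrite -(real_normK (num_real (i.+1%:R * x))); ring.
rewrite cos_norm real_normK ?num_real//.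
have iM : i.+1%:R ^+ 2 <= M%:R ^+ 2 :> R.
  by rewrite ler_sqr ?nnegrE// ler_nat (leq_trans (ltn_ord i))// ltnW.
have q0 : 0 <= (i.+1%:R * x) ^+ 2 * x ^+ 2 :> R by rewrite mulr_ge0// sqr_ge0.
have := ler_wpM2l q0 iM; rewrite !exprMn; lra.
Qed.

End TrigPoly.

(** * The interpolation kernel *)
Section Kernel.
Context {R : realType}.
Variable M : nat.
Hypothesis M0 : (0 < M)%N.
Implicit Types (x y z u : R).

Local Notation Mr := (M%:R : R).

Let Mr_gt0 : 0 < Mr. Proof. by rewrite ltr0n. Qed.

Definition fejer1 x : R :=
  (Mr ^+ 2)^-1 * \sum_(j < M) (2 * \sum_(i < j) - (i.+1%:R * sin (i.+1%:R * x))).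
Definition fejer2 x : R :=
  (Mr ^+ 2)^-1 *
  \sum_(j < M) (2 * \sum_(i < j) - (i.+1%:R * (i.+1%:R * cos (i.+1%:R * x)))).

Lemma der_fejer x : is_derive x 1 (fejer M) (fejer1 x).
Proof.
apply: derZ; apply: der_sum => j _; rewrite -[_ * _]add0r.
apply: derD; apply: derZ; apply: der_sum => i _; exact: der_cosM.
Qed.

Lemma der_fejer1 x : is_derive x 1 fejer1 (fejer2 x).
Proof.
apply: derZ; apply: der_sum => j _; apply: derZ; apply: der_sum => i _.
by apply: derN; apply: derZ; exact: der_sinM.
Qed.

(** The Jackson kernel [ker] carries the prescribed values and the odd kernel
    [kerS] the vanishing derivatives. Both are fourth powers up to [sin], which
    makes their sums over separated nodes converge quickly. *)
Definition ker x : R := fejer M x ^+ 2.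
Definition ker1 x : R := 2 * fejer M x * fejer1 x.
Definition ker2 x : R := 2 * (fejer1 x * fejer1 x + fejer M x * fejer2 x).
Definition kerS x : R := sin x * ker x.
Definition kerS1 x : R := cos x * ker x + sin x * ker1 x.
Definition kerS2 x : R := - sin x * ker x + 2 * (cos x * ker1 x) + sin x * ker2 x.

Lemma der_ker x : is_derive x 1 ker (ker1 x).
Proof.
apply: (der_eq _ (derX 2 (der_fejer x))) => /=.
by rewrite expr1 /ker1; ring.
Qed.

Lemma der_ker1 x : is_derive x 1 ker1 (ker2 x).
Proof.
apply: (der_eq _ (derM (derZ 2 (der_fejer x)) (der_fejer1 x))).
by rewrite /ker2; ring.
Qed.

Lemma der_kerS x : is_derive x 1 kerS (kerS1 x).
Proof. exact: (derM (is_derive_sin x) (der_ker x)). Qed.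

Lemma der_kerS1 x : is_derive x 1 kerS1 (kerS2 x).
Proof.
apply: (der_eq _ (derD (derM (is_derive_cos x) (der_ker x))
                       (derM (is_derive_sin x) (der_ker1 x)))).
by rewrite /kerS2; ring.
Qed.

Lemma trigpoly_ker : trigpoly M.-1.*2 ker.
Proof. by rewrite -addnn; exact: (trigpolyM (trigpoly_fejer M) (trigpoly_fejer M)). Qed.

Lemma trigpoly_kerS : trigpoly M.-1.*2.+1 kerS.
Proof.
have s : trigpoly 1 (@sin R).
  by have := trigpoly_sin (R := R) (leqnn 1); under eq_fun do rewrite mul1r.
exact: (trigpolyM s trigpoly_ker).
Qed.

Lemma fejer0 : fejer M 0 = 1 :> R.
Proof.
apply/eqP; rewrite eq_le; apply/andP; split.
  by apply: le_trans (ler_norm _) _; exact: fejer_norm_le1.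
by have := fejer_ge (0 : R) M0; rewrite expr0n mulr0 subr0.
Qed.

Lemma fejer10 : fejer1 0 = 0.
Proof.
rewrite /fejer1 big1 ?mulr0// => j _; rewrite big1 ?mulr0// => i _.
by rewrite mulr0 sin0 mulr0 oppr0.
Qed.

Lemma ker_0 : ker 0 = 1. Proof. by rewrite /ker fejer0 expr1n. Qed.
Lemma ker1_0 : ker1 0 = 0. Proof. by rewrite /ker1 fejer10 mulr0. Qed.
Lemma kerS_0 : kerS 0 = 0. Proof. by rewrite /kerS sin0 mul0r. Qed.
Lemma kerS1_0 : kerS1 0 = 1.
Proof. by rewrite /kerS1 cos0 sin0 ker_0 mul0r addr0 mulr1. Qed.

Section Decay.
Variable x : R.
Let y := 2^-1 * x.
Let v := Mr * sin y.
Let S := sin (Mr * y).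
Let C := cos (Mr * y).
Hypothesis v0 : v != 0.
Let u := `|v|^-1.

Let Vgt0 : 0 < `|v|. Proof. by rewrite normr_gt0. Qed.
Let ugt0 : 0 < u. Proof. by rewrite invr_gt0. Qed.

(** With [v = M sin (x / 2)] one has [v^4 * ker = sin (M x / 2)^4]. Differentiating
    this product twice, rather than a quotient, gives [ker], [ker1] and [ker2] as
    polynomials in [1 / v] with coefficients bounded uniformly in [M]. *)
Let ker_id z : (Mr * sin (2^-1 * z)) ^+ 4 * ker z = sin (Mr * (2^-1 * z)) ^+ 4.
Proof.
have h := sin2_fejer z M0.
by rewrite /ker -[4%N]/(2 * 2)%N !exprM -exprMn h.
Qed.

Let der_v z : is_derive z 1 (fun z => Mr * sin (2^-1 * z)) (Mr / 2 * cos (2^-1 * z)).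
Proof. by rewrite -mulrA; apply: derZ; exact: der_sinM. Qed.

Let der_v1 z : is_derive z 1 (fun z => Mr / 2 * cos (2^-1 * z))
  (- (Mr / 4 * sin (2^-1 * z))).
Proof.
by apply: (der_eq _ (derZ (Mr / 2) (der_cosM 2^-1 z))); field.
Qed.

Let der_S z : is_derive z 1 (fun z => sin (Mr * (2^-1 * z)))
  (Mr / 2 * cos (Mr * (2^-1 * z))).
Proof.
by under eq_fun do rewrite mulrA; rewrite mulrA; exact: der_sinM.
Qed.

Let der_C z : is_derive z 1 (fun z => cos (Mr * (2^-1 * z)))
  (- (Mr / 2 * sin (Mr * (2^-1 * z)))).
Proof.
by under eq_fun do rewrite mulrA; rewrite mulrA; exact: der_cosM.
Qed.

Let ker1_id z : (Mr * sin (2^-1 * z)) ^+ 4 * ker1 z +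
    2 * Mr * cos (2^-1 * z) * (Mr * sin (2^-1 * z)) ^+ 3 * ker z =
  2 * Mr * sin (Mr * (2^-1 * z)) ^+ 3 * cos (Mr * (2^-1 * z)).
Proof.
have h1 := derM (derX 4 (der_v z)) (der_ker z).
have h2 := derX 4 (der_S z).
move: h1; under eq_fun do rewrite ker_id; move=> h1.
have := @derive_val _ _ _ _ _ _ _ h1; rewrite (@derive_val _ _ _ _ _ _ _ h2) /=.
set A := Mr * sin _; move=> e.
rewrite (_ : _ + _ = 4%:R * A ^+ 3 * (Mr / 2 * cos (2^-1 * z)) * ker z + A ^+ 4 * ker1 z).
  by rewrite -e; field.
by field.
Qed.

Let ker2_id : v ^+ 4 * ker2 x + 4 * Mr * cos y * v ^+ 3 * ker1 x +
    (3 * Mr ^+ 2 * cos y ^+ 2 * v ^+ 2 - v ^+ 4) * ker x =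
  Mr ^+ 2 * (3 * S ^+ 2 * C ^+ 2 - S ^+ 4).
Proof.
have h1 := derD (derM (derX 4 (der_v x)) (der_ker1 x))
  (derM (derM (derZ 4 (der_v1 x)) (derX 3 (der_v x))) (der_ker x)).
have h2 := derM (derZ (2 * Mr) (derX 3 (der_S x))) (der_C x).
move: h1; rewrite (_ : (fun z => _) = (fun z =>
  2 * Mr * sin (Mr * (2^-1 * z)) ^+ 3 * cos (Mr * (2^-1 * z)))); last first.
  by apply/funext => z; rewrite -ker1_id; field.
move=> h1.
have := @derive_val _ _ _ _ _ _ _ h1; rewrite (@derive_val _ _ _ _ _ _ _ h2) /=.
rewrite -/y -/v -/S -/C => e.
transitivity (4%:R * v ^+ 3 * (Mr / 2 * cos y) * ker1 x + v ^+ 4 * ker2 x +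
  ((4 * - (Mr / 4 * sin y) * v ^+ 3 +
    4 * (Mr / 2 * cos y) * (3%:R * v ^+ 2 * (Mr / 2 * cos y))) * ker x +
   4 * (Mr / 2 * cos y) * v ^+ 3 * ker1 x)).
  have -> : v ^+ 4 = v ^+ 3 * (Mr * sin y) by rewrite [LHS]exprSr.
  by field.
by rewrite -e; field.
Qed.

Let SC : S ^+ 2 + C ^+ 2 = 1. Proof. by rewrite addrC cos2Dsin2. Qed.

Let S1 : `|S| <= 1. Proof. exact: sin_max. Qed.

Let normS3C : `|S ^+ 3 * C| <= 2^-1.
Proof.
have s2 : S ^+ 2 <= 1 by move: SC (sqr_ge0 C); lra.
have : (S ^+ 3 * C) ^+ 2 <= 2^-1 ^+ 2.
  have -> : (S ^+ 3 * C) ^+ 2 = S ^+ 2 * S ^+ 2 * (S ^+ 2 * (1 - S ^+ 2)).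
    by rewrite -SC; ring.
  have := sqr_ge0 S; set s := S ^+ 2 in s2 * => s0.
  have h1 : s * (1 - s) <= 2^-1 ^+ 2 by have := sqr_ge0 (s - 2^-1); lra.
  have h0 : 0 <= s * (1 - s) by apply: mulr_ge0; lra.
  have := ler_pM (mulr_ge0 s0 s0) h0 (ler_pM s0 s0 s2 s2) h1.
  by rewrite !mul1r.
move=> h; rewrite -ler_sqr ?nnegrE ?invr_ge0 ?normr_ge0// real_normK ?num_real//.
Qed.

Let kerE : ker x = S ^+ 4 / v ^+ 4.
Proof. by rewrite /S -ker_id -/y -/v mulrAC divff ?mul1r// expf_neq0. Qed.

Let ker1E : ker1 x =
  (2 * Mr * (S ^+ 3 * C) - 2 * Mr * cos y * S ^+ 4 / v) / v ^+ 4.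
Proof.
have := ker1_id x; rewrite -/y -/v -/S -/C => e.
have -> : 2 * Mr * (S ^+ 3 * C) = 2 * Mr * S ^+ 3 * C by ring.
by rewrite -e kerE; field.
Qed.

Let ker2E : ker2 x = (Mr ^+ 2 * (3 * S ^+ 2 * C ^+ 2 - S ^+ 4)
  - 8 * Mr ^+ 2 * cos y * (S ^+ 3 * C) / v
  + 5 * Mr ^+ 2 * cos y ^+ 2 * S ^+ 4 / v ^+ 2 + S ^+ 4) / v ^+ 4.
Proof. by rewrite -ker2_id ker1E kerE; field. Qed.

Let vu n : `|v ^- n| = u ^+ n. Proof. by rewrite normfV normrX exprVn. Qed.

Let cy : `|cos y| <= 1. Proof. exact: cos_max. Qed.
Let S4 : `|S ^+ 4| <= 1. Proof. by rewrite normrX exprn_ile1. Qed.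
Let un0 n : 0 <= u ^+ n. Proof. by rewrite exprn_ge0 ?ltW. Qed.

Lemma ker_decay : `|ker x| <= u ^+ 4.
Proof.
by rewrite kerE normrM vu; apply: ler_piMl.
Qed.

Lemma ker1_decay : `|ker1 x| <= Mr * (u ^+ 4 + 2 * u ^+ 5).
Proof.
have M20 : 0 <= 2 * Mr by rewrite mulr_ge0// ltW.
rewrite ker1E normrM vu.
have -> : Mr * (u ^+ 4 + 2 * u ^+ 5) = (2 * Mr * 2^-1 + 2 * Mr * 1 * 1 * u) * u ^+ 4.
  by field.
apply: ler_wpM2r => //.
apply: (le_trans (ler_normB _ _)); apply: lerD.
  by rewrite normrM ger0_norm ?M20//; apply: ler_wpM2l.
rewrite normrM normfV -/u; apply: ler_wpM2r; first exact: ltW.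
rewrite normrM normrM ger0_norm//; apply: ler_pM => //.
exact: ler_wpM2l.
Qed.

Lemma ker2_decay : `|ker2 x| <= Mr ^+ 2 * (u ^+ 4 + 4 * u ^+ 5 + 5 * u ^+ 6).
Proof.
rewrite ker2E normrM vu.
have -> : Mr ^+ 2 * (u ^+ 4 + 4 * u ^+ 5 + 5 * u ^+ 6) =
  (Mr ^+ 2 + 4 * Mr ^+ 2 * u + 5 * Mr ^+ 2 * u ^+ 2) * u ^+ 4 by ring.
apply: ler_wpM2r => //; rewrite -addrA.
have M2 : 0 <= Mr ^+ 2 by exact: sqr_ge0.
apply: (le_trans (ler_normD _ _)); apply: lerD.
  apply: (le_trans (ler_normB _ _)); apply: lerD.
    rewrite normrM ger0_norm//; apply: ler_piMr => //; rewrite ler_norml.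
    by move: SC (sqr_ge0 S) (sqr_ge0 C); rewrite [S ^+ 4](exprM S 2 2); nra.
  rewrite normrM normfV -/u; apply: ler_wpM2r; first exact: ltW.
  rewrite normrM (_ : 4 * _ = 8 * Mr ^+ 2 * 2^-1); last by field.
  apply: ler_pM => //; rewrite normrM ger0_norm ?mulr_ge0//.
  by apply: ler_piMr => //; rewrite mulr_ge0.
(* as [v = M sin y], the last term joins the one before it, and
   [5 cos^2 y + sin^2 y <= 5] *)
have -> : 5 * Mr ^+ 2 * cos y ^+ 2 * S ^+ 4 / v ^+ 2 + S ^+ 4 =
  S ^+ 4 * (Mr ^+ 2 * (5 * cos y ^+ 2 + sin y ^+ 2)) * v ^- 2.
  have -> : Mr ^+ 2 * (5 * cos y ^+ 2 + sin y ^+ 2) = 5 * Mr ^+ 2 * cos y ^+ 2 + v ^+ 2.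
    by rewrite /v; ring.
  by field.
rewrite normrM vu; apply: ler_wpM2r => //; rewrite normrM -[leRHS]mul1r; apply: ler_pM => //.
have c2 := sqr_ge0 (cos y); have s2 := sqr_ge0 (sin y).
rewrite ger0_norm; last by apply: mulr_ge0 => //; lra.
rewrite mulrC; apply: ler_wpM2r => //.
by have := cos2Dsin2 y; have := sqr_ge0 (sin y); lra.
Qed.

Let sinx : `|sin x| <= 2 / Mr * u^-1.
Proof.
have -> : x = y *+ 2 by rewrite /y -mulr_natl mulVKf.
rewrite sin_mulr2n -mulr_natl !normrM ger0_norm// /u invrK normrM.
rewrite (ger0_norm (ltW Mr_gt0)).
rewrite (_ : 2 / Mr * _ = 2 * `|sin y|); last by field; rewrite gt_eqF.
by apply: ler_wpM2l => //; apply: ler_piMl.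
Qed.

Lemma kerS_decay : Mr * `|kerS x| <= 2 * u ^+ 3.
Proof.
have -> : 2 * u ^+ 3 = Mr * (2 / Mr * u^-1 * u ^+ 4).
  by field; rewrite !gt_eqF.
apply: ler_wpM2l; first exact: ltW.
by rewrite normrM; apply: ler_pM => //; exact: ker_decay.
Qed.

Lemma kerS1_decay : `|kerS1 x| <= 2 * u ^+ 3 + 5 * u ^+ 4.
Proof.
have -> : 2 * u ^+ 3 + 5 * u ^+ 4 =
    1 * u ^+ 4 + 2 / Mr * u^-1 * (Mr * (u ^+ 4 + 2 * u ^+ 5)).
  by field; rewrite !gt_eqF.
apply: (le_trans (ler_normD _ _)); apply: lerD; rewrite normrM; apply: ler_pM => //.
- exact: cos_max.
- exact: ker_decay.
- exact: ker1_decay.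
Qed.

Lemma kerS2_decay : 5 <= Mr ->
  `|kerS2 x| <= Mr * (52 / 25 * u ^+ 3 + 10 * u ^+ 4 + 14 * u ^+ 5).
Proof.
move=> M5.
apply: (@le_trans _ _ (2 / Mr * u^-1 * u ^+ 4 +
    2 * (1 * (Mr * (u ^+ 4 + 2 * u ^+ 5))) +
    2 / Mr * u^-1 * (Mr ^+ 2 * (u ^+ 4 + 4 * u ^+ 5 + 5 * u ^+ 6)))).
  apply: (le_trans (ler_normD _ _)); apply: lerD; last first.
    by rewrite normrM; apply: ler_pM => //; exact: ker2_decay.
  apply: (le_trans (ler_normD _ _)); apply: lerD.
    by rewrite normrM normrN; apply: ler_pM => //; exact: ker_decay.
  rewrite normrM ger0_norm//; apply: ler_wpM2l => //.
  rewrite normrM; apply: ler_pM => //; first exact: cos_max.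
  exact: ker1_decay.
have -> : 2 / Mr * u^-1 * u ^+ 4 = 2 * Mr^-1 * u ^+ 3.
  by field; rewrite !gt_eqF.
have -> : 2 / Mr * u^-1 * (Mr ^+ 2 * (u ^+ 4 + 4 * u ^+ 5 + 5 * u ^+ 6)) =
   Mr * (2 * u ^+ 3 + 8 * u ^+ 4 + 10 * u ^+ 5).
  by field; rewrite !gt_eqF.
(* the lowest order term is absorbed thanks to [M >= 5] *)
have hM : 2 * Mr^-1 <= Mr * (8 / 100).
  by rewrite ler_pdivrMr//; nra.
have := ler_wpM2r (ltW (exprn_gt0 3 ugt0)) hM; lra.
Qed.

End Decay.

Lemma ker_ge0 x : 0 <= ker x. Proof. exact: sqr_ge0. Qed.

Lemma ker_le1 x : ker x <= 1.
Proof. by rewrite /ker -real_normK ?num_real// exprn_ile1// fejer_norm_le1. Qed.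

End Kernel.

(** * Sums over separated nodes *)
Section SeparatedSums.
Context {R : realType}.
Implicit Types (I J : finType) (d g : R).

Lemma fin_max J (f : J -> R) (j0 : J) : exists i, forall j, f j <= f i.
Proof.
exists [arg max_(i > j0) f i]%O.
by case: arg_maxP => // i _ h j; exact: h.
Qed.

Lemma sum_enum J (F : J -> R) : \sum_j F j = \sum_(k < #|J|) F (enum_val k).
Proof.
rewrite (reindex_onto enum_val enum_rank) /=; last by move=> j _; rewrite enum_rankK.
by apply: eq_bigl => j; rewrite enum_valK eqxx.
Qed.

(** Strict diagonal dominance: a kernel vector would be dominated at its largest
    entry by the rest of its row. *)
Lemma diag_dominant_solvable J (A : J -> J -> R) (eta : R) :
  eta < 1 -> (forall i, A i i = 1) ->
  (forall i, \sum_(j | j != i) `|A i j| <= eta) ->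
  forall b : J -> R, exists v : J -> R, forall i, \sum_j A i j * v j = b i.
Proof.
move=> eta1 Aii Arow b.
pose B : 'M[R]_#|J| := \matrix_(i, j) A (enum_val j) (enum_val i).
have Bu : B \in unitmx.
  rewrite -row_free_unit; apply: inj_row_free => u uB.
  apply/rowP => j0; rewrite mxE.
  pose f j := `|u ord0 (enum_rank j)|.
  have [i hi] := fin_max f (enum_val j0).
  have e : \sum_j A i j * u ord0 (enum_rank j) = 0.
    have /rowP/(_ (enum_rank i)) := uB; rewrite !mxE => h; rewrite -[RHS]h.
    by rewrite [LHS]sum_enum; apply: eq_bigr => j _; rewrite mxE ?enum_valK ?enum_rankK mulrC.
  have fi0 : f i <= eta * f i.
    move: e; rewrite (bigD1 i)//= Aii mul1r => /eqP; rewrite addr_eq0 => /eqP e.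
    rewrite {1}/f e normrN; apply: (le_trans (ler_norm_sum _ _ _)).
    apply: (@le_trans _ _ ((\sum_(j | j != i) `|A i j|) * f i)).
      rewrite mulr_suml; apply: ler_sum => j _; rewrite normrM.
      by apply: ler_wpM2l => //; exact: hi.
    by apply: ler_wpM2r => //; exact: normr_ge0.
  have fi : f i <= 0.
    have : 0 <= f i by exact: normr_ge0.
    nra.
  have := le_trans (hi (enum_val j0)) fi.
  by rewrite /f enum_valK normr_le0 => /eqP.
pose r : 'rV[R]_#|J| := \row_k b (enum_val k).
pose w := r *m invmx B.
exists (fun j => w ord0 (enum_rank j)) => i.
have wB : w *m B = r by rewrite /w mulmxKV.
have {wB} : (w *m B) ord0 (enum_rank i) = b i by rewrite wB mxE enum_rankK.
clearbody w; rewrite mxE => <-.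
by rewrite [LHS]sum_enum; apply: eq_bigr => j _; rewrite mxE ?enum_valK ?enum_rankK mulrC.
Qed.

Lemma sum_inj_rank I (B : pred I) (rank : I -> nat) (b : nat -> R) N :
  {in B &, injective rank} -> (forall i, B i -> (0 < rank i < N)%N) ->
  (forall r, 0 <= b r) ->
  \sum_(i | B i) b (rank i) <= \sum_(1 <= r < N) b r.
Proof.
move=> inj hN b0.
pose s := [seq rank i | i <- enum B].
have -> : \sum_(i | B i) b (rank i) = \sum_(r <- s) b r by rewrite big_map big_enum.
have us : uniq s.
  rewrite map_inj_in_uniq ?enum_uniq// => i j.
  by rewrite !mem_enum; exact: inj.
have ss r : r \in s -> r \in index_iota 1 N.
  by move=> /mapP[i]; rewrite mem_enum => /hN h ->; rewrite mem_index_iota.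
rewrite (perm_big [seq r <- index_iota 1 N | r \in s]) /=; last first.
  apply: uniq_perm => //; first by rewrite filter_uniq// iota_uniq.
  by move=> r; rewrite mem_filter andb_idr//; exact: ss.
rewrite big_filter [leRHS](bigID (mem s)) /= lerDl sumr_ge0//.
Qed.

(** Among points on one side of the origin, the quotient of the distance by the
    separation has distinct integer parts, which serve as ranks. *)
Lemma separated_sum I (A : pred I) (y f : I -> R) (b : nat -> R) d g :
  0 < d -> 0 <= g ->
  (forall i, A i -> d - g <= `|y i|) ->
  (forall i j, A i -> A j -> i != j -> d <= `|y i - y j|) ->
  (forall r, 0 <= b r) ->
  (forall i r, A i -> (0 < r)%N -> r%:R * d - g <= `|y i| -> f i <= b r) ->
  exists N, \sum_(i | A i) f i <= 2 * \sum_(1 <= r < N) b r.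
Proof.
move=> d0 g0 dg sep b0 fb.
pose rank i := Num.truncn ((`|y i| + g) / d).
have q0 i : 0 <= (`|y i| + g) / d by rewrite divr_ge0 ?addr_ge0// ltW.
have rank_le i : (rank i)%:R * d - g <= `|y i|.
  by have /andP[h _] := truncn_itv (q0 i); rewrite lerBlDr -ler_pdivlMr.
have rank_gt i : `|y i| < (rank i)%:R * d + d - g.
  have /andP[_ h] := truncn_itv (q0 i).
  by move: h; rewrite ltr_pdivrMr// -/(rank i) -natr1; lra.
have rank0 i : A i -> (0 < rank i)%N.
  move=> Ai; rewrite lt0n; apply/eqP => r0.
  by have := rank_gt i; have := dg _ Ai; rewrite r0; lra.
pose N := (\max_i rank i).+1.
have rankN i : (rank i < N)%N by rewrite ltnS leq_bigmax.
exists N; rewrite (bigID (fun i => 0 <= y i)) /= mulr_natl mulr2n.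
have side (S : pred I) : (forall i j, S i -> S j -> `|y i - y j| = `| `|y i| - `|y j| |) ->
    \sum_(i | A i && S i) f i <= \sum_(1 <= r < N) b r.
  move=> hS; apply: (@le_trans _ _ (\sum_(i | A i && S i) b (rank i))).
    by apply: ler_sum => i /andP[Ai _]; apply: fb => //; exact: rank0.
  apply: sum_inj_rank => // [i j|i]; last by move=> /andP[Ai _]; rewrite rank0 ?rankN.
  rewrite !unfold_in /= => /andP[Ai Si] /andP[Aj Sj] e.
  apply/eqP; apply: contraT => ij; have := sep _ _ Ai Aj ij; rewrite hS// leNgt ltr_norml => /negP [].
  have := rank_le i; have := rank_le j; have := rank_gt i; have := rank_gt j.
  by rewrite e => *; apply/andP; split; lra.
apply: lerD; apply: side => i j.
  by move=> /= i0 j0; rewrite (ger0_norm i0) (ger0_norm j0).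
rewrite /= -!ltNge => i0 j0.
by rewrite (ltr0_norm i0) (ltr0_norm j0) -normrN; congr `|_|; ring.
Qed.

(** As [8 / r^3 <= 8 / ((r - 1) r (r + 1))], the sum telescopes from its second
    term on. *)
Lemma sum_inv_cubes N : \sum_(2 <= r < N) (2 / r%:R) ^+ 3 <= 5 / 3 :> R.
Proof.
have [N2|N2] := leqP N 2; first by rewrite big_geq//; lra.
rewrite -(subnK N2); move: (N - 3)%N => k.
suff : \sum_(2 <= r < k + 3) (2 / r%:R) ^+ 3 <=
    5 / 3 - 4 / ((k%:R + 2) * (k%:R + 3)) :> R.
  move=> /le_trans; apply; rewrite gerBl divr_ge0// mulr_ge0// addr_ge0//.
elim: k => [|k ih].
  by rewrite add0n big_nat1 divff// expr1n !add0r (_ : 5 / 3 - _ = 1)//; field.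
rewrite addSn big_nat_recr ?addn3//=; rewrite -[k.+3]addn3.
apply: (le_trans (lerD ih (lexx _))).
rewrite -[k.+1%:R]natr1 natrD; have k0 : 0 <= k%:R :> R by [].
set t : R := k%:R in k0 *.
rewrite -subr_ge0.
have -> : 5 / 3 - 4 / ((t + 1 + 2) * (t + 1 + 3)) -
  (5 / 3 - 4 / ((t + 2) * (t + 3)) + (2 / (t + 3)) ^+ 3) =
  8 / ((t + 2) * (t + 3) ^+ 3 * (t + 4)).
  by field; do ![apply/andP; split]; apply: lt0r_neq0; lra.
by rewrite divr_ge0// !mulr_ge0 ?exprn_ge0//; lra.
Qed.

(** The shape of all the decay estimates of the kernels, as a function of
    [u = 1 / (M |sin (x / 2)|)]. *)
Definition decay (c3 c4 c5 c6 u : R) : R :=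
  c3 * u ^+ 3 + c4 * u ^+ 4 + c5 * u ^+ 5 + c6 * u ^+ 6.

Lemma decay_mono c3 c4 c5 c6 (u v : R) :
  0 <= c3 -> 0 <= c4 -> 0 <= c5 -> 0 <= c6 -> 0 <= u <= v ->
  decay c3 c4 c5 c6 u <= decay c3 c4 c5 c6 v.
Proof.
move=> h3 h4 h5 h6 /andP[u0 uv].
have v0 := le_trans u0 uv.
have p n : u ^+ n <= v ^+ n by apply: lerXn2r; rewrite ?nnegrE.
by rewrite /decay; do 3 (apply: lerD; last exact: ler_wpM2l); exact: ler_wpM2l.
Qed.

Lemma decay_scale c3 c4 c5 c6 (c u : R) :
  0 <= c3 -> 0 <= c4 -> 0 <= c5 -> 0 <= c6 -> 0 <= c <= 1 -> 0 <= u ->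
  decay c3 c4 c5 c6 (c * u) <= c ^+ 3 * decay c3 c4 c5 c6 u.
Proof.
move=> h3 h4 h5 h6 /andP[c0 c1] u0.
have p n e : 0 <= e -> e * (c * u) ^+ (n + 3) <= c ^+ 3 * (e * u ^+ (n + 3)).
  move=> e0; rewrite exprMn [c ^+ (n + 3)]exprD.
  rewrite [leLHS](_ : _ = c ^+ n * (c ^+ 3 * (e * u ^+ (n + 3)))); last by ring.
  by apply: ler_piMl; rewrite ?mulr_ge0 ?exprn_ge0 ?exprn_ile1.
rewrite /decay !mulrDr.
by do 3 (apply: lerD; last by [exact: (p 1%N)|exact: (p 2%N)|exact: (p 3%N)]);
  exact: (p 0%N).
Qed.

Lemma sin_lower (a b : R) : 0 <= a -> a <= b <= pi / 2 -> a - a ^+ 3 / 6 <= sin b.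
Proof.
move=> a0 /andP[ab bp]; apply: le_trans (sin_ge_cubic a0) _.
have [->//|ne] := eqVneq a b.
have pp := @pi_gt0 R; rewrite ltW// ltr_sin ?in_itv /=; lra.
Qed.

(** Every angle has a representative modulo [2 pi] in [[-pi, pi]], where the
    lower bounds on the sine of the half angle apply. *)
Lemma circle_rep (w : R) : exists z : int, `|w + z%:~R * (pi *+ 2)| <= pi.
Proof.
have p0 := @pi_gt0 R.
have p2 : 0 < pi *+ 2 :> R by rewrite mulrn_wgt0.
pose q := w / (pi *+ 2) + 2^-1.
exists (- Num.floor q).
have /andP[h1 h2] := floor_itv q.
have e : w = (q - 2^-1) * (pi *+ 2) by rewrite /q addrK divfK ?gt_eqF.
rewrite {1}e mulrNz mulNr -mulrBl.
have h3 : (Num.floor q + 1)%:~R = (Num.floor q)%:~R + 1 :> R by rewrite intrD.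
have h4 : pi *+ 2 = 2 * pi :> R by rewrite mulr_natl.
by rewrite h4 ler_norml; apply/andP; split; nra.
Qed.

Lemma sin_half_rep (w : R) (z : int) :
  `|sin (2^-1 * (w + z%:~R * (pi *+ 2)))| = `|sin (2^-1 * w)|.
Proof.
have h (n : nat) y : `|sin (y + pi *+ n)| = `|sin y| :> R.
  by rewrite (alternatingn (@sinDpi R)) normrM normrX normrN1 expr1n mul1r.
case: z => n.
  rewrite -[RHS](h n) -pmulrn; congr `|sin _|.
  by rewrite -[pi *+ n]mulr_natl; field.
rewrite -[LHS](h n.+1) NegzE mulrNz -pmulrn; congr `|sin _|.
by rewrite -[pi *+ n.+1]mulr_natl; field.
Qed.

(** Here [d = 5 pi / (2 M)] is the separation, [g] is how far the evaluation
    point may be from the centre of the excluded node, and [V1], [V2] bound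
    [M |sin (w / 2)|] from below at the nodes of rank one and two. *)
Lemma node_sum I (A : pred I) (w f : I -> R) (M : nat) (g a V1 V2 c3 c4 c5 c6 : R) :
  (5 <= M)%N ->
  let d := 5 * pi / (2 * M%:R) in
  0 <= c3 -> 0 <= c4 -> 0 <= c5 -> 0 <= c6 ->
  0 <= g -> 0 < a <= 39 / 10 -> 2 * a <= M%:R * (d - g) ->
  0 < V1 <= a * (1 - a ^+ 2 / 150) -> 0 < V2 <= 5 - M%:R * g / pi ->
  (forall i (z : int), A i -> d - g <= `|w i + z%:~R * (pi *+ 2)|) ->
  (forall i j (z : int), A i -> A j -> i != j ->
     d <= `|w i - w j + z%:~R * (pi *+ 2)|) ->
  (forall i, A i -> M%:R * sin (2^-1 * w i) != 0 ->
     f i <= decay c3 c4 c5 c6 `|M%:R * sin (2^-1 * w i)|^-1) ->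
  \sum_(i | A i) f i <=
    2 * decay c3 c4 c5 c6 V1^-1 + 10 / 3 * decay c3 c4 c5 c6 V2^-1.
Proof.
move=> M5 d h3 h4 h5 h6 g0 /andP[a0 a39] ag /andP[V10 V1a] /andP[V20 V2g] hd sep hf.
have [p pE] : exists p : R, p = pi by exists pi.
have p0 := @pi_gt0 R; have p312 := @pi_gt_312 R.
rewrite -pE in V2g p0 p312.
have M5r : 5 <= M%:R :> R by rewrite (ler_nat _ 5).
have Mp : 0 < M%:R :> R by lra.
have d0 : 0 < d by rewrite /d -pE divr_gt0// mulr_gt0.
have Md : M%:R * d = 5 / 2 * p by rewrite /d -pE; field; rewrite gt_eqF.
have [zz hz] := choice (fun i => circle_rep (w i)).
pose y i := w i + (zz i)%:~R * (pi *+ 2).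
have yp i : `|y i| <= p by rewrite pE; exact: hz.
pose v i := `|M%:R * sin (2^-1 * w i)|.
have vy i : v i = M%:R * sin (`|y i| / 2).
  rewrite /v normrM (ger0_norm (ltW Mp)); congr (_ * _).
  rewrite -(sin_half_rep (w i) (zz i)) -/(y i).
  have y2 : 0 <= `|y i| / 2 <= pi.
    by rewrite -pE; move: (yp i) (normr_ge0 (y i)) => *; apply/andP; split; lra.
  rewrite -[RHS]ger0_norm ?sin_ge0_pi//.
  have [y0|y0] := leP 0 (y i); first by rewrite (ger0_norm y0) mulrC.
  by rewrite (ltr0_norm y0) mulNr sinN normrN mulrC.
have vV1 i : A i -> V1 <= v i.
  move=> Ai; apply: le_trans V1a _; rewrite vy.
  have h : 2 * a <= M%:R * `|y i|.
    by apply: le_trans ag _; rewrite ler_pM2l//; exact: hd.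
  have aM : a / M%:R <= `|y i| / 2.
    by rewrite ler_pdivrMr//; nra.
  have : a / M%:R - (a / M%:R) ^+ 3 / 6 <= sin (`|y i| / 2).
    apply: sin_lower; first by rewrite divr_ge0 ?ltW.
    by rewrite aM -pE; have := yp i; lra.
  rewrite -(ler_pM2l Mp); apply: le_trans.
  have -> : M%:R * (a / M%:R - (a / M%:R) ^+ 3 / 6) =
     a * (1 - a ^+ 2 * (M%:R ^+ 2)^-1 / 6).
    by field; rewrite gt_eqF.
  apply: ler_wpM2l; first exact: ltW.
  have : (M%:R ^+ 2)^-1 <= 25^-1 :> R.
    by rewrite lef_pV2 ?posrE ?exprn_gt0//; nra.
  by have := sqr_ge0 a; nra.
have vJ i : A i -> M%:R * `|y i| / p <= v i.
  move=> Ai; rewrite vy -mulrA; apply: ler_wpM2l; first exact: ltW.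
  have : 2 / p * (`|y i| / 2) <= sin (`|y i| / 2).
    rewrite pE; apply: jordan_sin; rewrite -pE.
    by move: (yp i) (normr_ge0 (y i)) => *; apply/andP; split; lra.
  by rewrite (_ : 2 / p * _ = `|y i| / p)//; field; rewrite gt_eqF.
have dg : forall i, A i -> d - g <= `|y i| by move=> i; exact: hd.
have sepy i j : A i -> A j -> i != j -> d <= `|y i - y j|.
  move=> Ai Aj ij; have := sep i j (zz i - zz j) Ai Aj ij.
  by rewrite /y intrB mulrBl; congr (_ <= `|_|); ring.
pose q := decay c3 c4 c5 c6.
have q0 u : 0 <= u -> 0 <= q u.
  by move=> u0; rewrite /q /decay !addr_ge0 ?mulr_ge0 ?exprn_ge0.
have qV1 : 0 <= q V1^-1 by apply: q0; rewrite invr_ge0 ltW.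
have qV2 : 0 <= q V2^-1 by apply: q0; rewrite invr_ge0 ltW.
pose b r := if r == 1%N then q V1^-1 else (2 / r%:R) ^+ 3 * q V2^-1.
have b0 r : 0 <= b r.
  rewrite /b; case: ifP => _; first by [].
  by apply: mulr_ge0 => //; apply: exprn_ge0; exact: divr_ge0.
have fb i r : A i -> (0 < r)%N -> r%:R * d - g <= `|y i| -> f i <= b r.
  move=> Ai r0 hr.
  have v0 : 0 < v i := lt_le_trans V10 (vV1 _ Ai).
  apply: (le_trans (hf i Ai _)); first by rewrite -normr_gt0.
  rewrite -/(v i) /b; case: eqP => [_|/eqP r1].
    by apply: decay_mono => //; rewrite invr_ge0 (ltW v0) lef_pV2 ?posrE//= vV1.
  have r2 : 2 <= r%:R :> R by rewrite (ler_nat _ 2) ltn_neqAle eq_sym r1.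
  have rp : 0 < r%:R :> R by rewrite ltr0n.
  apply: le_trans (decay_scale h3 h4 h5 h6 _ _); last 2 first.
  - by rewrite divr_ge0//= ler_pdivrMr// mul1r.
  - by rewrite invr_ge0 ltW.
  apply: decay_mono => //; rewrite invr_ge0 (ltW v0) /=.
  have -> : 2 / r%:R / V2 = (V2 * (r%:R / 2))^-1 by field; rewrite !gt_eqF.
  rewrite lef_pV2 ?posrE ?mulr_gt0 ?divr_gt0//.
  apply: le_trans (vJ _ Ai).
  apply: (@le_trans _ _ (5 / 2 * r%:R - M%:R * g / p)); last first.
    rewrite ler_pdivlMr// mulrBl divfK ?gt_eqF//.
    have := ler_wpM2l (ltW Mp) hr; rewrite mulrBr mulrCA Md; lra.
  have : 0 <= M%:R * g / p by apply: divr_ge0; [apply: mulr_ge0|exact: ltW].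
  by nra.
have [N hN] := separated_sum d0 g0 dg sepy b0 fb.
apply: (le_trans hN).
have [N1|N1] := leqP N 1.
  by rewrite big_geq// mulr0; apply: addr_ge0; apply: mulr_ge0.
rewrite big_ltn// mulrDr {1}/b eqxx lerD2l.
rewrite (eq_big_nat _ _ (F2 := fun r => (2 / r%:R) ^+ 3 * q V2^-1)); last first.
  by move=> r /andP[r2 _]; rewrite /b; case: eqP => // e; rewrite e in r2.
rewrite -mulr_suml mulrA; apply: ler_wpM2r; first by [].
by have := sum_inv_cubes N; lra.
Qed.
End SeparatedSums.

(** * Numerical margins *)
Section Margins.
Context {R : realType}.

(** The bound provided by [node_sum]. It is evaluated in three situations: at a node,
    within [8 / (5 M)] of a node, and at half the separation or more from all the
    nodes of the sum. *)
Definition tail_bound (V1 V2 c3 c4 c5 c6 : R) : R :=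
  2 * decay c3 c4 c5 c6 V1^-1 + 10 / 3 * decay c3 c4 c5 c6 V2^-1.

Lemma tail_node_ker : tail_bound (7 / 2) 5 0 1 0 0 <= 19 / 1000.
Proof. by rewrite /tail_bound /decay; lra. Qed.
Lemma tail_node_kerS : tail_bound (7 / 2) 5 2 0 0 0 <= 147 / 1000.
Proof. by rewrite /tail_bound /decay; lra. Qed.
Lemma tail_node_ker1 : tail_bound (7 / 2) 5 0 1 2 0 <= 29 / 1000.
Proof. by rewrite /tail_bound /decay; lra. Qed.
Lemma tail_node_kerS1 : tail_bound (7 / 2) 5 2 5 0 0 <= 6 / 25.
Proof. by rewrite /tail_bound /decay; lra. Qed.
Lemma tail_near_ker2 : tail_bound (29 / 10) (112 / 25) 0 1 4 5 <= 51 / 500.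
Proof. by rewrite /tail_bound /decay; lra. Qed.
Lemma tail_near_kerS2 :
  tail_bound (29 / 10) (112 / 25) (52 / 25) 10 14 0 <= 97 / 125.
Proof. by rewrite /tail_bound /decay; lra. Qed.
Lemma tail_far_ker : tail_bound (19 / 10) (15 / 4) 0 1 0 0 <= 171 / 1000.
Proof. by rewrite /tail_bound /decay; lra. Qed.
Lemma tail_far_kerS : tail_bound (19 / 10) (15 / 4) 2 0 0 0 <= 71 / 100.
Proof. by rewrite /tail_bound /decay; lra. Qed.

(** [A] and [B] stand for the largest coefficients of the two kernels. *)
Lemma coef_bounds (A B : R) : 0 <= A -> 0 <= B ->
  A <= A * (19 / 1000) + B * (147 / 1000) + 1 ->
  B <= A * (29 / 1000) + B * (6 / 25) ->
  A * (19 / 1000) + B * (147 / 1000) <= 13 / 500 /\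
  A * (29 / 1000) + B * (6 / 25) <= 1 / 25.
Proof. by move=> A0 B0 hA hB; split; lra. Qed.

Lemma row_margins : (19 / 1000 + 147 / 1000 <= 27 / 100 :> R) *
  (29 / 1000 + 6 / 25 <= 27 / 100 :> R) * (27 / 100 < 1 :> R).
Proof. by do !split; lra. Qed.

End Margins.

(** * Interpolation of signs on the circle *)
Section CircleCertificate.
Context {R : realType}.
Variables (M : nat) (I : finType) (x : I -> R).
Hypothesis M5 : (5 <= M)%N.
Hypothesis sep : forall (i j : I) (z : int), i != j ->
  5 * pi / (2 * M%:R) <= `|x i - x j + z%:~R * (pi *+ 2)|.
Implicit Types (i j k : I) (th t : R).

Local Notation Mr := (M%:R : R).
Local Notation d := (5 * pi / (2 * Mr)).
Local Notation K := (@ker R M).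
Local Notation K1 := (@ker1 R M).
Local Notation K2 := (@ker2 R M).
Local Notation S := (@kerS R M).
Local Notation S1 := (@kerS1 R M).
Local Notation S2 := (@kerS2 R M).

Let M0 : (0 < M)%N. Proof. exact: leq_trans M5. Qed.
Let Mr5 : 5 <= Mr. Proof. by rewrite (ler_nat _ 5). Qed.
Let Mr0 : 0 < Mr. Proof. by rewrite ltr0n. Qed.

(* The products [M d] and [pi] enter the estimates only through these. *)
Let p0 : 0 < pi :> R. Proof. exact: pi_gt0. Qed.
Let Md : Mr * d = 5 / 2 * pi.
Proof. by move: p0; move: (@pi R) => p p0'; field; rewrite gt_eqF. Qed.
Let Md78 : 39 / 5 <= Mr * d.
Proof. by rewrite Md; have := @pi_gt_312 R; move: (@pi R) => p; lra. Qed.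
Let d0 : 0 < d.
Proof. by apply: divr_gt0; apply: mulr_gt0. Qed.

Definition regime (A : pred I) th V1 V2 := forall (f : I -> R) c3 c4 c5 c6,
  0 <= c3 -> 0 <= c4 -> 0 <= c5 -> 0 <= c6 ->
  (forall j, A j -> Mr * sin (2^-1 * (th - x j)) != 0 ->
    f j <= decay c3 c4 c5 c6 `|Mr * sin (2^-1 * (th - x j))|^-1) ->
  \sum_(j | A j) f j <=
    tail_bound V1 V2 c3 c4 c5 c6.

Let regimeP (A : pred I) th g a V1 V2 :
  0 <= g -> 0 < a <= 39 / 10 -> 2 * a <= Mr * (d - g) ->
  0 < V1 <= a * (1 - a ^+ 2 / 150) -> 0 < V2 <= 5 - Mr * g / pi ->
  (forall j (z : int), A j -> d - g <= `|th - x j + z%:~R * (pi *+ 2)|) ->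
  regime A th V1 V2.
Proof.
move=> g0 a0 ag hV1 hV2 hd f c3 c4 c5 c6 h3 h4 h5 h6 hf.
apply: (node_sum (w := fun j => th - x j) M5 h3 h4 h5 h6 g0 a0 ag hV1 hV2) => //.
move=> i j z _ _ ij; have := sep (- z) ij.
rewrite -normrN mulrNz mulNr; congr (_ <= `|_|); ring.
Qed.

Lemma regime_node k : regime (fun j => j != k) (x k) (7 / 2) 5.
Proof.
apply: (@regimeP _ _ 0 (39 / 10)).
- by [].
- by apply/andP; split; lra.
- by rewrite subr0; apply: le_trans Md78; lra.
- by apply/andP; split; lra.
- by rewrite mulr0 mul0r subr0 lexx andbT.
- by move=> j z jk; rewrite subr0; apply: sep; rewrite eq_sym.
Qed.

Lemma regime_near k t : `|t| <= 8 / 5 / Mr ->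
  regime (fun j => j != k) (x k + t) (29 / 10) (112 / 25).
Proof.
move=> ht.
have Mg : Mr * (8 / 5 / Mr) = 8 / 5 by rewrite mulrCA divff ?mulr1// gt_eqF.
apply: (@regimeP _ _ (8 / 5 / Mr) (31 / 10)).
- by rewrite divr_ge0// ltW.
- by apply/andP; split; lra.
- by rewrite mulrBr Mg; move: Md78; lra.
- by apply/andP; split; lra.
- rewrite Mg; apply/andP; split; first by lra.
  have : 8 / 5 / pi <= 13 / 25 :> R.
    by rewrite ler_pdivrMr//; have := @pi_gt_312 R; move: (@pi R) => p; lra.
  by move: (8 / 5 / pi) => e; lra.
- move=> j z jk; have := sep z (_ : k != j); rewrite eq_sym => /(_ jk) h.
  rewrite lerBlDr; apply: (le_trans h).
  have -> : x k - x j + z%:~R * (pi *+ 2) =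
     (x k + t - x j + z%:~R * (pi *+ 2)) - t by ring.
  by apply: (le_trans (ler_normB _ _)); rewrite lerD2l.
Qed.

Lemma regime_far (A : pred I) th :
  (forall j (z : int), A j -> d / 2 <= `|th - x j + z%:~R * (pi *+ 2)|) ->
  regime A th (19 / 10) (15 / 4).
Proof.
move=> h; apply: (@regimeP _ _ (d / 2) (39 / 20)).
- by rewrite divr_ge0// ltW.
- by apply/andP; split; lra.
- have -> : Mr * (d - d / 2) = (Mr * d) / 2 by field; rewrite gt_eqF.
  by move: Md78; lra.
- by apply/andP; split; lra.
- rewrite mulrA Md; apply/andP; split; first by lra.
  rewrite (_ : _ / pi = 5 / 4); first by lra.
  by move: p0; move: (@pi R) => p p0'; field; rewrite gt_eqF.
- move=> j z Aj; have := h _ z Aj; move: (5 * pi / _) => e; lra.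
Qed.

Lemma sum_ker_regime A th V1 V2 : regime A th V1 V2 ->
  \sum_(j | A j) `|K (th - x j)| <=
    tail_bound V1 V2 0 1 0 0.
Proof.
move=> h; apply: h => // j _ v0; apply: (le_trans (ker_decay M0 v0)).
by rewrite /decay !mul0r mul1r addr0 add0r addr0.
Qed.

Lemma sum_kerS_regime A th V1 V2 : regime A th V1 V2 ->
  \sum_(j | A j) `|Mr * S (th - x j)| <=
    tail_bound V1 V2 2 0 0 0.
Proof.
move=> h; apply: h => // j _ v0; rewrite normrM (ger0_norm (ltW Mr0)).
apply: (le_trans (kerS_decay M0 v0)).
by rewrite /decay !mul0r !addr0.
Qed.

Lemma sum_ker1_regime A th V1 V2 : regime A th V1 V2 ->
  \sum_(j | A j) `|K1 (th - x j) / Mr| <=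
    tail_bound V1 V2 0 1 2 0.
Proof.
move=> h; apply: h => // j _ v0; rewrite normrM normfV (ger0_norm (ltW Mr0)).
rewrite ler_pdivrMr//; apply: (le_trans (ker1_decay M0 v0)).
by rewrite /decay !mul0r mul1r addr0 add0r mulrC.
Qed.

Lemma sum_kerS1_regime A th V1 V2 : regime A th V1 V2 ->
  \sum_(j | A j) `|S1 (th - x j)| <=
    tail_bound V1 V2 2 5 0 0.
Proof.
move=> h; apply: h => // j _ v0; apply: (le_trans (kerS1_decay M0 v0)).
by rewrite /decay !mul0r !addr0.
Qed.

Lemma sum_ker2_regime A th V1 V2 : regime A th V1 V2 ->
  \sum_(j | A j) `|K2 (th - x j) / Mr ^+ 2| <=
    tail_bound V1 V2 0 1 4 5.
Proof.
move=> h; apply: h => // j _ v0.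
rewrite normrM normfV (ger0_norm (sqr_ge0 _)) ler_pdivrMr ?exprn_gt0//.
apply: (le_trans (ker2_decay M0 v0)).
by rewrite /decay !mul0r mul1r add0r mulrC.
Qed.

Lemma sum_kerS2_regime A th V1 V2 : regime A th V1 V2 ->
  \sum_(j | A j) `|S2 (th - x j) / Mr| <=
    tail_bound V1 V2 (52 / 25) 10 14 0.
Proof.
move=> h; apply: h; [by lra|by []|by []|by []|move=> j _ v0].
rewrite normrM normfV (ger0_norm (ltW Mr0)) ler_pdivrMr//.
apply: (le_trans (kerS2_decay M0 v0 Mr5)).
by rewrite /decay !mul0r addr0 mulrC.
Qed.

Definition interpolant (a b : I -> R) th :=
  \sum_j (a j * K (th - x j) + b j * (Mr * S (th - x j))).
Definition interpolant1 (a b : I -> R) th :=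
  \sum_j (a j * (K1 (th - x j) / Mr) + b j * S1 (th - x j)).

Lemma sum_dir (J : finType) (F : bool * J -> R) :
  \sum_c F c = \sum_j F (false, j) + \sum_j F (true, j).
Proof.
rewrite (eq_bigr (fun c => F (c.1, c.2))); last by case.
by rewrite -(pair_bigA _ (fun (e : bool) (j : J) => F (e, j))) /= big_bool /= addrC.
Qed.

Lemma sum_weighted (A : pred I) (a b f g : I -> R) (a0 b0 sf sg : R) :
  (forall j, `|a j| <= a0) -> (forall j, `|b j| <= b0) ->
  \sum_(j | A j) `|f j| <= sf -> \sum_(j | A j) `|g j| <= sg ->
  0 <= a0 -> 0 <= b0 ->
  `|\sum_(j | A j) (a j * f j + b j * g j)| <= a0 * sf + b0 * sg.
Proof.
move=> ha hb hf hg a00 b00; rewrite big_split /=.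
apply: (le_trans (ler_normD _ _)).
have bnd (c h : I -> R) c0 sh : (forall j, `|c j| <= c0) ->
    \sum_(j | A j) `|h j| <= sh -> 0 <= c0 ->
    `|\sum_(j | A j) c j * h j| <= c0 * sh.
  move=> hc hh c00; apply: (le_trans (ler_norm_sum _ _ _)).
  apply: (@le_trans _ _ (c0 * \sum_(j | A j) `|h j|)); last exact: ler_wpM2l.
  rewrite mulr_sumr; apply: ler_sum => j _; rewrite normrM.
  exact: ler_wpM2r.
by apply: lerD; exact: bnd.
Qed.

(** The equations for the values and for the derivatives, divided by [M], form a
    square system whose diagonal entries are [1]. By the decay of the kernels the rest
    of each row sums to at most [27/100], so the system is solvable; reading the
    equations again at the largest coefficients bounds the solution. *)
Lemma interpolation (eps : I -> R) : (forall k, `|eps k| <= 1) ->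
  exists a b : I -> R,
  [/\ forall k, interpolant a b (x k) = eps k,
      forall k, interpolant1 a b (x k) = 0,
      forall k, `|a k - eps k| <= 13 / 500
    & forall k, `|b k| <= 1 / 25].
Proof.
move=> he.
pose A (r c : bool * I) : R := let y := x r.2 - x c.2 in
  if r.1 then (if c.1 then S1 y else K1 y / Mr)
  else (if c.1 then Mr * S y else K y).
have Aii r : A r r = 1.
  by rewrite /A subrr; case: r.1; rewrite ?kerS1_0 ?ker_0.
have hk k := sum_ker_regime (@regime_node k).
have hS k := sum_kerS_regime (@regime_node k).
have hk1 k := sum_ker1_regime (@regime_node k).
have hS1 k := sum_kerS1_regime (@regime_node k).
have {}hk k := le_trans (hk k) tail_node_ker. have {}hS k := le_trans (hS k) tail_node_kerS.
have {}hk1 k := le_trans (hk1 k) tail_node_ker1. have {}hS1 k := le_trans (hS1 k) tail_node_kerS1.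
have Arow r : \sum_(c | c != r) `|A r c| <= 27 / 100.
  have e1 : \sum_c `|A r c| = 1 + \sum_(c | c != r) `|A r c|.
    by rewrite (bigD1 r)//= Aii normr1.
  have e2 : \sum_c `|A r c| =
      `|A r (false, r.2)| + \sum_(j | j != r.2) `|A r (false, j)| +
      (`|A r (true, r.2)| + \sum_(j | j != r.2) `|A r (true, j)|).
    by rewrite sum_dir (bigD1 r.2)//= [X in _ + X](bigD1 r.2).
  have e3 : `|A r (false, r.2)| + `|A r (true, r.2)| = 1.
    rewrite /A /= subrr; case: r.1.
      by rewrite ker1_0// mul0r normr0 kerS1_0// normr1 add0r.
    by rewrite kerS_0// mulr0 normr0 ker_0// normr1 addr0.
  have -> : \sum_(c | c != r) `|A r c| =
      \sum_(j | j != r.2) `|A r (false, j)| + \sum_(j | j != r.2) `|A r (true, j)|.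
    by apply: (@addrI _ 1); rewrite -e1 e2 -e3 addrACA.
  clear e1 e2 e3; rewrite /A /=; case: r.1.
    by apply: le_trans (lerD (hk1 r.2) (hS1 r.2)) _; rewrite row_margins.
  by apply: le_trans (lerD (hk r.2) (hS r.2)) _; rewrite row_margins.
have [|v hv] := diag_dominant_solvable (_ : 27 / 100 < 1) Aii Arow
  (fun r => if r.1 then 0 else eps r.2); first by rewrite row_margins.
pose a j := v (false, j); pose b j := v (true, j).
have ha k : interpolant a b (x k) = eps k.
  have := hv (false, k); rewrite sum_dir -big_split /= => <-.
  by apply: eq_bigr => j _; rewrite mulrC [in X in _ + X]mulrC.
have hb k : interpolant1 a b (x k) = 0.
  have := hv (true, k); rewrite sum_dir -big_split /= => <-.
  by apply: eq_bigr => j _; rewrite mulrC [in X in _ + X]mulrC.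
have ak k : a k - eps k =
    - \sum_(j | j != k) (a j * K (x k - x j) + b j * (Mr * S (x k - x j))).
  rewrite -(ha k) /interpolant (bigD1 k)//= subrr ker_0// kerS_0 !mulr0; ring.
have bk k : b k =
    - \sum_(j | j != k) (a j * (K1 (x k - x j) / Mr) + b j * S1 (x k - x j)).
  apply/eqP; rewrite -addr_eq0; apply/eqP; rewrite -[RHS](hb k).
  by rewrite /interpolant1 [RHS](bigD1 k)//= subrr ker1_0// kerS1_0// mul0r mulr0 add0r mulr1.
exists a, b; split; [exact: ha|exact: hb| |] => k.
all: have [ka hka] := fin_max (fun j => `|a j|) k.
all: have [kb hkb] := fin_max (fun j => `|b j|) k.
all: set A0 := `|a ka| in hka; set B0 := `|b kb| in hkb.
all: have A00 : 0 <= A0 by exact: normr_ge0.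
all: have B00 : 0 <= B0 by exact: normr_ge0.
all: have dev i : `|a i - eps i| <= A0 * (19 / 1000) + B0 * (147 / 1000)
  by rewrite ak normrN; exact: sum_weighted.
all: have devb i : `|b i| <= A0 * (29 / 1000) + B0 * (6 / 25)
  by rewrite bk normrN; exact: sum_weighted.
all: have hA : A0 <= A0 * (19 / 1000) + B0 * (147 / 1000) + 1
  by have := ler_normD (a ka - eps ka) (eps ka); rewrite subrK => h;
     apply: (le_trans h); apply: lerD; [exact: dev|exact: he].
all: have hB := devb kb; rewrite -/B0 in hB.
- exact: le_trans (dev k) (coef_bounds A00 B00 hA hB).1.
- exact: le_trans (devb k) (coef_bounds A00 B00 hA hB).2.
Qed.

End CircleCertificate.

(** * The kernel at its peak and away from it *)
Section KernelProfile.
Context {R : realType}.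
Variable M : nat.
Hypothesis M5 : (5 <= M)%N.
Implicit Types (t w y z F c : R).

Local Notation Mr := (M%:R : R).

Let M0 : (0 < M)%N. Proof. exact: leq_trans M5. Qed.
Let Mr5 : 5 <= Mr. Proof. by rewrite (ler_nat _ 5). Qed.
Let Mr0 : 0 < Mr. Proof. by rewrite ltr0n. Qed.
Let M25 : 25 <= Mr ^+ 2. Proof. by move: Mr5; move: (Mr) => q; nra. Qed.
Let M25V : (Mr ^+ 2)^-1 <= 25^-1.
Proof. by rewrite lef_pV2 ?posrE ?exprn_gt0. Qed.

Lemma sqr_scale_le t c : 0 <= c -> `|t| <= c / Mr -> Mr ^+ 2 * t ^+ 2 <= c ^+ 2.
Proof.
move=> c0; rewrite ler_pdivlMr// => h.
rewrite -exprMn -real_normK ?num_real// lerXn2r ?nnegrE//.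
by rewrite normrM (ger0_norm (ltW Mr0)) mulrC.
Qed.

Lemma fejer_profile t z : z = Mr ^+ 2 * t ^+ 2 -> z <= 12 ->
  1 - z / 12 <= fejer M t <= 1 - 2 / 25 * z * (1 - z / 12).
Proof.
move=> zE z12; move: M25 (sqr_ge0 t) => M25' t0.
apply/andP; split.
  by apply: le_trans (fejer_ge t M0); rewrite zE; move: (Mr ^+ 2) M25' => q; nra.
apply: (le_trans (fejer_le t M0)); rewrite lerD2l lerN2 -zE.
apply: ler_wpM2r; first by lra.
rewrite zE; move: (Mr ^+ 2) M25' => q; nra.
Qed.

Let profile_square F z : 0 <= z <= 64 / 25 ->
  1 - z / 12 <= F <= 1 - 2 / 25 * z * (1 - z / 12) ->
  11 / 100 * z <= 1 - F ^+ 2 <= z / 6.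
Proof.
move=> /andP[z0 z1] /andP[h1 h2].
have F1 : F <= 1 by nra.
have h3 : 62 / 1000 * z <= 1 - F by nra.
by apply/andP; split; nra.
Qed.

Lemma ker_profile t z : z = Mr ^+ 2 * t ^+ 2 -> `|t| <= 8 / 5 / Mr ->
  11 / 100 * z <= 1 - ker M t <= z / 6.
Proof.
move=> zE ht; have z2 : z <= 64 / 25.
  by rewrite zE; apply: (le_trans (sqr_scale_le _ ht)); lra.
have z0 : 0 <= z by rewrite zE mulr_ge0 ?sqr_ge0.
apply: profile_square; first by rewrite z0.
by apply: (fejer_profile zE); apply: (le_trans z2); lra.
Qed.

(** For [M |y| <= 3] the quartic bound at the peak is still good enough; beyond, the
    closed form applies, with [M sin (y / 2)] of square at least [2]. *)
Lemma fejer_far y : 8 / 5 / Mr <= `|y| <= pi -> `|fejer M y| <= 839 / 1000.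
Proof.
move=> /andP[h1 h2].
have [h3|h3] := leP `|y| (3 / Mr).
  have z9 : Mr ^+ 2 * y ^+ 2 <= 9.
    by apply: (le_trans (sqr_scale_le _ h3)); lra.
  have z2 : 64 / 25 <= Mr ^+ 2 * y ^+ 2.
    rewrite -exprMn -real_normK ?num_real// normrM (ger0_norm (ltW Mr0)).
    move: h1; rewrite ler_pdivrMr// [`|y| * _]mulrC => h1.
    have -> : 64 / 25 = (8 / 5) ^+ 2 :> R by field.
    have q0 : 0 <= 8 / 5 :> R by lra.
    by apply: lerXn2r => //; rewrite nnegrE; exact: le_trans h1.
  have /andP[] : 1 - Mr ^+ 2 * y ^+ 2 / 12 <= fejer M y <=
      1 - 2 / 25 * (Mr ^+ 2 * y ^+ 2) * (1 - Mr ^+ 2 * y ^+ 2 / 12).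
    by apply: fejer_profile => //; apply: (le_trans z9); lra.
  move: (Mr ^+ 2 * y ^+ 2) z2 z9 => z z2 z9 f1 f2.
  have f3 : 161 / 80 <= z * (1 - z / 12) by nra.
  by rewrite ler_norml; apply/andP; split; lra.
pose v := Mr * sin (2^-1 * y).
have v2F : v ^+ 2 * fejer M y <= 1.
  by rewrite /v sin2_fejer// -real_normK ?num_real// exprn_ile1// sin_max.
have v2F0 : 0 <= v ^+ 2 * fejer M y by rewrite /v sin2_fejer// sqr_ge0.
have vE : v ^+ 2 = (Mr * sin (`|y| / 2)) ^+ 2.
  rewrite /v; have [y0|y0] := leP 0 y; first by rewrite ger0_norm// [y / 2]mulrC.
  by rewrite ltr0_norm// mulNr sinN mulrN sqrrN [y / 2]mulrC.
have hs : 3 / 2 / Mr - (3 / 2 / Mr) ^+ 3 / 6 <= sin (`|y| / 2).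
  apply: sin_lower; first by rewrite divr_ge0 ?ltW//; lra.
  apply/andP; split; last by rewrite ler_wpM2r.
  rewrite [leLHS](_ : _ = 3 / Mr / 2); last by rewrite mulrAC.
  by rewrite ler_wpM2r// ltW.
have v2 : 2 <= v ^+ 2.
  have e : Mr * (3 / 2 / Mr - (3 / 2 / Mr) ^+ 3 / 6) = 3 / 2 - 9 / 16 * (Mr ^+ 2)^-1.
    by field; rewrite gt_eqF.
  have := ler_wpM2l (ltW Mr0) hs; rewrite e vE.
  move: (Mr * sin _) ((Mr ^+ 2)^-1) M25V => u i; nra.
have F0 : 0 <= fejer M y by nra.
rewrite ger0_norm//; nra.
Qed.

Lemma ker_far w : (forall k : int, 8 / 5 / Mr <= `|w + k%:~R * (pi *+ 2)|) ->
  ker M w <= 88 / 125 /\ `|Mr * kerS M w| <= 42 / 25.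
Proof.
move=> h; have [k hk] := circle_rep w.
have F839 : `|fejer M w| <= 839 / 1000.
  by rewrite -(fejer_periodic M k w); apply: fejer_far; rewrite h hk.
have F2 : ker M w <= 88 / 125.
  rewrite /ker -real_normK ?num_real//.
  by have := normr_ge0 (fejer M w); nra.
split=> //.
pose v := Mr * sin (2^-1 * w).
have vF : `|v * fejer M w| <= 1.
  rewrite -(@expr_le1 _ 2)// real_normK ?num_real//.
  rewrite exprMn [fejer M w ^+ 2]expr2 mulrA /v sin2_fejer//.
  have := fejer_norm_le1 w M0; rewrite ler_norml => /andP[f1 f2].
  have := sin_max (Mr * (2^-1 * w)); rewrite ler_norml => /andP[s1 s2].
  move: (sin _) (fejer M w) f1 f2 s1 s2 => s f f1 f2 s1 s2.
  have : s ^+ 2 <= 1 by nra.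
  have := sqr_ge0 s; nra.
have -> : Mr * kerS M w = 2 * (v * fejer M w) * (cos (2^-1 * w) * fejer M w).
  rewrite /kerS /ker /v.
  have -> : sin w = 2 * (cos (2^-1 * w) * sin (2^-1 * w)).
    rewrite mulr_natl -sin_mulr2n; congr sin.
    by rewrite -[RHS]mulr_natl; field.
  ring.
rewrite normrM normrM (ger0_norm (_ : 0 <= 2))//.
have c1 := cos_max (2^-1 * w).
have : `|cos (2^-1 * w) * fejer M w| <= 839 / 1000.
  by rewrite normrM -[leRHS]mul1r ler_pM.
move: vF; move: (`|v * _|) (normr_ge0 (v * fejer M w)) => a a0 a1.
move: (`|cos _ * _|) (normr_ge0 (cos (2^-1 * w) * fejer M w)) => c' c0 c1'.
nra.
Qed.

End KernelProfile.

(** * The dual certificate on the circle *)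
Section ProfileMargins.
Context {R : realType}.

Lemma abs_sub_sin (t : R) : `|t - sin t| <= `|t| ^+ 3 / 6.
Proof.
wlog t0 : t / 0 <= t.
  move=> wl; have [|t0] := leP 0 t; first exact: wl.
  have e : - t - sin (- t) = - (t - sin t) by rewrite sinN; ring.
  by have := wl (- t); rewrite e !normrN; apply; lra.
rewrite (ger0_norm t0); have h1 := sin_le_id t0; have h2 := sin_ge_cubic t0.
by rewrite ger0_norm; lra.
Qed.

(** Here [a], [b] are the coefficients at the node considered, [o] is the contribution
    of all the other nodes, and [o - (1 - a) + b * u] its second order remainder. The
    concave peak of [a * K] outweighs the other terms. *)
Lemma near_margin (a b K s u o z : R) : `|a - 1| <= 13 / 500 -> `|b| <= 1 / 25 ->
  0 <= z -> 11 / 100 * z <= 1 - K <= z / 6 ->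
  `|u - s| <= 8 / 5 * (1 - K) + 8 / 5 / 150 * z ->
  `|o - (1 - a) + b * u| <= 17 / 250 * z ->
  1 - 3 / 10 * z <= a * K + b * s + o <= 1 - z / 50.
Proof.
move=> ha hb z0 /andP[k1 k2] hu ho.
have : `|b * (u - s)| <= 1 / 25 * (8 / 5 * (1 - K) + 8 / 5 / 150 * z).
  by rewrite normrM ler_pM.
move: ha ho; rewrite !ler_norml => /andP[a1 a2] /andP[r1 r2] /andP[b1 b2].
have e : a * K + b * s + o = 1 - a * (1 - K) - b * (u - s) + (o - (1 - a) + b * u).
  by ring.
have D0 : 0 <= 1 - K by lra.
have m1 : 487 / 500 * (1 - K) <= a * (1 - K) by apply: ler_wpM2r => //; lra.
have m2 : a * (1 - K) <= 513 / 500 * (1 - K) by apply: ler_wpM2r => //; lra.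
move: (a * (1 - K)) (b * (u - s)) (o - (1 - a) + b * u) b1 b2 r1 r2 m1 m2 e.
move=> A B C b1 b2 r1 r2 m1 m2 ->.
by apply/andP; split; lra.
Qed.

Lemma remainder_margin : 513 / 500 * (51 / 500) + 1 / 25 * (97 / 125)
  <= 17 / 125 :> R.
Proof. by lra. Qed.

Lemma coef_ge0 : (0 <= 513 / 500 :> R) * (0 <= 1 / 25 :> R).
Proof. by split; lra. Qed.

Lemma far_margin (a b K s o : R) : `|a| <= 513 / 500 -> `|b| <= 1 / 25 ->
  0 <= K <= 88 / 125 -> `|s| <= 42 / 25 ->
  `|o| <= 513 / 500 * (171 / 1000) + 1 / 25 * (71 / 100) ->
  `|a * K + b * s + o| <= 497 / 500.
Proof.
move=> ha hb /andP[k0 k1] hs ho.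
apply: (le_trans (ler_normD _ _)).
apply: (@le_trans _ _ (513 / 500 * (88 / 125) + 1 / 25 * (42 / 25) +
  (513 / 500 * (171 / 1000) + 1 / 25 * (71 / 100)))); last by lra.
apply: lerD => //; apply: (le_trans (ler_normD _ _)); rewrite !normrM.
by apply: lerD; apply: ler_pM => //; rewrite ger0_norm.
Qed.

End ProfileMargins.

Section InterpolantProfile.
Context {R : realType}.
Variables (M : nat) (I : finType) (x : I -> R).
Hypothesis M5 : (5 <= M)%N.
Hypothesis sep : forall (i j : I) (z : int), i != j ->
  5 * pi / (2 * M%:R) <= `|x i - x j + z%:~R * (pi *+ 2)|.
Variables (a b : I -> R).
Implicit Types (i j k : I) (th t u : R).

Local Notation Mr := (M%:R : R).
Local Notation K := (@ker R M).
Local Notation S := (@kerS R M).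
Local Notation p := (interpolant M x a b).

Let M0 : (0 < M)%N. Proof. exact: leq_trans M5. Qed.
Let Mr5 : 5 <= Mr. Proof. by rewrite (ler_nat _ 5). Qed.
Let Mr0 : 0 < Mr. Proof. by rewrite ltr0n. Qed.

Variable eps : I -> R.
Hypothesis eps1 : forall k, `|eps k| = 1.
Hypothesis ha : forall k, `|a k - eps k| <= 13 / 500.
Hypothesis hb : forall k, `|b k| <= 1 / 25.
Hypothesis hp : forall k, p (x k) = eps k.
Hypothesis hp1 : forall k, interpolant1 M x a b (x k) = 0.

Let ha1 k : `|a k| <= 513 / 500.
Proof.
rewrite -[a k](subrK (eps k)); apply: (le_trans (ler_normD _ _)).
by rewrite eps1 -[leRHS](_ : 13 / 500 + 1 = _) ?lerD2r//; field.
Qed.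

(** The contribution of the other nodes is nearly flat at [x k], and its value
    and slope there are those that the node [k] itself leaves missing. *)
Lemma interpolant_near k t : `|t| <= 8 / 5 / Mr ->
  1 - 3 / 10 * (Mr ^+ 2 * t ^+ 2) <= eps k * p (x k + t) <=
    1 - Mr ^+ 2 * t ^+ 2 / 50.
Proof.
move=> ht; set z := Mr ^+ 2 * t ^+ 2.
have z0 : 0 <= z by rewrite mulr_ge0 ?sqr_ge0.
pose o u := \sum_(j | j != k)
  (a j * K (x k - x j + u) + b j * (Mr * S (x k - x j + u))).
pose o1 u := \sum_(j | j != k)
  (a j * ker1 M (x k - x j + u) + b j * (Mr * kerS1 M (x k - x j + u))).
pose o2 u := \sum_(j | j != k)
  (a j * ker2 M (x k - x j + u) + b j * (Mr * kerS2 M (x k - x j + u))).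
have do0 u : is_derive u 1 o (o1 u).
  apply: der_sum => j _; apply: derD; first apply: derZ.
    exact: (der_shiftr (der_ker M _)).
  do 2 apply: derZ; exact: (der_shiftr (der_kerS M _)).
have do1 u : is_derive u 1 o1 (o2 u).
  apply: der_sum => j _; apply: derD; first apply: derZ.
    exact: (der_shiftr (der_ker1 M _)).
  do 2 apply: derZ; exact: (der_shiftr (der_kerS1 M _)).
have pE u : p (x k + u) = a k * K u + b k * (Mr * S u) + o u.
  rewrite /interpolant (bigD1 k)//= (_ : x k + u - x k = u); last by ring.
  congr (_ + _).
  by apply: eq_bigr => j _; rewrite addrAC.
have o0 : o 0 = eps k - a k.
  have := pE 0; rewrite addr0 hp ker_0// kerS_0 => ->; ring.
have o10 : o1 0 = - (Mr * b k).
  have := hp1 k; rewrite /interpolant1 (bigD1 k)//= subrr ker1_0// kerS1_0// mul0r mulr0.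
  rewrite add0r mulr1 => e.
  have -> : o1 0 = Mr * \sum_(j | j != k)
      (a j * (ker1 M (x k - x j) / Mr) + b j * kerS1 M (x k - x j)).
    rewrite mulr_sumr; apply: eq_bigr => j _; rewrite addr0.
    by field; rewrite gt_eqF.
  by rewrite -(addr0_eq e) mulrN.
have o2b u : `|u| <= 8 / 5 / Mr -> `|o2 u| <= 17 / 125 * Mr ^+ 2.
  move=> hu; have rg := @regime_near _ _ _ _ M5 sep k _ hu.
  have -> : o2 u = Mr ^+ 2 * \sum_(j | j != k)
     (a j * (ker2 M (x k + u - x j) / Mr ^+ 2) + b j * (kerS2 M (x k + u - x j) / Mr)).
    rewrite mulr_sumr; apply: eq_bigr => j _; rewrite addrAC.
    by field; rewrite gt_eqF.
  rewrite normrM ger0_norm ?sqr_ge0// mulrC; apply: ler_wpM2r; first exact: sqr_ge0.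
  apply: le_trans remainder_margin.
  apply: (sum_weighted ha1 hb _ _ coef_ge0.1 coef_ge0.2).
    exact: le_trans (sum_ker2_regime M5 rg) tail_near_ker2.
  exact: le_trans (sum_kerS2_regime M5 rg) tail_near_kerS2.
have tay := taylor2_norm ht (fun u _ => do0 u) (fun u _ => do1 u) o2b.
rewrite o0 o10 in tay.
have ee : eps k * eps k = 1 by rewrite -expr2 -real_normK ?num_real// eps1 expr1n.
have -> : eps k * p (x k + t) =
    (eps k * a k) * K t + (eps k * b k) * (Mr * S t) + eps k * o t.
  by rewrite pE; ring.
apply: (@near_margin _ _ _ _ _ (Mr * t)) => //.
- have -> : eps k * a k - 1 = eps k * (a k - eps k) by rewrite mulrBr ee.
  by rewrite normrM eps1 mul1r; exact: ha.
- by rewrite normrM eps1 (mul1r `|b k|); exact: hb.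
- exact: (ker_profile M5 (erefl z) ht).
- have K1 : 0 <= 1 - K t by rewrite subr_ge0 ker_le1.
  have t3 : Mr * (`|t| ^+ 3 / 6) <= 8 / 5 / 150 * z.
    have -> : Mr * (`|t| ^+ 3 / 6) = (Mr * `|t| / (6 * Mr ^+ 2)) * z.
      rewrite /z -(real_normK (num_real t)); field; rewrite gt_eqF//.
    apply: ler_wpM2r => //.
    have M25 : 25 <= Mr ^+ 2 by move: Mr5; move: (Mr) => q; nra.
    rewrite ler_pdivrMr; last by rewrite mulr_gt0// exprn_gt0.
    apply: (@le_trans _ _ (8 / 5)); last by lra.
    by move: ht; rewrite ler_pdivlMr// mulrC.
  have -> : Mr * t - Mr * S t = Mr * (t * (1 - K t)) + Mr * ((t - sin t) * K t).
    by rewrite /kerS; ring.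
  apply: (le_trans (ler_normD _ _)); apply: lerD.
    rewrite mulrA normrM (ger0_norm K1); apply: ler_wpM2r => //.
    by move: ht; rewrite ler_pdivlMr// mulrC normrM (ger0_norm (ltW Mr0)).
  apply: le_trans t3; rewrite normrM (ger0_norm (ltW Mr0)); apply: ler_wpM2l; first exact: ltW.
  apply: le_trans (abs_sub_sin t); rewrite normrM; apply: ler_piMr => //.
  by rewrite ger0_norm ?ker_ge0// ker_le1.
- have -> : eps k * o t - (1 - eps k * a k) + eps k * b k * (Mr * t) =
    eps k * (o t - (eps k - a k) - t * - (Mr * b k)).
    by rewrite -ee; ring.
  rewrite normrM eps1 mul1r; apply: (le_trans tay).
  by rewrite /z le_eqVlt; apply/orP; left; apply/eqP; field.
Qed.

Lemma interpolant_far th :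
  (forall k (z : int), 8 / 5 / Mr <= `|th - x k + z%:~R * (pi *+ 2)|) ->
  `|p th| <= 497 / 500.
Proof.
move=> hth.
have [k0 _|noI] := pickP (xpredT : pred I); last first.
  rewrite /interpolant big_pred0 ?normr0; first by lra.
  by move=> i; have := noI i.
have [zz hz] := choice (fun i => circle_rep (th - x i)).
pose y i := th - x i + (zz i)%:~R * (pi *+ 2).
have [k hk] := fin_max (fun i => - `|y i|) k0.
have {}hk i : `|y k| <= `|y i| by rewrite -lerN2.
have rep i (z : int) : `|y i| <= `|th - x i + z%:~R * (pi *+ 2)|.
  have [->//|zn] := eqVneq z (zz i).
  have -> : th - x i + z%:~R * (pi *+ 2) = y i + (z - zz i)%:~R * (pi *+ 2).
    by rewrite /y intrB; ring.
  have z1 : 1 <= `|(z - zz i)%:~R| :> R.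
    by rewrite -intr_norm -[1]/(1%:~R) ler_int -gtz0_ge1 normr_gt0 subr_eq0.
  have yp : `|y i| <= pi by exact: hz.
  have p0 := @pi_gt0 R.
  have : `|(z - zz i)%:~R * (pi *+ 2)| - `|y i| <= `|y i + (z - zz i)%:~R * (pi *+ 2)|.
    by rewrite lerBlDr; apply: le_trans (ler_normB _ _); rewrite addrAC subrr add0r.
  apply: le_trans; rewrite normrM.
  have -> : `|pi *+ 2| = 2 * pi :> R by rewrite ger0_norm ?mulr_natl// mulrn_wge0// ltW.
  have : 2 * pi <= `|(z - zz i)%:~R| * (2 * pi) :> R.
    by apply: ler_peMl => //; rewrite mulr_ge0// ltW.
  move=> h; rewrite lerBrDr; apply: le_trans h.
  by rewrite mulr_natl mulr2n; exact: lerD.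
have rg : regime M x (fun j => j != k) th (19 / 10) (15 / 4).
  apply: (regime_far M5 sep) => j z jk.
  have h1 := rep j z; have h2 := hk j.
  have := sep (z - zz k) (_ : k != j); rewrite eq_sym => /(_ jk).
  have -> : x k - x j + (z - zz k)%:~R * (pi *+ 2) =
      (th - x j + z%:~R * (pi *+ 2)) - y k.
    by rewrite /y intrB; ring.
  move=> /le_trans/(_ (ler_normB _ _)).
  by move: (`|y k|) (`|y j|) (`|_ + _|) (5 * pi / _) h1 h2 => Y Y' W D; lra.
have -> : p th = a k * K (th - x k) + b k * (Mr * S (th - x k)) +
    \sum_(j | j != k) (a j * K (th - x j) + b j * (Mr * S (th - x j))).
  by rewrite /interpolant (bigD1 k).
have [f1 f2] := ker_far M5 (hth k).
have K0 : 0 <= K (th - x k) <= 88 / 125 by rewrite ker_ge0.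
apply: (far_margin (ha1 k) (hb k) K0 f2).
apply: (sum_weighted ha1 hb _ _ coef_ge0.1 coef_ge0.2).
  exact: le_trans (sum_ker_regime M5 rg) tail_far_ker.
exact: le_trans (sum_kerS_regime M5 rg) tail_far_kerS.
Qed.

Lemma trigpoly_interpolant : trigpoly M.-1.*2.+1 p.
Proof.
apply: trigpoly_sum => j; apply: trigpolyD; apply: trigpolyZ.
  by apply: trigpoly_shift; apply: trigpoly_widen (trigpoly_ker M).
by apply: trigpolyZ; apply: trigpoly_shift; exact: trigpoly_kerS.
Qed.

End InterpolantProfile.

(** Interpolating the signs together with zero derivatives makes each node a strict
    local extremum; the quantitative profile is what the analysis of the estimator
    consumes. *)
Theorem circle_certificate (R : realType) (M : nat) (I : finType) (x eps : I -> R) :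
  (5 <= M)%N ->
  (forall i j (z : int), i != j ->
    5 * pi / (2 * M%:R) <= `|x i - x j + z%:~R * (pi *+ 2)|) ->
  (forall k, `|eps k| = 1) ->
  exists p : R -> R, [/\ trigpoly M.-1.*2.+1 p,
    forall k t, `|t| <= 8 / 5 / M%:R ->
      1 - 3 / 10 * (M%:R ^+ 2 * t ^+ 2) <= eps k * p (x k + t) <=
        1 - M%:R ^+ 2 * t ^+ 2 / 50
  & forall th, (forall k (z : int),
      8 / 5 / M%:R <= `|th - x k + z%:~R * (pi *+ 2)|) ->
    `|p th| <= 497 / 500].
Proof.
move=> M5 sep he.
have [|a [b [h1 h2 h3 h4]]] := interpolation M5 sep (eps := eps).
  by move=> k; rewrite he.
exists (interpolant M x a b); split.
- exact: trigpoly_interpolant.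
- by move=> k t; exact: (interpolant_near M5 sep).
- by move=> th; exact: (interpolant_far M5 sep he).
Qed.

(** * Certificates on the interval *)
Section IntervalCertificate.
Context {R : realType}.

Lemma circle_dist (w d : R) (z : int) : 0 <= d -> d <= `|w| <= 2 * pi - d ->
  d <= `|w + z%:~R * (pi *+ 2)|.
Proof.
move=> d0 /andP[dw wd]; have [->|z0] := eqVneq z 0.
  by rewrite mulr0z mul0r addr0.
have p0 := @pi_gt0 R.
have z1 : 1 <= `|z%:~R| :> R.
  by rewrite -intr_norm -[1]/(1%:~R) ler_int -gtz0_ge1 normr_gt0.
have h : 2 * pi <= `|z%:~R * (pi *+ 2)| :> R.
  rewrite normrM.
  have -> : `|pi *+ 2| = 2 * pi :> R by rewrite ger0_norm ?mulr_natl// mulrn_wge0// ltW.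
  by apply: ler_peMl => //; rewrite mulr_ge0// ltW.
have : `|z%:~R * (pi *+ 2)| - `|w| <= `|w + z%:~R * (pi *+ 2)|.
  by rewrite lerBlDr; apply: le_trans (ler_normB _ _); rewrite addrAC subrr add0r.
apply: le_trans; rewrite lerBrDr -lerBrDl; apply: (le_trans wd).
by rewrite lerD2r.
Qed.

(** For [0 < m], the largest order for which the kernels have degree at most [m]. *)
Definition half_order (m : nat) : nat := uphalf m.
Definition radius (m : nat) : R := 8 / 5 / (half_order m)%:R.

Lemma half_order_bounds m : (m <= 2 * half_order m)%N /\ ((half_order m).-1.*2.+1 <= maxn m 1)%N /\ (half_order m <= m)%N.
Proof.
rewrite /half_order uphalf_half; have := odd_double_half m.
by case: (odd m) => /=; lia.
Qed.

(** The nodes on the circle are the angles of the knots and their opposites;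
    averaging over [th |-> - th] leaves cosines only. *)
Theorem angle_certificate (m s : nat) (an eps : 'I_s -> R) :
  (0 < m)%N ->
  (forall i j, i != j -> 5 * pi / m%:R <= `|an i - an j|) ->
  (forall i, 5 * pi / m%:R <= an i <= pi - 5 * pi / m%:R) ->
  (forall i, `|eps i| = 1) ->
  exists a : nat -> R, let P th := \sum_(k < m.+1) a k * cos (k%:R * th) in
  [/\ forall i th, `|th - an i| <= radius m ->
        1 - 3 / 10 * (m%:R ^+ 2 * (th - an i) ^+ 2) <= eps i * P th <=
          1 - m%:R ^+ 2 * (th - an i) ^+ 2 / 200,
      forall i th, `|th - an i| <= radius m -> 0 <= eps i * P th
    & forall th, 0 <= th <= pi -> (forall i, radius m < `|th - an i|) ->
        `|P th| <= 497 / 500].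
Proof.
move=> m0 sepa rng he.
have [s0|s0] := posnP s.
  subst s; exists (fun=> 0) => P; split=> [[]//|[]//|th _ _].
  rewrite /P big1 ?normr0; first by lra.
  by move=> k _; rewrite mul0r.
have p0 := @pi_gt0 R.
pose i0 := Ordinal s0.
have mr0 : 0 < m%:R :> R by rewrite ltr0n.
have m10 : (10 <= m)%N.
  have /andP[h1 h2] := rng i0.
  have : 5 * pi / m%:R <= pi - 5 * pi / m%:R :> R by exact: le_trans h1 h2.
  rewrite lerBrDr -mulrDl ler_pdivrMr// -(ler_nat R) => h.
  by rewrite -(ler_pM2l p0); apply: le_trans h; rewrite -mulrDl -natrD mulrC.
set M := half_order m.
have [mM [Mm Mlem]] := half_order_bounds m.
have M5 : (5 <= M)%N by move: mM; rewrite -/M; lia.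
have Mr0 : 0 < M%:R :> R by rewrite ltr0n; lia.
have mMr : m%:R <= 2 * M%:R :> R by rewrite -natrM ler_nat.
have Mmr : M%:R <= m%:R :> R by rewrite ler_nat.
pose x (c : bool * 'I_s) := if c.1 then - an c.2 else an c.2.
have d0 : 0 < 5 * pi / m%:R :> R by rewrite divr_gt0// mulr_gt0.
have sep c c' (z : int) : c != c' ->
    5 * pi / (2 * M%:R) <= `|x c - x c' + z%:~R * (pi *+ 2)|.
  move=> cc; apply: (@le_trans _ _ (5 * pi / m%:R)).
    apply: ler_wpM2l; first by rewrite mulr_ge0 ?ltW.
    by rewrite lef_pV2 ?posrE ?mulr_gt0.
  apply: circle_dist; first exact: ltW.
  have opp i j : 5 * pi / m%:R <= `|an i + an j| <= 2 * pi - 5 * pi / m%:R.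
    have := rng i; have := rng j.
    move: (@pi R) (5 * pi / m%:R) d0 => p d d0' /andP[a1 a2] /andP[b1 b2].
    by rewrite ger0_norm; [apply/andP; split|]; lra.
  have same i j : i != j -> 5 * pi / m%:R <= `|an i - an j| <= 2 * pi - 5 * pi / m%:R.
    move=> ij; rewrite sepa//=; have := rng i; have := rng j.
    move: (@pi R) (5 * pi / m%:R) d0 => p d d0' /andP[a1 a2] /andP[b1 b2].
    by rewrite ler_norml; apply/andP; split; lra.
  move: c c' cc => [[] i] [[] j]; rewrite xpair_eqE /x /= => ij.
  - by rewrite -opprD normrN; apply: same.
  - by rewrite -opprD normrN; exact: opp.
  - by rewrite opprK; exact: opp.
  - exact: same.
have [p [tp near far]] := circle_certificate M5 sep (fun c => he c.2).
have [a ha] : exists a : nat -> R, forall th,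
    (p th + p (- th)) / 2 = \sum_(k < m.+1) a k * cos (k%:R * th).
  apply: trigpoly_even; apply: trigpoly_widen tp.
  by move: Mm; rewrite -/M; lia.
exists a => P; have {}ha th : P th = (p th + p (- th)) / 2 by rewrite ha.
have sandwich i th : `|th - an i| <= radius m ->
    1 - 3 / 10 * (M%:R ^+ 2 * (th - an i) ^+ 2) <= eps i * P th <=
    1 - M%:R ^+ 2 * (th - an i) ^+ 2 / 50.
  move=> h.
  have h' : `|- (th - an i)| <= 8 / 5 / M%:R by rewrite normrN.
  have /andP[a1 a2] := near (false, i) _ h.
  have /andP[b1 b2] := near (true, i) _ h'.
  rewrite /x /= in a1 a2 b1 b2.
  rewrite subrKC in a1 a2.
  have e : - an i - (th - an i) = - th by ring.
  rewrite e sqrrN in b1 b2; rewrite ha.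
  have -> : eps i * ((p th + p (- th)) / 2) = (eps i * p th + eps i * p (- th)) / 2.
    by field.
  move: (eps i * p th) (eps i * p (- th)) (_ ^+ 2 * _ ^+ 2) a1 a2 b1 b2 => u v w.
  by move=> *; apply/andP; split; lra.
split.
- move=> i th h; have /andP[h1 h2] := sandwich i th h.
  have q0 : 0 <= (th - an i) ^+ 2 by exact: sqr_ge0.
  have q1 : M%:R ^+ 2 * (th - an i) ^+ 2 <= m%:R ^+ 2 * (th - an i) ^+ 2.
    by apply: ler_wpM2r => //; apply: lerXn2r => //; rewrite nnegrE ltW.
  have q2 : m%:R ^+ 2 * (th - an i) ^+ 2 <= 4 * (M%:R ^+ 2 * (th - an i) ^+ 2).
    rewrite mulrA; apply: ler_wpM2r => //.
    rewrite (_ : 4 * _ = (2 * M%:R) ^+ 2); last by ring.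
    by apply: lerXn2r => //; rewrite nnegrE ltW// mulr_gt0.
  move: (eps i * P th) (M%:R ^+ 2 * _) (m%:R ^+ 2 * _) h1 h2 q1 q2 => e u v *.
  by apply/andP; split; lra.
- move=> i th h; have /andP[h1 _] := sandwich i th h.
  apply: le_trans h1; have c0 : 0 <= 8 / 5 :> R by lra.
  by have := sqr_scale_le M5 c0 h; lra.
- move=> th /andP[th0 thp] h.
  have hr i : radius m <= `|th - an i| by exact: ltW.
  have dist i (z : int) : radius m <= `|th - an i + z%:~R * (pi *+ 2)| /\
      radius m <= `|th + an i + z%:~R * (pi *+ 2)|.
    have /andP[a1 a2] := rng i.
    split; apply: (le_trans (hr i)); apply: circle_dist; rewrite ?normr_ge0// ?lexx/=.
      have wp : `|th - an i| <= pi.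
        rewrite ler_norml.
        move: (@pi R) (5 * pi / m%:R) d0 a1 a2 thp => q d d0' a1 a2 thp.
        by apply/andP; split; lra.
      by rewrite lerBrDr mulr_natl mulr2n; exact: lerD.
    rewrite (ger0_norm (_ : 0 <= th + an i)); last first.
      by rewrite addr_ge0// (le_trans (ltW d0)).
    move: (@pi R) (5 * pi / m%:R) d0 a1 a2 thp => q d d0' a1 a2 thp.
    have [g|g] := leP 0 (th - an i); [rewrite (ger0_norm g)|rewrite (ltr0_norm g)].
      by apply/andP; split; lra.
    by apply/andP; split; lra.
  have b1 : `|p th| <= 497 / 500.
    apply: far => -[[] i] z; rewrite /x /= ?opprK; [exact: (dist i z).2|exact: (dist i z).1].
  have b2 : `|p (- th)| <= 497 / 500.
    apply: far => -[[] i] z; rewrite /x /= -normrN.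
      have -> : - (- th - - an i + z%:~R * (pi *+ 2)) = th - an i + (- z)%:~R * (pi *+ 2).
        by rewrite mulrNz; ring.
      exact: (dist i _).1.
    have -> : - (- th - an i + z%:~R * (pi *+ 2)) = th + an i + (- z)%:~R * (pi *+ 2).
      by rewrite mulrNz; ring.
    exact: (dist i _).2.
  rewrite ha normrM (ger0_norm (_ : 0 <= 2^-1)) ?invr_ge0//.
  by have := ler_normD (p th) (p (- th)); lra.
Qed.

End IntervalCertificate.

(** * Chebyshev expansions *)
Section Chebyshev.
Context {R : realType}.
Implicit Types (p : nat -> R) (u th : R).

Definition cheb m p u := \sum_(k < m.+1) p k * phi k u.

Lemma sqr_sqrt2 : Num.sqrt 2 ^+ 2 = 2 :> R. Proof. by rewrite sqr_sqrtr. Qed.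

Lemma phi_cos k th : 0 <= th <= pi ->
  phi k (cos th) = (if k == 0%N then 1 else Num.sqrt 2) * cos (k%:R * th) :> R.
Proof.
move=> hth; rewrite /phi cosK ?in_itv//=.
by case: eqP => // ->; rewrite mul0r cos0 mulr1.
Qed.

(** Multiplied by the sine of half the step, the sum telescopes. *)
Lemma sum_cos_nodes N j : (0 < j < 2 * N)%N ->
  \sum_(r < N) cos (j%:R * ((2 * r%:R + 1) * (pi / (2 * N%:R)))) = 0 :> R.
Proof.
move=> /andP[j0 jN]; have N0 : (0 < N)%N by lia.
have Nr : 0 < N%:R :> R by rewrite ltr0n.
set h := pi / (2 * N%:R); have p0 := @pi_gt0 R.
have h0 : 0 < h by rewrite divr_gt0// mulr_gt0.
have hN : 2 * N%:R * h = pi by rewrite /h mulrC divfK// mulf_neq0// gt_eqF.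
have jh : 0 < sin (j%:R * h).
  apply: sin_gt0_pi; rewrite mulr_gt0 ?ltr0n//= -hN ltr_pM2r//.
  by rewrite -natrM ltr_nat.
apply: (mulfI (lt0r_neq0 jh)); rewrite mulr0.
apply: (mulfI (_ : 2 != 0 :> R)) => //; rewrite mulr0.
suff -> : 2 * (sin (j%:R * h) * \sum_(r < N) cos (j%:R * ((2 * r%:R + 1) * h))) =
   sin (j%:R * (2 * N%:R * h)).
  by rewrite hN mulr_natl -[pi *+ j]add0r (alternatingn (@sinDpi R)) sin0 mulr0.
elim: (N) => [|n ih]; first by rewrite big_ord0 !mulr0 mul0r mulr0 sin0.
rewrite big_ord_recr /= mulrDr mulrDr ih.
set q := j%:R.
have -> : q * (2 * n.+1%:R * h) = q * ((2 * n%:R + 1) * h) + q * h.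
  by rewrite -natr1; ring.
have -> : q * (2 * n%:R * h) = q * ((2 * n%:R + 1) * h) - q * h by ring.
by rewrite sinB sinD; ring.
Qed.

(** The normalized Chebyshev polynomials are orthonormal for the uniform
    measure on the roots of the Chebyshev polynomial of degree [m + 1], so that
    a bound on the polynomial bounds the norm of its coefficients. *)
Lemma cheb_coef_le m p (B : R) :
  (forall u, -1 <= u <= 1 -> `|cheb m p u| <= B) ->
  \sum_(k < m.+1) p k ^+ 2 <= B ^+ 2.
Proof.
move=> hB.
pose N := m.+1; pose h : R := pi / (2 * N%:R).
have Nr : 0 < N%:R :> R by rewrite ltr0n.
have p0 := @pi_gt0 R.
have h0 : 0 < h by rewrite divr_gt0// mulr_gt0.
have hN : 2 * N%:R * h = pi by rewrite /h mulrC divfK// mulf_neq0// gt_eqF.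
pose th (r : nat) := (2 * r%:R + 1) * h.
have thb (r : 'I_N) : 0 <= th r <= pi.
  apply/andP; split; first by rewrite /th mulr_ge0 ?addr_ge0 ?mulr_ge0// ltW.
  rewrite /th -hN ler_pM2r//.
  by rewrite -natrM natr1 -natrM ler_nat; have := ltn_ord r; lia.
pose e (k : nat) : R := if k == 0%N then 1 else Num.sqrt 2.
pose A (j : nat) := \sum_(r < N) cos (j%:R * th r).
have A0 : A 0%N = N%:R.
  by rewrite /A (eq_bigr (fun=> 1)) ?sumr_const ?card_ord// => r _; rewrite mul0r cos0.
have orth (k l : 'I_N) : \sum_(r < N) (e k * cos (k%:R * th r)) * (e l * cos (l%:R * th r))
    = (k == l)%:R * N%:R.
  have half (a b : nat) : (b <= a)%N -> \sum_(r < N) cos (a%:R * th r) * cos (b%:R * th r) =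
      (A (a + b)%N + A (a - b)%N) / 2.
    move=> ba; rewrite -big_split mulr_suml; apply: eq_bigr => r _ /=.
    have -> : (a + b)%:R * th r = a%:R * th r + b%:R * th r by rewrite natrD mulrDl.
    have -> : (a - b)%:R * th r = a%:R * th r - b%:R * th r by rewrite natrB// mulrBl.
    by rewrite cosB cosD; field.
  have -> : \sum_(r < N) (e k * cos (k%:R * th r)) * (e l * cos (l%:R * th r)) =
     e k * e l * \sum_(r < N) cos (k%:R * th r) * cos (l%:R * th r).
    by rewrite mulr_sumr; apply: eq_bigr => r _; ring.
  have [->|kl] := eqVneq k l.
    rewrite half// subnn A0 mul1r /e; case: eqP => [->|/eqP l0].
      by rewrite addn0 A0; field.
    rewrite [A _]sum_cos_nodes; last by have := ltn_ord l; lia.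
    by rewrite add0r -expr2 sqr_sqrt2; field.
  rewrite mul0r.
  wlog lk : k l kl / (l < k)%N.
    move=> wl; move: (kl); rewrite neq_ltn => /orP[kl'|/wl]; last by apply.
    transitivity (e l * e k * \sum_(r < N) cos (l%:R * th r) * cos (k%:R * th r)).
      by rewrite [e l * _]mulrC; congr (_ * _); apply: eq_bigr => r _; rewrite mulrC.
    by apply: wl; rewrite // eq_sym.
  rewrite half; last exact: ltnW.
  rewrite [A _]sum_cos_nodes; last by have := ltn_ord k; lia.
  rewrite [A _]sum_cos_nodes; last by have := ltn_ord k; lia.
  by rewrite addr0 mul0r mulr0.
rewrite -(ler_pM2l Nr).
apply: (@le_trans _ _ (\sum_(r < N) cheb m p (cos (th r)) ^+ 2)); last first.
  apply: (@le_trans _ _ (\sum_(r < N) B ^+ 2)); last first.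
    by rewrite sumr_const card_ord mulr_natl.
  apply: ler_sum => r _; rewrite -real_normK ?num_real//.
  have c1 : -1 <= cos (th r) <= 1 by rewrite cos_geN1 cos_le1.
  by apply: lerXn2r; rewrite ?nnegrE ?(le_trans _ (hB _ c1))// hB.
rewrite le_eqVlt; apply/orP; left; apply/eqP.
transitivity (\sum_(k < N) \sum_(l < N) p k * p l * ((k == l)%:R * N%:R)).
  rewrite mulr_sumr; apply: eq_bigr => k _.
  rewrite (bigD1 k)//= eqxx big1; first by rewrite mul1r addr0; ring.
  by move=> l; rewrite eq_sym => /negPf ->; rewrite mul0r mulr0.
transitivity (\sum_(k < N) \sum_(l < N) \sum_(r < N)
   p k * p l * ((e k * cos (k%:R * th r)) * (e l * cos (l%:R * th r)))).
  apply: eq_bigr => k _; apply: eq_bigr => l _.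
  by rewrite -orth mulr_sumr.
rewrite (eq_bigr (fun k : 'I_N => \sum_(r < N) \sum_(l < N)
   p k * p l * ((e k * cos (k%:R * th r)) * (e l * cos (l%:R * th r))))); last first.
  by move=> k _; rewrite exchange_big.
rewrite exchange_big; apply: eq_bigr => r _ /=.
rewrite expr2 /cheb mulr_suml; apply: eq_bigr => k _.
rewrite mulr_sumr; apply: eq_bigr => l _.
by rewrite !phi_cos ?thb// -/(e k) -/(e l); ring.
Qed.

Lemma chebE m (a : nat -> R) :
  let p k := if k == 0%N then a k else a k / Num.sqrt 2 in
  forall u, -1 <= u <= 1 ->
  cheb m p u = \sum_(k < m.+1) a k * cos (k%:R * acos u).
Proof.
move=> p u hu; apply: eq_bigr => k _; rewrite /p /phi.
case: eqP => [->|_]; first by rewrite mul0r cos0.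
by rewrite mulrA divfK// gt_eqF// sqrtr_gt0.
Qed.

End Chebyshev.

Section KnotCertificate.
Context {R : realType}.

Lemma knots_inj (s : nat) (t : nat -> R) :
  (forall k, (1 <= k < s)%N -> t k < t k.+1) ->
  forall i j, (1 <= i <= s)%N -> (1 <= j <= s)%N -> t i = t j -> i = j.
Proof.
move=> tinc.
have tmono i j : (1 <= i)%N -> (i < j <= s)%N -> t i < t j.
  move=> i1 /andP[]; elim: j => // j ih ij js; rewrite ltnS leq_eqVlt in ij.
  case/orP: ij => [/eqP e|ij]; first by subst j; apply: tinc; lia.
  apply: (lt_trans (ih ij (ltnW js))); apply: tinc; lia.
move=> i j hi hj tij; apply/eqP; case: ltngtP => // h.
  by have : t i < t j; [apply: tmono; lia|rewrite tij ltxx].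
by have : t j < t i; [apply: tmono; lia|rewrite tij ltxx].
Qed.

Lemma knot_separation (m s : nat) (t : nat -> R) :
  ((5 * pi / m%:R)%:E <= Delta (knot_set s t))%E ->
  (forall k, (1 <= k <= s)%N -> -1 < t k < 1) ->
  (forall k, (1 <= k < s)%N -> t k < t k.+1) ->
  (forall i j, (1 <= i <= s)%N -> (1 <= j <= s)%N -> i != j ->
    5 * pi / m%:R <= `|acos (t i) - acos (t j)|) /\
  (forall i, (1 <= i <= s)%N -> 5 * pi / m%:R <= acos (t i) <= pi - 5 * pi / m%:R).
Proof.
move=> hD ht tinc.
have sepT u v : knot_set s t u -> knot_set s t v -> acos u <> acos v ->
    5 * pi / m%:R <= `|acos u - acos v|.
  move=> Tu Tv uv; rewrite -lee_fin; apply: (le_trans hD).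
  apply: ereal_inf_lbound; exists (acos u, acos v) => //=; split => //=.
  - by exists u => //; exists 0; rewrite mul0r addr0.
  - by exists v => //; exists 0; rewrite mul0r addr0.
have Tk k : (1 <= k <= s)%N -> knot_set s t (t k) by move=> hk; right; exists k.
have acos_ne u v : -1 <= u <= 1 -> -1 <= v <= 1 -> u != v -> acos u <> acos v.
  move=> hu hv uv e; move: uv; rewrite -(acosK (x := u)) ?in_itv//.
  by rewrite e acosK ?in_itv// eqxx.
have tW k : (1 <= k <= s)%N -> -1 <= t k <= 1.
  by move=> /ht /andP[h1 h2]; rewrite !ltW.
split=> [i j hi hj ij|i hi].
  apply: sepT; [exact: Tk|exact: Tk|apply: acos_ne; [exact: tW|exact: tW|]].
  by apply/eqP => /(knots_inj tinc hi hj); apply/eqP.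
have /andP[t1 t2] := ht i hi.
have a0 : 5 * pi / m%:R <= `|acos (t i) - acos 1|.
  apply: sepT; [exact: Tk|by left; right|apply: acos_ne; [exact: tW| |]].
    by rewrite lexx andbT.
  by rewrite lt_eqF.
have a1 : 5 * pi / m%:R <= `|acos (-1) - acos (t i)|.
  apply: sepT; [by left; left|exact: Tk|apply: acos_ne; [|exact: tW|]].
    by rewrite lexx /=.
  by rewrite lt_eqF.
move: a0 a1; rewrite acos1 acosN1 subr0 ger0_norm ?acos_ge0 ?tW// => ->.
by rewrite ger0_norm ?subr_ge0 ?acos_lepi ?tW// lerBrDr -lerBrDl.
Qed.

(** The change of variable [u = cos th] turns the even trigonometric certificate into
    a Chebyshev expansion and angular distances into [rho]. The gap to [1] is at
    least [m^2 rho^2 / 200] next to a knot and [3 / 500] elsewhere. *)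
Lemma knot_certificate (m s : nat) (t eps : nat -> R) :
  (0 < m)%N ->
  ((5 * pi / m%:R)%:E <= Delta (knot_set s t))%E ->
  (forall k, (1 <= k <= s)%N -> -1 < t k < 1) ->
  (forall k, (1 <= k < s)%N -> t k < t k.+1) ->
  (forall k, `|eps k| = 1) ->
  exists p : nat -> R,
  [/\ forall i u, (1 <= i <= s)%N -> -1 <= u <= 1 -> rho (t i) u <= radius m ->
        [/\ 1 - 3 / 10 * (m%:R ^+ 2 * rho (t i) u ^+ 2) <= eps i * cheb m p u,
            eps i * cheb m p u <= 1 - m%:R ^+ 2 * rho (t i) u ^+ 2 / 200
          & 0 <= eps i * cheb m p u]
    & forall u, -1 <= u <= 1 ->
        (forall i, (1 <= i <= s)%N -> radius m < rho (t i) u) ->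
        `|cheb m p u| <= 497 / 500].
Proof.
move=> m0 hD ht tinc he; have [sep rng] := knot_separation hD ht tinc.
have idx (i : 'I_s) : (1 <= i.+1 <= s)%N by rewrite /= ltn_ord.
have [||a [near pos far]] := @angle_certificate R m s (fun i => acos (t i.+1))
  (fun i => eps i.+1) m0 _ _ (fun i => he i.+1).
- by move=> i j ij; apply: sep.
- by move=> i; exact: rng.
pose p k := if k == 0%N then a k else a k / Num.sqrt 2.
have pE u : -1 <= u <= 1 -> cheb m p u = \sum_(k < m.+1) a k * cos (k%:R * acos u).
  exact: chebE.
exists p; split.
- move=> [//|i] u hi hu; rewrite /rho distrC => hr.
  have i_s : (i < s)%N by [].
  have /andP[h1 h2] := near (Ordinal i_s) _ hr.
  have h3 := pos (Ordinal i_s) _ hr.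
  rewrite real_normK ?num_real//.
  by split; rewrite pE.
- move=> u hu hr; rewrite pE//; apply: far; first by rewrite acos_ge0// acos_lepi.
  by move=> i; rewrite distrC; exact: hr.
Qed.

End KnotCertificate.

(** * Deterministic analysis of the estimator *)
Section Recovery.
Context {R : realType}.

(** The splitting [(x - y)^2 <= 5 x^2 + 5/4 y^2] is the optimal one for norms [lam / 4]
    and [lam]. *)
Lemma sum_sub_sqr_le (I : Type) (r : seq I) (P : pred I) (n p : I -> R) (lam : R) :
  \sum_(i <- r | P i) n i ^+ 2 <= (lam / 4) ^+ 2 ->
  \sum_(i <- r | P i) p i ^+ 2 <= 1 ->
  \sum_(i <- r | P i) (n i - lam * p i) ^+ 2 <= 25 / 16 * lam ^+ 2.
Proof.
move=> hn hp.
apply: (@le_trans _ _ (5 * \sum_(i <- r | P i) n i ^+ 2 +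
  5 / 4 * lam ^+ 2 * \sum_(i <- r | P i) p i ^+ 2)).
  rewrite !mulr_sumr -big_split; apply: ler_sum => i _ /=.
  by have := sqr_ge0 (2 * n i + lam / 2 * p i); lra.
have := ler_wpM2l (_ : 0 <= 5 / 4 * lam ^+ 2) hp.
rewrite mulr1 => h; have {}h := h ltac:(by rewrite mulr_ge0 ?sqr_ge0//; lra).
by move: hn h; rewrite exprMn; lra.
Qed.

Section Bregman.
Variables (m s s' : nat) (t a t' a' y : nat -> R) (d : nat) (lam : R).
Hypothesis lam0 : 0 < lam.
Let c j := \sum_(1 <= i < s.+1) a i * phi j (t i).
Let c' j := \sum_(1 <= k < s'.+1) a' k * phi j (t' k).
Hypothesis opt :
  2^-1 * \sum_(j < m.+1) (c' j - y j) ^+ 2 + lam * \sum_(1 <= k < s'.+1) `|a' k| <=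
  2^-1 * \sum_(j < m.+1) (c j - y j) ^+ 2 + lam * \sum_(1 <= i < s.+1) `|a i|.
Hypothesis same_low : forall j, (j <= d)%N -> c' j = c j.
Hypothesis noise :
  \sum_(j < m.+1 | (d < j)%N) (y j - c j) ^+ 2 <= (lam / 4) ^+ 2.

Let h j := c' j - c j.
Implicit Types p q : nat -> R.

Lemma pair_cheb p : \sum_(j < m.+1) p j * h j =
  \sum_(1 <= k < s'.+1) a' k * cheb m p (t' k) -
  \sum_(1 <= i < s.+1) a i * cheb m p (t i).
Proof.
have E (n : nat) (b u : nat -> R) : \sum_(1 <= k < n) b k * cheb m p (u k) =
    \sum_(j < m.+1) p j * \sum_(1 <= k < n) b k * phi j (u k).
  under eq_bigr do rewrite mulr_sumr.
  rewrite exchange_big; apply: eq_bigr => j _; rewrite mulr_sumr.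
  by apply: eq_bigr => k _; ring.
by rewrite !E -sumrB; apply: eq_bigr => j _; rewrite mulrBr.
Qed.

(** Comparing the objective at the estimate and at the truth. The residual is
    completed to a square with the coefficients of the certificate. *)
Lemma bregman_bound p : \sum_(j < m.+1) p j ^+ 2 <= 1 ->
  \sum_(1 <= i < s.+1) a i * cheb m p (t i) = \sum_(1 <= i < s.+1) `|a i| ->
  let D := \sum_(1 <= k < s'.+1) (`|a' k| - a' k * cheb m p (t' k)) in
  D <= 25 / 32 * lam /\ (0 <= D -> \sum_(j < m.+1) h j ^+ 2 <= 25 / 4 * lam ^+ 2).
Proof.
move=> hp hcert D.
pose n j : R := if (d < j)%N then y j - c j else 0.
have hn : \sum_(j < m.+1) n j ^+ 2 <= (lam / 4) ^+ 2.
  apply: le_trans noise; rewrite [leRHS]big_mkcond /=; apply: ler_sum => j _.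
  by rewrite /n; case: ifP => //; rewrite expr0n.
have he := sum_sub_sqr_le hn hp.
set e := fun j : nat => n j - lam * p j.
have hn' j : h j * (y j - c j) = h j * n j.
  rewrite /n; case: ltnP => // jd; by rewrite /h same_low// subrr !mul0r.
have split_sq : \sum_(j < m.+1) (c' j - y j) ^+ 2 =
    \sum_(j < m.+1) h j ^+ 2 - 2 * \sum_(j < m.+1) h j * n j +
    \sum_(j < m.+1) (c j - y j) ^+ 2.
  rewrite mulr_sumr -sumrB -big_split; apply: eq_bigr => j _ /=.
  by rewrite -hn' /h; ring.
have hD : \sum_(1 <= k < s'.+1) `|a' k| - \sum_(1 <= i < s.+1) `|a i| =
    D + \sum_(j < m.+1) p j * h j.
  by rewrite pair_cheb hcert /D sumrB; ring.
have hes : \sum_(j < m.+1) h j * n j - lam * \sum_(j < m.+1) p j * h j =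
    \sum_(j < m.+1) h j * e j.
  by rewrite mulr_sumr -sumrB; apply: eq_bigr => j _; rewrite /e; ring.
have key : 2^-1 * \sum_(j < m.+1) h j ^+ 2 - \sum_(j < m.+1) h j * e j + lam * D <= 0.
  have := opt; rewrite split_sq -hes.
  move: hD.
  move: (\sum_(1 <= k < s'.+1) `|a' k|) (\sum_(1 <= i < s.+1) `|a i|) D
    (\sum_(j < m.+1) p j * h j) (\sum_(j < m.+1) h j * n j)
    (\sum_(j < m.+1) h j ^+ 2) (\sum_(j < m.+1) (c j - y j) ^+ 2).
  move=> X Y D' L N H C hD o'.
  have : lam * (X - Y) = lam * D' + lam * L by rewrite hD mulrDr.
  by rewrite mulrBr; lra.
have sq1 : 2 * \sum_(j < m.+1) h j * e j <=
    \sum_(j < m.+1) h j ^+ 2 + \sum_(j < m.+1) e j ^+ 2.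
  rewrite mulr_sumr -big_split; apply: ler_sum => j _ /=.
  by have := sqr_ge0 (h j - e j); lra.
have sq2 : \sum_(j < m.+1) h j * e j <=
    4^-1 * \sum_(j < m.+1) h j ^+ 2 + \sum_(j < m.+1) e j ^+ 2.
  rewrite mulr_sumr -big_split; apply: ler_sum => j _ /=.
  by have := sqr_ge0 (2^-1 * h j - e j); lra.
move: he key sq1 sq2; rewrite -/(e _).
move: (\sum_(j < m.+1) h j ^+ 2) (\sum_(j < m.+1) h j * e j).
have -> : \sum_(i < m.+1) (n i - lam * p i) ^+ 2 = \sum_(j < m.+1) e j ^+ 2 by [].
move: (\sum_(j < m.+1) e j ^+ 2) => E H X he key sq1 sq2.
split; last by move=> D0; have := mulr_ge0 (ltW lam0) D0; lra.
rewrite -(ler_pM2l lam0) [leRHS](_ : _ = 25 / 32 * lam ^+ 2); last by ring.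
lra.
Qed.

(** Cauchy-Schwarz, one sign at a time. *)
Lemma residual_pairing q : \sum_(j < m.+1) h j ^+ 2 <= 25 / 4 * lam ^+ 2 ->
  \sum_(j < m.+1) q j ^+ 2 <= 1 ->
  `|\sum_(j < m.+1) q j * h j| <= 5 / 2 * lam.
Proof.
move=> hh hq.
have side (g : R) : g ^+ 2 = 1 ->
    5 * lam * (g * \sum_(j < m.+1) q j * h j) <= 25 / 2 * lam ^+ 2.
  move=> g1.
  apply: (@le_trans _ _ (25 / 4 * lam ^+ 2 * \sum_(j < m.+1) q j ^+ 2 +
      \sum_(j < m.+1) h j ^+ 2)).
    rewrite !mulr_sumr -big_split; apply: ler_sum => j _ /=.
    have := sqr_ge0 (5 / 2 * lam * q j - g * h j).
    by rewrite sqrrB [(g * _) ^+ 2]exprMn g1; lra.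
  have := ler_wpM2l (_ : 0 <= 25 / 4 * lam ^+ 2) hq.
  rewrite mulr1 => h1; have {}h1 := h1 ltac:(by rewrite mulr_ge0 ?sqr_ge0//; lra).
  lra.
have pl : 0 < 5 * lam by rewrite mulr_gt0.
have e : 25 / 2 * lam ^+ 2 = 5 * lam * (5 / 2 * lam) by field.
rewrite ler_norml; apply/andP; split.
  have := side (-1) (etrans (sqrrN 1) (expr1n _ _)).
  by rewrite e ler_pM2l// mulN1r; lra.
by have := side 1 (expr1n _ _); rewrite e ler_pM2l// mul1r.
Qed.

End Bregman.
End Recovery.

(** * Localization of the atoms *)
Section Localization.
Context {R : realType}.

Lemma dist_to_ge0 (T : set R) (u v : R) : T u -> 0 <= dist_to T v.
Proof.
move=> Tu; apply: lb_le_inf; first by exists (rho u v); exists u.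
by move=> x [w _ <-]; exact: normr_ge0.
Qed.

Lemma dist_to_le (T : set R) (u v : R) : T u -> dist_to T v <= rho u v.
Proof.
move=> Tu; apply: ge_inf; last by exists u.
by exists 0 => x [w _ <-]; exact: normr_ge0.
Qed.

Lemma c0_sqr : (1 <= (c0 : R) ^+ 2) * ((c0 : R) ^+ 2 <= 6 / 5).
Proof. by rewrite /c0; split; lra. Qed.

Lemma c1_margin (lam : R) : 0 <= lam -> 200 * (25 / 32 * lam) <= c1 * lam.
Proof. by move=> l0; rewrite mulrA; apply: ler_wpM2r => //; rewrite /c1; lra. Qed.

(** Two certificates that carry the same sign [e] at a knot lie in the same quadratic
    band next to it: their difference is of the order of the gap [1 - e * gp]. *)
Lemma half_diff_near (e gp gm z : R) : `|e| = 1 -> 0 <= z ->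
  1 - 3 / 10 * z <= e * gp -> e * gp <= 1 - z / 200 ->
  1 - 3 / 10 * z <= e * gm -> e * gm <= 1 - z / 200 ->
  `|(gp - gm) / 2| <= 500 / 3 * (1 - e * gp).
Proof.
move=> e1 z0 h1 h2 h3 h4.
have -> : `|(gp - gm) / 2| = `|(e * gp - e * gm) / 2|.
  by rewrite -mulrBr -mulrA [RHS]normrM e1 mul1r.
by rewrite ler_norml; apply/andP; split; lra.
Qed.

Lemma far_gain (kappa g : R) : 500 / 3 <= kappa -> g <= 497 / 500 ->
  1 <= kappa * (1 - g).
Proof. by move=> hk hg; nra. Qed.

Lemma near_gain (x w kappa z g : R) : 0 < x -> 0 < w -> 200 * x / w <= kappa ->
  w / x <= z -> g <= 1 - z / 200 -> 1 <= kappa * (1 - g).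
Proof.
move=> x0 w0 hk hz hg.
have e : 200 * x / w * (w / x / 200) = 1 by field; rewrite !gt_eqF.
rewrite -[leLHS]e.
have p0 : 0 <= 200 * x / w by apply: divr_ge0 (ltW w0); exact: mulr_ge0 (ler0n _ _) (ltW x0).
have q0 : 0 <= w / x / 200 by apply: divr_ge0 (ler0n _ _); exact: divr_ge0 (ltW w0) (ltW x0).
apply: (ler_pM p0 q0 hk); move: (w / x) hz => q hz; lra.
Qed.

(** The contradiction that localizes a large jump: [c1] is large enough for the second
    entry of the maximum, [c2] for the first one. *)
Lemma jump_margin (A lam : R) : 0 < lam -> c2 * lam < A ->
  Num.max (500 / 3) (200 * (A - c2 * lam) / (c1 * lam)) * (25 / 32 * lam) +
    5 / 2 * lam < A.
Proof.
move=> lam0 hA; have c1p : 0 < c1 :> R by rewrite /c1; lra.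
case: (leP (500 / 3) (200 * (A - c2 * lam) / (c1 * lam))) => _.
  have -> : 200 * (A - c2 * lam) / (c1 * lam) * (25 / 32 * lam) =
      (A - c2 * lam) * (625 / 4 / c1).
    by field; rewrite !gt_eqF.
  have c1q : 625 / 4 / c1 <= 1 :> R by rewrite ler_pdivrMr /c1; lra.
  have : (A - c2 * lam) * (625 / 4 / c1) <= A - c2 * lam.
    by rewrite ler_piMr// subr_ge0 ltW.
  have : 5 / 2 * lam < c2 * lam by rewrite ltr_pM2r// /c2; lra.
  by lra.
apply: le_lt_trans hA; rewrite mulrA -mulrDl ler_pM2r// /c2; lra.
Qed.

Variables (m s s' : nat) (t a t' a' y : nat -> R) (d : nat) (lam : R).
Hypothesis m0 : (0 < m)%N.
Hypothesis hD : ((5 * pi / m%:R)%:E <= Delta (knot_set s t))%E.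
Hypothesis ht : forall k, (1 <= k <= s)%N -> -1 < t k < 1.
Hypothesis tinc : forall k, (1 <= k < s)%N -> t k < t k.+1.
Hypothesis ht' : forall k, (1 <= k <= s')%N -> -1 <= t' k <= 1.
Hypothesis lam0 : 0 < lam.
Let c j := \sum_(1 <= i < s.+1) a i * phi j (t i).
Let c' j := \sum_(1 <= k < s'.+1) a' k * phi j (t' k).
Hypothesis opt :
  2^-1 * \sum_(j < m.+1) (c' j - y j) ^+ 2 + lam * \sum_(1 <= k < s'.+1) `|a' k| <=
  2^-1 * \sum_(j < m.+1) (c j - y j) ^+ 2 + lam * \sum_(1 <= i < s.+1) `|a i|.
Hypothesis same_low : forall j, (j <= d)%N -> c' j = c j.
Hypothesis noise :
  \sum_(j < m.+1 | (d < j)%N) (y j - c j) ^+ 2 <= (lam / 4) ^+ 2.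
Implicit Types (eps p : nat -> R) (u : R).

Let mr0 : 0 < m%:R :> R. Proof. by rewrite ltr0n. Qed.

Let certificate eps p :=
  [/\ forall i u, (1 <= i <= s)%N -> -1 <= u <= 1 -> rho (t i) u <= radius m ->
        [/\ 1 - 3 / 10 * (m%:R ^+ 2 * rho (t i) u ^+ 2) <= eps i * cheb m p u,
            eps i * cheb m p u <= 1 - m%:R ^+ 2 * rho (t i) u ^+ 2 / 200
          & 0 <= eps i * cheb m p u]
    & forall u, -1 <= u <= 1 ->
        (forall i, (1 <= i <= s)%N -> radius m < rho (t i) u) ->
        `|cheb m p u| <= 497 / 500].

Let near_or_far u : (exists i, (1 <= i <= s)%N /\ rho (t i) u <= radius m) \/
  (forall i, (1 <= i <= s)%N -> radius m < rho (t i) u).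
Proof.
have [h|h] := pselect (exists i, (1 <= i <= s)%N /\ rho (t i) u <= radius m).
  by left.
by right=> i hi; rewrite ltNge; apply/negP => hr; apply: h; exists i.
Qed.

Let norm_sign (e g : R) : `|e| = 1 -> 0 <= e * g -> `|g| = e * g.
Proof. by move=> e1 h; rewrite -[RHS]ger0_norm// normrM e1 mul1r. Qed.

Let z0 i u : 0 <= m%:R ^+ 2 * rho (t i) u ^+ 2.
Proof. by rewrite mulr_ge0 ?sqr_ge0. Qed.

Let cert_le1 eps p u : (forall k, `|eps k| = 1) -> certificate eps p ->
  -1 <= u <= 1 -> `|cheb m p u| <= 1.
Proof.
move=> e1 [near far] hu; have [[i [hi hr]]|hr] := near_or_far u.
  have [_ h2 h3] := near _ _ hi hu hr.
  rewrite (norm_sign (e1 i) h3); apply: (le_trans h2).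
  by rewrite gerBl; exact: divr_ge0 (z0 i u) (ler0n _ _).
by apply: (le_trans (far _ hu hr)); lra.
Qed.

Let radius0 : 0 < radius m :> R.
Proof.
have e0 : 0 < 8 / 5 :> R by lra.
apply: divr_gt0 => //.
by rewrite ltr0n uphalf_gt0.
Qed.

Let tW i : (1 <= i <= s)%N -> -1 <= t i <= 1.
Proof. by move=> /ht /andP[h1 h2]; rewrite !ltW. Qed.

Let cert_knot eps p i : (forall k, `|eps k| = 1) -> certificate eps p ->
  (1 <= i <= s)%N -> cheb m p (t i) = eps i.
Proof.
move=> e1 [near _] hi.
have r0 : rho (t i) (t i) = 0 by rewrite /rho subrr normr0.
have [||h1 h2 _] := near i (t i) hi; first exact: tW.
  by rewrite r0 ltW.
move: h1 h2; rewrite r0 expr0n /= !mulr0 mul0r subr0 => h1 h2.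
have e : eps i * cheb m p (t i) = 1 by apply/eqP; rewrite eq_le h1 h2.
have ee : eps i * eps i = 1 by rewrite -expr2 -real_normK ?num_real// e1 expr1n.
by rewrite -[LHS]mul1r -ee -mulrA e mulr1.
Qed.

Let sgn (x : R) : R := if x < 0 then -1 else 1.
Let sgn1 x : `|sgn x| = 1.
Proof. by rewrite /sgn; case: ifP; rewrite ?normrN1 ?normr1. Qed.
Let sgnM x : x * sgn x = `|x|.
Proof.
rewrite /sgn; case: ltP => h; first by rewrite mulrN1 ltr0_norm.
by rewrite mulr1 ger0_norm.
Qed.

Let exists_cert eps : (forall k, `|eps k| = 1) -> exists p, certificate eps p.
Proof. exact: (knot_certificate m0 hD ht tinc). Qed.

Let D p := \sum_(1 <= k < s'.+1) (`|a' k| - a' k * cheb m p (t' k)).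

Let in_s' k : (1 <= k < s'.+1)%N -> (1 <= k <= s')%N. Proof. by rewrite ltnS. Qed.

Let cert_bregman p : certificate (sgn \o a) p ->
  [/\ \sum_(1 <= k < s'.+1) `|a' k| * (1 - `|cheb m p (t' k)|) <= 25 / 32 * lam,
      \sum_(j < m.+1) p j ^+ 2 <= 1 &
      \sum_(j < m.+1) (c' j - c j) ^+ 2 <= 25 / 4 * lam ^+ 2].
Proof.
move=> hp; have e1 k : `|(sgn \o a) k| = 1 by exact: sgn1.
have p1 : \sum_(j < m.+1) p j ^+ 2 <= 1.
  by rewrite -(expr1n _ 2); apply: cheb_coef_le => u; exact: (cert_le1 e1 hp).
have hcert : \sum_(1 <= i < s.+1) a i * cheb m p (t i) = \sum_(1 <= i < s.+1) `|a i|.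
  by apply: eq_big_nat => i; rewrite ltnS => hi; rewrite (cert_knot e1 hp)//= sgnM.
have [h1 h2] := bregman_bound lam0 opt same_low noise p1 hcert.
have term k : (1 <= k < s'.+1)%N -> 0 <= `|a' k| * (1 - `|cheb m p (t' k)|) <=
    `|a' k| - a' k * cheb m p (t' k).
  move=> /in_s' /ht' hu; apply/andP; split.
    by rewrite mulr_ge0// subr_ge0 (cert_le1 e1 hp).
  by rewrite mulrBr mulr1 lerD2l lerN2 -normrM ler_norm.
split=> //.
  by apply: le_trans h1; apply: ler_sum_nat => k /term /andP[].
apply: h2; rewrite big_nat; apply: sumr_ge0 => k /term /andP[h3 h4].
exact: le_trans h3 h4.
Qed.

(** An atom of the estimate at [u] pays its mass times the gap of the certificate at
    [u], and the total payment is at most [25/32 lam]. The gap is at least [1/200] of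
    the minimum in the statement. *)
Theorem global_control :
  \sum_(1 <= k < s'.+1) `|a' k| *
    Num.min (m%:R ^+ 2 * dist_to (knot_set s t) (t' k) ^+ 2) (c0 ^+ 2) <= c1 * lam.
Proof.
have e1 k : `|(sgn \o a) k| = 1 by exact: sgn1.
have [p hp] := exists_cert e1; have [h _ _] := cert_bregman hp.
apply: le_trans (c1_margin (ltW lam0)).
have h200 : 0 <= 200 :> R by exact: ler0n.
apply: le_trans (ler_wpM2l h200 h).
rewrite mulr_sumr; apply: ler_sum_nat => k /in_s' hk; have hu := ht' hk.
rewrite [leRHS]mulrCA; apply: ler_wpM2l; first exact: normr_ge0.
have [near far] := hp; have [[i [hi hr]]|hr] := near_or_far (t' k).
  have [_ h2 h3] := near _ _ hi hu hr.
  rewrite (norm_sign (e1 i) h3) ge_min; apply/orP; left.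
  apply: (@le_trans _ _ (m%:R ^+ 2 * rho (t i) (t' k) ^+ 2)); last by lra.
  apply: ler_wpM2l; first exact: sqr_ge0.
  have Ti : knot_set s t (t i) by right; exists i.
  apply: lerXn2r; rewrite ?nnegrE ?normr_ge0//; first exact: dist_to_ge0 Ti.
  exact: dist_to_le.
have h2 := far _ hu hr.
by rewrite ge_min; apply/orP; right; apply: (le_trans c0_sqr.2); lra.
Qed.

(** The pairing with half the difference of the certificates for two sign
    patterns that differ at [i] only isolates the amplitude [a i]. *)
Theorem large_jump_localization i : (1 <= i <= s)%N -> `|a i| > c2 * lam ->
  exists2 k, (1 <= k <= s')%N &
    rho (t i) (t' k) <= Num.sqrt (c1 * lam / (`|a i| - c2 * lam)) * (1 / m%:R).
Proof.
move=> hi hai; set r := Num.sqrt _ * _.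
have [//|no] := pselect (exists2 k, (1 <= k <= s')%N & rho (t i) (t' k) <= r).
exfalso.
have hr k : (1 <= k <= s')%N -> r < rho (t i) (t' k).
  by move=> hk; rewrite ltNge; apply/negP => h; apply: no; exists k.
have e1 k : `|(sgn \o a) k| = 1 by exact: sgn1.
pose em k := if k == i then - sgn (a k) else sgn (a k).
have em1 k : `|em k| = 1 by rewrite /em; case: ifP; rewrite ?normrN sgn1.
have [p hp] := exists_cert e1; have [q hq] := exists_cert em1.
have [hbreg p1 hres] := cert_bregman hp.
pose f j := (p j - q j) / 2.
have fE u : cheb m f u = (cheb m p u - cheb m q u) / 2.
  by rewrite /cheb -sumrB mulr_suml; apply: eq_bigr => j _; rewrite /f; ring.
have gap0 : 0 < `|a i| - c2 * lam by rewrite subr_gt0.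
pose x := `|a i| - c2 * lam.
have xg : 0 < x by [].
have f1 u : -1 <= u <= 1 -> `|cheb m f u| <= 1.
  move=> hu; rewrite fE normrM (ger0_norm (_ : 0 <= 2^-1)) ?invr_ge0//.
  have := cert_le1 e1 hp hu; have := cert_le1 em1 hq hu.
  by have := ler_normB (cheb m p u) (cheb m q u); lra.
have fsq : \sum_(j < m.+1) f j ^+ 2 <= 1.
  by rewrite -(expr1n _ 2); exact: cheb_coef_le.
have fknot : \sum_(1 <= j < s.+1) a j * cheb m f (t j) = `|a i|.
  rewrite (bigD1_seq i)/= ?mem_index_iota ?iota_uniq//.
  rewrite fE (cert_knot e1 hp)// (cert_knot em1 hq)//= /em eqxx.
  rewrite (_ : a i * _ = a i * sgn (a i)); last by field.
  rewrite sgnM big1_seq ?addr0// => j /andP[ji]; rewrite mem_index_iota ltnS => hj.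
  by rewrite fE (cert_knot e1 hp)// (cert_knot em1 hq)//= /em (negPf ji) subrr mul0r mulr0.
(* [kappa] compares the half difference with the gain of the certificate away
   from the knots, next to the other knots, and next to the knot [i] *)
pose kappa := Num.max (500 / 3) (200 * x / (c1 * lam)).
have c1l : 0 < c1 * lam by rewrite mulr_gt0// /c1; lra.
have kap1 : 500 / 3 <= kappa by rewrite le_max lexx.
have kap2 : 200 * x / (c1 * lam) <= kappa by rewrite le_max lexx orbT.
have kap0 : 0 <= kappa by apply: le_trans kap1; lra.
have term k : (1 <= k <= s')%N ->
    `|cheb m f (t' k)| <= kappa * (1 - `|cheb m p (t' k)|).
  move=> hk; have hu := ht' hk.
  have [near far] := hp; have [near' _] := hq.
  have [[j [hj hjr]]|hf] := near_or_far (t' k); last first.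
    apply: (le_trans (f1 _ hu)).
    exact: far_gain kap1 (far _ hu hf).
  have [h1 h2 h3] := near _ _ hj hu hjr.
  rewrite (norm_sign (e1 j) h3).
  have g0 : 0 <= 1 - (sgn \o a) j * cheb m p (t' k).
    by rewrite subr_ge0; apply: (le_trans h2); rewrite gerBl; exact: divr_ge0 (z0 _ _) (ler0n _ _).
  have [ji|ji] := eqVneq j i.
    apply: (le_trans (f1 _ hu)); subst j.
    have rz : c1 * lam / x <= m%:R ^+ 2 * rho (t i) (t' k) ^+ 2.
      have q0 : 0 <= c1 * lam / x by rewrite divr_ge0 ?ltW.
      rewrite -[leLHS](sqr_sqrtr q0) -exprMn.
      apply: lerXn2r; rewrite ?nnegrE ?sqrtr_ge0 ?mulr_ge0 ?normr_ge0//.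
      rewrite -ler_pdivrMl// mulrC; apply: ltW.
      by have := hr _ hk; rewrite /r mul1r.
    exact: near_gain xg c1l kap2 rz h2.
  have := near' _ _ hj hu hjr; rewrite /em (negPf ji) => -[h4 h5 _].
  rewrite fE; apply: (le_trans (half_diff_near (sgn1 (a j)) (z0 j (t' k)) h1 h2 h4 h5)).
  by apply: ler_wpM2r; [exact: g0|exact: kap1].
have hpair := pair_cheb m s s' t a t' a' f.
have := residual_pairing lam0 hres fsq.
rewrite hpair fknot ler_norml => /andP[lo _].
have sumle : \sum_(1 <= k < s'.+1) a' k * cheb m f (t' k) <= kappa * (25 / 32 * lam).
  apply: (@le_trans _ _ (kappa * \sum_(1 <= k < s'.+1) `|a' k| * (1 - `|cheb m p (t' k)|)));
    last exact: ler_wpM2l.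
  rewrite mulr_sumr; apply: ler_sum_nat => k /in_s' hk.
  apply: (le_trans (ler_norm _)); rewrite normrM mulrCA; apply: ler_wpM2l => //.
  exact: term.
have tot : `|a i| <= kappa * (25 / 32 * lam) + 5 / 2 * lam by lra.
have := jump_margin lam0 hai; rewrite -/x -/kappa.
by move=> /(le_lt_trans tot); rewrite ltxx.
Qed.

End Localization.

(** * Chebyshev polynomials *)
Section ChebyshevPoly.
Context {R : realType}.

Fixpoint chebT2 (k : nat) : {poly R} * {poly R} :=
  if k is j.+1 then let: (p, q) := chebT2 j in (q, 2 *: 'X * q - p) else (1, 'X).
Definition chebT k := (chebT2 k).1.

Lemma chebT0 : chebT 0 = 1. Proof. by []. Qed.
Lemma chebT1 : chebT 1 = 'X. Proof. by []. Qed.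
Lemma chebTSS k : chebT k.+2 = 2 *: 'X * chebT k.+1 - chebT k.
Proof. by rewrite /chebT /=; case: (chebT2 k) => p q. Qed.

Lemma nat_ind2 (P : nat -> Prop) : P 0%N -> P 1%N ->
  (forall k, P k -> P k.+1 -> P k.+2) -> forall k, P k.
Proof.
move=> P0 P1 PS k; suff : P k /\ P k.+1 by case.
by elim: k => // k [h1 h2]; split => //; exact: PS.
Qed.

Lemma horner_chebT k (th : R) : (chebT k).[cos th] = cos (k%:R * th).
Proof.
elim/nat_ind2: k => [||k ih1 ih2].
- by rewrite chebT0 hornerC mul0r cos0.
- by rewrite chebT1 hornerX mul1r.
rewrite chebTSS hornerD hornerN hornerM hornerZ hornerX ih1 ih2.
have -> : k.+2%:R * th = k.+1%:R * th + th by rewrite -[k.+2%:R]natr1; ring.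
have -> : k%:R * th = k.+1%:R * th - th by rewrite -[k.+1%:R]natr1; ring.
by rewrite cosB cosD; ring.
Qed.

Definition phi_poly k : {poly R} := if k == 0%N then 1 else Num.sqrt 2 *: chebT k.

Lemma phiE k (x : R) : -1 <= x <= 1 -> phi k x = (phi_poly k).[x].
Proof.
move=> hx; rewrite /phi /phi_poly; case: eqP => _; first by rewrite hornerC.
by rewrite hornerZ -horner_chebT acosK// in_itv.
Qed.

Lemma measurable_horner (q : {poly R}) (D : set R) : measurable D ->
  measurable_fun D (horner q).
Proof.
move=> mD; apply: measurable_funTS.
by apply: continuous_measurable_fun; exact: continuous_horner.
Qed.

Lemma measurable_phi k : measurable_fun (`[-1, 1] : set R) (phi k : R -> R).
Proof.
apply: (eq_measurable_fun (horner (phi_poly k))).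
  by move=> x; rewrite inE /= in_itv /= => hx; rewrite phiE.
exact: measurable_horner.
Qed.

End ChebyshevPoly.

(** * Discrete signed measures *)
Section DiscreteCharges.
Context {R : realType}.
Implicit Types (t a b : nat -> R) (s : nat).

Lemma discrete_chargeE s t a (A : set R) :
  discrete_charge s t a A = (\sum_(1 <= i < s.+1) a i * \1_A (t i))%:E.
Proof.
rewrite /discrete_charge; elim: (index_iota _ _) => [|i r ih].
  by rewrite !big_nil.
rewrite !big_cons EFinD -ih EFinM /=.
by [].
Qed.

Lemma ge0_integral_atoms s t b (D : set R) (mu : {measure set R -> \bar R})
    (f : R -> \bar R) :
  measurable D -> (forall i, (1 <= i <= s)%N -> D (t i)) ->
  (forall i, (1 <= i <= s)%N -> 0 <= b i) ->
  (forall A, measurable A -> mu A = (\sum_(1 <= i < s.+1) b i * \1_A (t i))%:E) ->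
  measurable_fun D f -> (forall x, D x -> (0 <= f x)%E) ->
  (\int[mu]_(x in D) f x = \sum_(1 <= i < s.+1) (b i)%:E * f (t i))%E.
Proof.
move=> mD Dt b0 muE mf f0.
pose m_ (n : nat) : {measure set R -> \bar R} :=
  mscale (NngNum (normr_ge0 (b n.+1))) (dirac (t n.+1)).
rewrite (eq_measure_integral (msum m_ s)); last first.
  move=> A mA _; rewrite muE// /msum big_add1 /= big_mkord.
  rewrite -sumEFin; apply: eq_bigr => i _.
  by rewrite /m_ /= /mscale /= ger0_norm ?b0 /= ?ltn_ord// EFinM.
rewrite ge0_integral_measure_sum// big_add1 /= big_mkord; apply: eq_bigr => i _.
rewrite ge0_integral_mscale//= ger0_norm ?b0 /= ?ltn_ord//.
rewrite integral_dirac// diracE mem_set ?mul1e//.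
by apply: Dt; rewrite /= ltn_ord.
Qed.

Lemma integral_atoms s t b (D : set R) (mu : {measure set R -> \bar R})
    (f : R -> R) :
  measurable D -> (forall i, (1 <= i <= s)%N -> D (t i)) ->
  (forall i, (1 <= i <= s)%N -> 0 <= b i) ->
  (forall A, measurable A -> mu A = (\sum_(1 <= i < s.+1) b i * \1_A (t i))%:E) ->
  measurable_fun D f ->
  Rintegral mu D f = \sum_(1 <= i < s.+1) b i * f (t i).
Proof.
move=> mD Dt b0 muE mf.
have mfE : measurable_fun D (EFin \o f) by exact/measurable_EFinP.
rewrite /Rintegral integralE.
rewrite (ge0_integral_atoms mD Dt b0 muE); last 2 first.
- exact: measurable_funepos.
- by move=> x _; exact: funepos_ge0.
rewrite (ge0_integral_atoms mD Dt b0 muE); last 2 first.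
- exact: measurable_funeneg.
- by move=> x _; exact: funeneg_ge0.
have -> : (\sum_(1 <= i < s.+1) (b i)%:E * (EFin \o f)^\+ (t i) =
    (\sum_(1 <= i < s.+1) b i * Num.max (f (t i)) 0)%:E)%E.
  by rewrite -sumEFin; apply: eq_bigr => i _; rewrite funeposE EFinM EFin_max.
have -> : (\sum_(1 <= i < s.+1) (b i)%:E * (EFin \o f)^\- (t i) =
    (\sum_(1 <= i < s.+1) b i * Num.max (- f (t i)) 0)%:E)%E.
  by rewrite -sumEFin; apply: eq_bigr => i _; rewrite funenegE EFinM EFin_max EFinN.
rewrite -EFinB /= -sumrB; apply: eq_bigr => i _; rewrite -mulrBr; congr (_ * _).
by case: (leP (f (t i)) 0) => h; case: (leP (- f (t i)) 0) => h'; lra.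
Qed.

(** Hahn decompositions are not unique, but each of them puts every atom with a nonzero
    weight on the side of its sign, which determines both Jordan parts. *)
Section HahnAtoms.
Variables (s : nat) (t a : nat -> R).
Hypothesis tinj : forall i j, (1 <= i <= s)%N -> (1 <= j <= s)%N -> t i = t j -> i = j.
Let nu := discrete_charge s t a.
Let P := hahn_pos nu.
Let N := hahn_neg nu.

Let nu_atom i : (1 <= i <= s)%N -> nu [set t i] = (a i)%:E.
Proof.
move=> hi; rewrite /nu discrete_chargeE; congr EFin.
rewrite (bigD1_seq i)/= ?mem_index_iota ?iota_uniq//.
rewrite indicE mem_set// mulr1 big1_seq ?addr0// => j /andP[ji].
rewrite mem_index_iota ltnS => hj; rewrite indicE memNset ?mulr0//= => e.
by move: ji; rewrite (tinj hj hi e) eqxx.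
Qed.

Let hahn := hahn_choice nu.

Let posP i : (1 <= i <= s)%N -> 0 <= a i * \1_P (t i).
Proof.
move=> hi; rewrite indicE; case: (boolP (t i \in P)) => [|_]; last by rewrite mulr0.
rewrite inE => Pi; rewrite mulr1 -lee_fin -nu_atom//.
by have [[_ h] _ _ _] := hahn; apply: h => // x ->.
Qed.

Let negN i : (1 <= i <= s)%N -> 0 <= - (a i * \1_N (t i)).
Proof.
move=> hi; rewrite indicE; case: (boolP (t i \in N)) => [|_]; last by rewrite mulr0 oppr0.
rewrite inE => Ni; rewrite mulr1 oppr_ge0 -lee_fin -nu_atom//.
by have [_ [_ h] _ _] := hahn; apply: h => // x ->.
Qed.

Let indPN x : \1_P x + \1_N x = 1 :> R.
Proof.
have [_ _ U I] := hahn; rewrite !indicE.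
have : (P `|` N) x by rewrite U.
have nPN : ~ (P `&` N) x by rewrite I.
case=> [Px|Nx].
  by rewrite mem_set// memNset ?addr0// => Nx; apply: nPN.
by rewrite [x \in N]mem_set// memNset ?add0r// => Px; apply: nPN.
Qed.

Let jposE (A : set R) : measurable A -> jordan_pos hahn A =
  (\sum_(1 <= i < s.+1) (a i * \1_P (t i)) * \1_A (t i))%:E.
Proof.
move=> mA; rewrite jordan_posE cjordan_posE /crestr0 mem_set// /crestr.
rewrite discrete_chargeE; congr EFin; apply: eq_bigr => i _.
by rewrite indicI /= -mulrA [\1_A _ * _]mulrC.
Qed.

Let jnegE (A : set R) : measurable A -> jordan_neg hahn A =
  (\sum_(1 <= i < s.+1) (- (a i * \1_N (t i))) * \1_A (t i))%:E.
Proof.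
move=> mA; rewrite jordan_negE cjordan_negE /crestr0 mem_set// /crestr.
rewrite discrete_chargeE -EFinN -sumrN; congr EFin; apply: eq_bigr => i _.
by rewrite indicI /=; ring.
Qed.

Lemma tv_norm_discrete : tv_norm nu = \sum_(1 <= i < s.+1) `|a i|.
Proof.
rewrite /tv_norm /charge_variation /= jposE// jnegE// -EFinD /= -big_split.
apply: eq_big_nat => i; rewrite ltnS => hi /=.
have h1 := posP hi; have h2 := negN hi; have h3 := indPN (t i).
rewrite !indicT !mulr1; move: h1 h2 h3; rewrite !indicE.
case: (t i \in P); case: (t i \in N) => /=.
- by move=> _ _ /eqP; rewrite -subr_eq0 addrK oner_eq0.
- by rewrite !mulr1 !mulr0 subr0 => h _ _; rewrite ger0_norm.
- by rewrite !mulr1 !mulr0 sub0r => _; rewrite oppr_ge0 => h _; rewrite ler0_norm.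
- by move=> _ _ /eqP; rewrite addr0 eq_sym oner_eq0.
Qed.

Hypothesis t1 : forall i, (1 <= i <= s)%N -> -1 <= t i <= 1.

Lemma moment_discrete k : moment k nu = \sum_(1 <= i < s.+1) a i * phi k (t i).
Proof.
have mD : measurable (`[-1, 1] : set R) by [].
have Dt i : (1 <= i <= s)%N -> (`[-1, 1]%classic : set R) (t i).
  by move=> hi; rewrite /= in_itv /= t1.
rewrite /moment /charge_integral.
rewrite (integral_atoms mD Dt posP jposE (measurable_phi k)).
rewrite (integral_atoms mD Dt negN jnegE (measurable_phi k)).
rewrite -sumrB; apply: eq_bigr => i _.
have h := indPN (t i).
rewrite -mulrBl opprK -mulrDr h mulr1//.
Qed.

Lemma on_interval_discrete : on_interval nu.
Proof.
move=> A mA AI; rewrite /nu discrete_chargeE big_nat_cond big1 ?mulr0//.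
move=> i /andP[]; rewrite ltnS => hi _; rewrite indicE memNset ?mulr0// => Ai.
by have : (A `&` `[-1, 1]%classic) (t i); [split=> //=; rewrite in_itv /= t1|rewrite AI].
Qed.

End HahnAtoms.
End DiscreteCharges.

(** * Integration by parts for splines *)
Section ChebyshevDerivatives.
Context {R : realType}.
Implicit Types (k l d : nat) (p q : {poly R}).

Let X2 : {poly R} := 1 - 'X ^+ 2.

Let deriv_X2 : X2^`() = - (2 * 'X).
Proof. by rewrite derivB derivC sub0r expr2 derivM derivX mul1r mulr1 mulr_natl mulr2n. Qed.

Let derivMnat n q : (n%:R * q)^`() = n%:R * q^`().
Proof. by rewrite !mulr_natl derivMn. Qed.

Let cheb_deriv k :
  X2 * (chebT k.+1)^`() = k.+1%:R * (chebT k - 'X * chebT k.+1) /\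
  X2 * (chebT k)^`() = k%:R * ('X * chebT k - chebT k.+1) :> {poly R}.
Proof.
elim: k => [|k [ih1 ih2]].
  rewrite chebT0 chebT1 derivX derivC !mulr0 mul0r; split=> //.
  by rewrite /X2 mul1r mulr1 expr2.
split; last by rewrite ih1 chebTSS -!mul_polyC; ring.
rewrite chebTSS derivB derivM derivZ derivX mulrBr mulrDr.
have -> : X2 * (2 *: 'X * (chebT k.+1)^`()) = 2 *: 'X * (X2 * (chebT k.+1)^`()).
  by rewrite mulrCA.
rewrite ih1 ih2 /X2 -!mul_polyC -[k.+2%:R]natr1 -[k.+1%:R]natr1.
rewrite (_ : 2%:P = 2%:R); last by rewrite polyCMn.
ring.
Qed.

(** Chebyshev's differential equation, differentiated [l] times. At [1] and [-1] the
    term of highest order vanishes, which leaves the two-term recursion solved by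
    [w]. *)
Lemma cheb_ode k l :
  X2 * (chebT k)^`(l.+2) - (2 * l%:R + 1) * 'X * (chebT k)^`(l.+1) +
  (k%:R ^+ 2 - l%:R ^+ 2) * (chebT k)^`(l) = 0 :> {poly R}.
Proof.
elim: l => [|l ih].
  have [h1 h2] := cheb_deriv k.
  rewrite derivn0 derivn1 derivnS derivn1.
  set T := chebT k in h1 h2 *; set T' := chebT k.+1 in h1 h2 *.
  have X20 : X2 != 0.
    apply/eqP => /(congr1 (fun q => q.[0])); rewrite /X2 !hornerE expr0n subr0.
    by move/eqP; rewrite oner_eq0.
  have := congr1 (@deriv R) h2; rewrite derivM deriv_X2 derivMnat derivB derivM derivX mul1r.
  move=> h3.
  apply: (mulfI X20); rewrite mulr0.
  have h4 : X2 * (X2 * T^`()^`()) =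
      k%:R * (X2 * T + 'X * (X2 * T^`()) - X2 * T'^`()) + 2 * 'X * (X2 * T^`()).
    have -> : X2 * T^`()^`() = k%:R * (T + 'X * T^`() - T'^`()) + 2 * 'X * T^`().
      by rewrite -h3; ring.
    ring.
  transitivity (X2 * (X2 * T^`()^`()) - 'X * (X2 * T^`()) + k%:R ^+ 2 * (X2 * T)).
    ring.
  rewrite h4 h1 h2 -[k.+1%:R]natr1 /X2; ring.
have := congr1 (@deriv R) ih.
have e1 : (2 * l%:R + 1) * 'X * (chebT k)^`(l.+1) =
    (2 * l + 1)%:R * ('X * (chebT k)^`(l.+1)) :> {poly R}.
  by rewrite natrD natrM mulrA.
have e2 : (k%:R ^+ 2 - l%:R ^+ 2) * (chebT k)^`(l) =
    (k ^ 2)%:R * (chebT k)^`(l) - (l ^ 2)%:R * (chebT k)^`(l) :> {poly R}.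
  by rewrite !natrX mulrBl.
rewrite e1 e2 derivD derivB derivM deriv_X2 derivMnat derivM derivX derivB !derivMnat.
rewrite -!derivnS !natrX natrD natrM raddf0.
move=> h; rewrite -[RHS]h -[l.+1%:R]natr1; ring.
Qed.

Let horner_nat n (e : R) : (n%:R : {poly R}).[e] = n%:R.
Proof. by rewrite hornerMn hornerC. Qed.

Let sgn_step (e : R) k l : e ^+ 2 = 1 ->
  (chebT k)^`(l.+1).[e] =
  e * ((k%:R ^+ 2 - l%:R ^+ 2) / (2 * l%:R + 1)) * (chebT k)^`(l).[e].
Proof.
move=> e1; have := congr1 (fun q => q.[e]) (cheb_ode k l).
rewrite /X2 !(hornerD, hornerN, hornerM, horner_exp, hornerX, hornerC, horner_nat).
rewrite -[e * e]expr2 e1 subrr mul0r sub0r => h.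
have n0 : 2 * l%:R + 1 != 0 :> R.
  by apply: lt0r_neq0; have : 0 <= l%:R :> R by []; lra.
have h2 : (2 * l%:R + 1) * (e * (chebT k)^`(l.+1).[e]) =
   (k%:R ^+ 2 - l%:R ^+ 2) * (chebT k)^`(l).[e].
  by apply/eqP; rewrite -subr_eq0 -oppr_eq0; apply/eqP; rewrite -[RHS]h; ring.
have -> : (chebT k)^`(l.+1).[e] = e * (e * (chebT k)^`(l.+1).[e]).
  by rewrite mulrA -expr2 e1 mul1r.
rewrite -mulrA; congr (_ * _); apply: (mulfI n0); rewrite h2; field.
exact: n0.
Qed.

Let wE k l : w k l = \prod_(j < l) ((k%:R ^+ 2 - j%:R ^+ 2) / (2 * j%:R + 1)) :> R.
Proof.
rewrite /w; case: leqP => [_|kl]; first by rewrite mul1r.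
by rewrite mul0r (bigD1 (Ordinal kl))//= subrr !mul0r.
Qed.

Lemma cheb_deriv_at1 k l : (chebT k)^`(l).[1] = w k l :> R.
Proof.
rewrite wE; elim: l => [|l ih].
  by rewrite big_ord0 derivn0 -cos0 horner_chebT mulr0 cos0.
by rewrite sgn_step ?expr1n// ih big_ord_recr /= mul1r mulrC.
Qed.

Lemma cheb_deriv_atN1 k l : (chebT k)^`(l).[-1] = (-1) ^+ (k + l) * w k l :> R.
Proof.
rewrite wE; elim: l => [|l ih].
  rewrite big_ord0 derivn0 mulr1 addn0 -cospi horner_chebT mulr_natl.
  by rewrite -[pi *+ k]add0r (alternatingn (@cosDpi R)) cos0 mulr1 cospi.
rewrite sgn_step ?sqrrN ?expr1n// ih big_ord_recr /= addnS [(-1) ^+ _.+1]exprS.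
move: (_ / _) ((-1) ^+ _) (\prod_(_ < _) _) => q e b; ring.
Qed.

(** The antiderivative of [p * q^`(d.+1)] found by [d + 1] integrations by parts when
    [p] has degree at most [d]. *)
Definition byparts d p q : {poly R} :=
  \sum_(l < d.+1) (-1) ^+ l * (p^`(l) * q^`(d - l)).

Lemma deriv_byparts d p q : (size p <= d.+1)%N ->
  (byparts d p q)^`() = p * q^`(d.+1).
Proof.
move=> hp.
have p0 : p^`(d.+1) = 0 by exact: derivn_poly0.
suff h n : (n <= d)%N ->
    (\sum_(l < n.+1) (-1) ^+ l * (p^`(l) * q^`(d - l)))^`() =
    p * q^`(d.+1) + (-1) ^+ n * (p^`(n.+1) * q^`(d - n)).
  by rewrite /byparts h// subnn p0 mul0r mulr0 addr0.
have sgnd (j : nat) (u : {poly R}) : ((-1) ^+ j * u)^`() = (-1) ^+ j * u^`().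
  by rewrite -signr_odd; case: (odd j); rewrite /= ?expr0 ?expr1 ?mul1r ?mulN1r ?derivN.
elim: n => [|n ih] hn.
  rewrite big_ord_recr big_ord0 /= add0r !expr0 !mul1r subn0 derivM -!derivnS.
  by rewrite addrC.
rewrite big_ord_recr derivD ih; last exact: ltnW.
rewrite [nat_of_ord _]/= sgnd derivM.
rewrite -[p^`(n.+1)^`()]derivnS -[q^`(d - n.+1)^`()]derivnS subnSK//.
by rewrite exprS; ring.
Qed.

Lemma bypartsD d p1 p2 q : byparts d (p1 + p2) q = byparts d p1 q + byparts d p2 q.
Proof. by rewrite -big_split; apply: eq_bigr => l _ /=; rewrite derivnD; ring. Qed.

Lemma bypartsN d p q : byparts d (- p) q = - byparts d p q.
Proof. by rewrite -sumrN; apply: eq_bigr => l _ /=; rewrite derivnN; ring. Qed.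

Lemma horner_byparts d p q (x : R) : (byparts d p q).[x] =
  \sum_(l < d.+1) (-1) ^+ l * (p^`(l).[x] * q^`(d - l).[x]).
Proof.
rewrite /byparts horner_sum; apply: eq_bigr => l _.
have h1 : (1 : {poly R}).[x] = 1 by rewrite -polyC1 hornerC.
by rewrite !hornerM horner_exp hornerN h1.
Qed.

Lemma horner_byparts_rev d p q (x : R) : (-1) ^+ d * (byparts d p q).[x] =
  \sum_(l < d.+1) (-1) ^+ l * (p^`(d - l).[x] * q^`(l).[x]).
Proof.
rewrite horner_byparts mulr_sumr (reindex_inj rev_ord_inj); apply: eq_bigr => l _ /=.
rewrite subSS mulrA -exprD subKn; last by rewrite -ltnS.
congr (_ * _).
have -> : (d + (d - l) = (d - l).*2 + l)%N by have := ltn_ord l; lia.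
by rewrite exprD -mul2n exprM sqrrN !expr1n mul1r.
Qed.

End ChebyshevDerivatives.

(** * Piecewise polynomials *)
Section LocalPolynomials.
Context {R : realType}.
Implicit Types (p q Q : {poly R}) (x u : R) (f : R -> R).

Lemma derive1n_local f p (a b : R) n :
  (forall x, a < x < b -> f x = p.[x]) ->
  forall x, a < x < b -> derive1n n f x = p^`(n).[x].
Proof.
move=> h; elim: n => [|n ih] x xab; first by rewrite derive1n0 derivn0 h.
rewrite derive1nS derivnS derive1E.
have nf : \near x, derive1n n f x = p^`(n).[x].
  have xi : x \in `]a, b[ by rewrite in_itv.
  by near=> y; apply: ih; near: y; have := near_in_itvoo xi; apply: filterS => y; rewrite in_itv.
by rewrite (near_eq_derive _ nf) -derive1E -derivE.
Unshelve. all: by end_near. Qed.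

(** The derivatives of both polynomials at [b] are one-sided limits of the continuous
    derivatives of [g]. *)
Lemma class_C_matching n (g : R -> R) p q (a b c : R) : a < b < c ->
  (forall j x, (j < n)%N -> derivable (derive1n j g) x 1) ->
  continuous (derive1n n g) ->
  (forall x, a < x < b -> g x = p.[x]) -> (forall x, b < x < c -> g x = q.[x]) ->
  forall j, (j <= n)%N -> p^`(j).[b] = q^`(j).[b].
Proof.
move=> /andP[ab bc] dg cg gp gq j jn.
have cj : {for b, continuous (derive1n j g)}.
  move: jn; rewrite leq_eqVlt => /orP[/eqP ->|jn]; first exact: cg.
  by apply/differentiable_continuous/derivable1_diffP; exact: dg.
have lim_eq (F : set_system R) (r : {poly R}) : ProperFilter F -> F --> b ->
    (\forall x \near F, derive1n j g x = r^`(j).[x]) ->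
    derive1n j g b = r^`(j).[b].
  move=> FF Fb hF.
  have h1 : derive1n j g x @[x --> F] --> derive1n j g b by apply: cvg_trans cj; exact: cvg_fmap2.
  have h2 : r^`(j).[x] @[x --> F] --> r^`(j).[b].
    by apply: cvg_trans (@continuous_horner _ r^`(j) b); exact: cvg_fmap2.
  have h3 : derive1n j g x @[x --> F] --> r^`(j).[b].
    by apply: cvg_trans h2; apply: near_eq_cvg; apply: filterS hF => x ->.
  exact: (cvg_unique (@Rhausdorff R) h1 h3).
have <- : derive1n j g b = p^`(j).[b].
  apply: (lim_eq (at_left b)); first exact: cvg_within.
  near=> x; apply: (derive1n_local j gp); apply/andP; split.
    by near: x; exact: nbhs_left_gt.
  by near: x; exact: nbhs_left_lt.
apply: (lim_eq (at_right b)); first exact: cvg_within.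
near=> x; apply: (derive1n_local j gq); apply/andP; split.
  by near: x; exact: nbhs_right_gt.
by near: x; exact: nbhs_right_lt.
Unshelve. all: by end_near. Qed.

Local Notation mu := (@lebesgue_measure R).

Lemma integral_poly q Q (a b : R) : a < b -> Q^`() = q ->
  Rintegral mu `[a, b] (horner q) = Q.[b] - Q.[a].
Proof.
move=> ab <-; rewrite /Rintegral (@continuous_FTC2 _ _ (horner Q))//.
- by apply: continuous_subspaceT; exact: continuous_horner.
- split.
  + by move=> x _; exact: derivable_horner.
  + by apply: cvg_at_right_filter; exact: continuous_horner.
  + by apply: cvg_at_left_filter; exact: continuous_horner.
- by move=> x _; rewrite derivE.
Qed.

Definition step_poly u q : R -> R := horner q \_ `[u, 1].

Lemma integrable_step u q : mu.-integrable `[-1, 1] (EFin \o step_poly u q).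
Proof.
have h : mu.-integrable `[u, 1] (EFin \o (horner q)).
  apply: continuous_compact_integrable; first exact: segment_compact.
  by apply: continuous_subspaceT; exact: continuous_horner.
have {h} : mu.-integrable setT (EFin \o step_poly u q).
  by rewrite /step_poly -restrict_EFin; refine ((integrable_mkcond _ _).1 h).
exact: integrableS.
Qed.

Lemma integral_step u q Q : -1 <= u < 1 -> Q^`() = q ->
  Rintegral mu `[-1, 1] (step_poly u q) = Q.[1] - Q.[u].
Proof.
move=> /andP[u1 u2] hQ; rewrite -Rintegral_mkcondr.
rewrite (_ : _ `&` _ = `[u, 1]%classic); first exact: integral_poly.
apply/seteqP; split=> x /=; first by case.
rewrite !in_itv /= => /andP[h1 h2]; split; last by rewrite h1 h2.
by rewrite h2 (le_trans u1 h1).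
Qed.

Lemma integral_steps n (u : nat -> R) (q Q : nat -> {poly R}) :
  (forall k, (k < n)%N -> -1 <= u k < 1) -> (forall k, (k < n)%N -> (Q k)^`() = q k) ->
  Rintegral mu `[-1, 1] (fun x => \sum_(k < n) step_poly (u k) (q k) x) =
  \sum_(k < n) ((Q k).[1] - (Q k).[u k]).
Proof.
have int_sum m : mu.-integrable `[-1, 1]
    (EFin \o (fun x => \sum_(k < m) step_poly (u k) (q k) x)).
  rewrite (_ : _ \o _ = (fun x => \sum_(k < m) (EFin \o step_poly (u k) (q k)) x)%E).
    by apply: integrable_sum => // k _; exact: integrable_step.
  by apply/funext => x /=; rewrite sumEFin.
elim: n => [|n ih] hu hQ.
  rewrite big_ord0 (eq_Rintegral _ (g := fun=> 0)); first by rewrite Rintegral_cst// mul0r.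
  by move=> x _; rewrite big_ord0.
rewrite big_ord_recr /= -ih; last 2 first.
- by move=> k kn; apply: hu; exact: ltnW.
- by move=> k kn; apply: hQ; exact: ltnW.
rewrite -(integral_step (hu n (ltnSn n)) (hQ n (ltnSn n))) -RintegralD//.
  by apply: eq_Rintegral => x _; rewrite big_ord_recr.
exact: integrable_step.
Qed.

Lemma measurable_steps n (u : nat -> R) (q : nat -> {poly R}) (D : set R) : measurable D ->
  measurable_fun D (fun x => \sum_(k < n) step_poly (u k) (q k) x).
Proof.
move=> mD; apply: measurable_sum => k.
apply: measurable_funTS; rewrite /step_poly.
by apply/(measurable_restrictT _ _).1 => //; exact: measurable_horner.
Qed.

Lemma Rintegral_interior (f g : R -> R) : measurable_fun (`]-1, 1[ : set R) g ->
  (forall x, -1 < x < 1 -> f x = g x) ->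
  Rintegral mu `[-1, 1] f = Rintegral mu `[-1, 1] g.
Proof.
move=> mg fg.
have fgi : {in (`]-1, 1[%classic : set R), f =1 g}.
  by move=> x; rewrite inE /= in_itv; exact: fg.
have mgE : measurable_fun (`]-1, 1[ : set R) (EFin \o g) by exact/measurable_EFinP.
have mfE : measurable_fun (`]-1, 1[ : set R) (EFin \o f).
  by apply: eq_measurable_fun mgE => x xi; rewrite /= fgi.
rewrite /Rintegral integral_itv_bndoo// [in RHS]integral_itv_bndoo//; congr fine.
by apply: eq_integral => x xi; rewrite fgi.
Qed.

End LocalPolynomials.

(** * Moments of the derivative of a spline *)
Section SplineMoments.
Context {R : realType}.
Variables (d s : nat) (t : nat -> R) (P : nat -> {poly R}).
Hypothesis spl : is_spline d s t P.
Implicit Types (j k : nat) (x : R).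

Let u k : R := if k == 0%N then -1 else t k.
Let q k : {poly R} := if k == 0%N then P 0%N else P k - P k.-1.
Let A j x : R := ((j <= s)%N && (u j <= x))%:R.

Let u_lt1 k : (k <= s)%N -> -1 <= u k < 1.
Proof.
have [ht _ _ _] := spl; rewrite /u; case: eqP => [_ _|/eqP k0 ks].
  by rewrite lexx -subr_gt0 opprK addr_gt0.
by have /andP[h1 h2] : -1 < t k < 1 by [apply: ht; rewrite lt0n k0]; rewrite ltW.
Qed.

Let u_lt k : (k < s)%N -> u k < u k.+1.
Proof.
have [ht tlt _ _] := spl; rewrite {2}/u /= /u; case: eqP => [-> h|/eqP k0 h].
  by have /andP[] : -1 < t 1 < 1 by apply: ht.
by apply: tlt; rewrite lt0n k0.
Qed.

Let u_le i j : (i <= j <= s)%N -> u i <= u j.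
Proof.
elim: j => [|j ih]; first by rewrite leqn0 => /andP[/eqP ->].
case/andP; rewrite leq_eqVlt => /orP[/eqP -> //|ij] js.
apply: le_trans (ltW (u_lt js)); apply: ih; rewrite -ltnS ij /=; exact: ltnW.
Qed.

Let indic_piece k x : (k <= s)%N -> -1 <= x <= 1 ->
  \1_[set` piece_itv s t k] x = A k x - A k.+1 x.
Proof.
move=> ks /andP[x0 x1]; rewrite indicE mem_setE /piece_itv -/(u k) /A ks /=.
case: eqP => [->|/eqP ks']; rewrite in_itv /=.
  by rewrite ltnn subr0 x1 andbT.
have lt : (k < s)%N by rewrite ltn_neqAle ks' ks.
have := u_lt lt; rewrite lt /= /u /= => ult.
case: (leP (t k.+1) x) => h; last by rewrite subr0 andbT.
by rewrite andbF (le_trans (ltW ult) h) subrr.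
Qed.

Let piecewiseE x : -1 <= x <= 1 ->
  piecewise s t P x = \sum_(k < s.+1) (A k x - A k.+1 x) * (P k).[x].
Proof.
move=> hx; rewrite /piecewise big_mkord; apply: eq_bigr => k _.
by rewrite indic_piece// -ltnS.
Qed.

(** Summation by parts turns the pieces into a sum of half-line steps. *)
Let piecewise_steps x : -1 <= x <= 1 ->
  piecewise s t P x = \sum_(k < s.+1) A k x * (q k).[x].
Proof.
move=> hx; rewrite piecewiseE//.
have abel n : \sum_(k < n.+1) (A k x - A k.+1 x) * (P k).[x] =
    \sum_(k < n.+1) A k x * (q k).[x] - A n.+1 x * (P n).[x].
  elim: n => [|n ih]; first by rewrite !big_ord_recl !big_ord0 /= !addr0 mulrBl.
  rewrite big_ord_recr ih [in RHS]big_ord_recr /= /q /= hornerD hornerN; ring.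
by rewrite abel /A ltnn mul0r subr0.
Qed.

Let piecewise_on k x : (k <= s)%N -> u k <= x <= 1 -> ((k < s)%N -> x < u k.+1) ->
  piecewise s t P x = (P k).[x].
Proof.
move=> ks /andP[ux x1] xu.
have x0 : -1 <= x by apply: le_trans ux; have /andP[] := u_lt1 ks.
have AE j : A j x = (j <= k)%N%:R.
  rewrite /A; congr (nat_of_bool _)%:R; case: (leqP j k) => jk.
    rewrite (leq_trans jk ks) /=; apply: le_trans ux.
    by apply: u_le; rewrite jk ks.
  case: (leqP j s) => //= js; apply/negbTE; rewrite -ltNge.
  apply: (lt_le_trans (xu (leq_trans jk js))).
  by apply: u_le; rewrite jk js.
rewrite piecewiseE ?x0//.
have hk : (k < s.+1)%N by [].
rewrite (bigD1 (Ordinal hk))//= big1 => [|j /eqP jk].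
  by rewrite !AE leqnn ltnn subr0 mul1r addr0.
have {}jk : (j != k :> nat) by apply/eqP => e; apply: jk; apply: val_inj.
rewrite !AE; rewrite ltn_neqAle jk /= subrr mul0r//.
Qed.

Lemma top_derivE (p : {poly R}) x : (size p <= d.+1)%N -> p^`(d).[x] = top_deriv d p.
Proof.
move=> hp; rewrite /top_deriv (@size1_polyC _ p^`(d)) ?hornerC//.
apply/leq_sizeP => j j0; rewrite coef_derivn nth_default ?mul0rn//.
by apply: (leq_trans hp); rewrite -addn1 leq_add2l.
Qed.

Let size_P k : (k <= s)%N -> (size (P k) <= d.+1)%N.
Proof. by have [_ _ h _] := spl; exact: h. Qed.

Let size_q k : (k <= s)%N -> (size (q k) <= d.+1)%N.
Proof.
move=> ks; rewrite /q; case: eqP => _; first by rewrite size_P.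
rewrite (leq_trans (size_polyD _ _))// geq_max size_polyN !size_P//.
by rewrite (leq_trans (leq_pred k)).
Qed.

Let deriv_q k j : (1 <= k <= s)%N -> (j < d)%N -> (q k)^`(j).[t k] = 0.
Proof.
move=> /andP[k0 ks] jd.
have [ht tlt _ Cf] := spl.
have d0 : (0 < d)%N by exact: leq_ltn_trans jd.
have [g [fg dg cg]] := Cf d0.
have k1s : (k.-1 < s)%N by case: k k0 ks.
have uk : u k = t k by rewrite /u gtn_eqF.
have ukE : u k.-1.+1 = t k by rewrite prednK.
pose c := if k == s then 1 else u k.+1.
have bc : t k < c.
  rewrite /c; case: eqP => [_|/eqP ks'].
    by have /andP[] : -1 < t k < 1 by apply: ht; rewrite k0.
  by rewrite -uk u_lt// ltn_neqAle ks' ks.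
have c1 : c <= 1.
  rewrite /c; case: eqP => [//|/eqP ks'].
  have ks2 : (k < s)%N by rewrite ltn_neqAle ks' ks.
  by have /andP[_ /ltW] := u_lt1 ks2.
have /andP[tk0 tk1] : -1 < t k < 1 by apply: ht; rewrite k0.
have ab : u k.-1 < t k by rewrite -ukE; exact: u_lt.
have /andP[uk10 _] := u_lt1 (ltnW k1s).
have := @class_C_matching R d.-1 g (P k.-1) (P k) (u k.-1) (t k) c.
rewrite ab bc => /(_ isT dg cg) h.
rewrite /q gtn_eqF// derivnB hornerD hornerN -h ?subrr//.
- move=> x /andP[x0 x1]; rewrite -fg; last first.
    by rewrite /= in_itv /= (le_trans uk10 (ltW x0)) (le_trans (ltW x1) (ltW tk1)).
  apply: piecewise_on; first exact: ltnW.
    by rewrite (ltW x0) (le_trans (ltW x1) (ltW tk1)).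
  by rewrite ukE.
- move=> x /andP[x0 x1]; rewrite -fg; last first.
    by rewrite /= in_itv /= (le_trans (ltW tk0) (ltW x0)) (le_trans (ltW x1) c1).
  apply: piecewise_on => //; first by rewrite uk (ltW x0) (le_trans (ltW x1) c1).
  by move=> ks2; move: x1; rewrite /c ltn_eqF.
by rewrite -ltnS prednK.
Qed.

Let byparts_knot k (tau : {poly R}) : (1 <= k <= s)%N ->
  (byparts d (q k) tau).[t k] = (-1) ^+ d * (jump d P k * tau.[t k]).
Proof.
move=> hk; have /andP[k0 ks] := hk.
rewrite horner_byparts big_ord_recr /= subnn derivn0 big1 => [|j _].
  rewrite add0r /q gtn_eqF// derivnB hornerD hornerN !top_derivE// size_P//.
  by rewrite (leq_trans (leq_pred k)).
by rewrite deriv_q// mul0r mulr0.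
Qed.

Local Notation mu := (@lebesgue_measure R).

(** Integrating by parts [d + 1] times: the lower order boundary terms at a knot
    cancel by smoothness, and only the jump of the top derivative remains. *)
Lemma spline_byparts k : theta d k (piecewise s t P) =
  (byparts d (P s) (phi_poly k)).[1] - (byparts d (P 0%N) (phi_poly k)).[-1] -
  (-1) ^+ d * \sum_(1 <= i < s.+1) jump d P i * phi k (t i).
Proof.
pose tau : {poly R} := phi_poly k.
pose B (p : {poly R}) := byparts d p tau.
transitivity (Rintegral mu `[-1, 1]
    (fun x => \sum_(j < s.+1) step_poly (u j) (q j * tau^`(d.+1)) x)).
  apply: Rintegral_interior => [|x hx]; first exact: (@measurable_steps _ _ u (fun j => q j * tau^`(d.+1))).
  have hx' : -1 <= x <= 1 by case/andP: hx => h1 h2; rewrite !ltW.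
  rewrite (@derive1n_local R (phi k) tau (-1) 1)//; last first.
    by move=> y /andP[h1 h2]; apply: phiE; rewrite !ltW.
  rewrite piecewise_steps// mulr_suml; apply: eq_bigr => j _.
  rewrite /A /step_poly patchE mem_setE in_itv /= -ltnS ltn_ord /=.
  case/andP: hx' => _ ->; rewrite andbT; case: ifP => _; last by rewrite !mul0r.
  by rewrite mul1r hornerM.
rewrite (@integral_steps _ _ u (fun j => q j * tau^`(d.+1)) (fun j => B (q j))); first last.
- by move=> j js; rewrite deriv_byparts// size_q.
- by move=> j js; exact: u_lt1.
rewrite big_ord_recl big_add1 /= big_mkord /u /q /=.
have tel n : (n <= s)%N -> \sum_(i < n) ((B (P i.+1 - P i)).[1] - (B (P i.+1 - P i)).[t i.+1]) =
    (B (P n)).[1] - (B (P 0%N)).[1] - (-1) ^+ d * \sum_(i < n) jump d P i.+1 * phi k (t i.+1).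
  elim: n => [|n ih] ns; first by rewrite !big_ord0 mulr0 !subrr.
  rewrite !big_ord_recr /= ih; last exact: ltnW.
  have [ht _ _ _] := spl.
  have /andP[t0 t1] : -1 < t n.+1 < 1 by apply: ht.
  have := @byparts_knot n.+1 tau; rewrite ns /q /= => /(_ isT) ->.
  rewrite /B bypartsD bypartsN hornerD hornerN -/(B _) -/(B _).
  rewrite phiE ?ltW// -/tau; ring.
rewrite tel//; ring.
Qed.

(** The data fed to the procedure are the moments of the derivative measure, up to
    the noise in the integrals against the spline. *)
Lemma observation_moment k (Q : {poly R}) : (d < k)%N ->
  observation d (left_data P) (right_data s P) Q k =
  \sum_(1 <= i < s.+1) jump d P i * phi k (t i) +
  (-1) ^+ d.+1 * (theta d k (fun x => Q.[x]) - theta d k (piecewise s t P)).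
Proof.
move=> dk; rewrite /observation leqNgt dk.
have k0 : (k == 0%N) = false by case: (k) dk.
rewrite k0 /= spline_byparts.
have pk : phi_poly k = Num.sqrt 2 *: chebT k :> {poly R} by rewrite /phi_poly k0.
have E1 : Num.sqrt 2 * (\sum_(l < d.+1) (-1) ^+ l * w k l * right_data s P (d - l)) =
    (-1) ^+ d * (byparts d (P s) (phi_poly k)).[1].
  rewrite horner_byparts_rev mulr_sumr; apply: eq_bigr => l _.
  rewrite pk derivnZ hornerZ cheb_deriv_at1 /right_data.
  move: (Num.sqrt _) ((-1) ^+ l) (w _ _) => c e v; ring.
have E2 : (-1) ^+ k.+1 * Num.sqrt 2 * (\sum_(l < d.+1) w k l * left_data P (d - l)) =
    - ((-1) ^+ d * (byparts d (P 0%N) (phi_poly k)).[-1]).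
  rewrite horner_byparts_rev mulr_sumr -sumrN; apply: eq_bigr => l _.
  rewrite pk derivnZ hornerZ cheb_deriv_atN1 /left_data.
  rewrite exprS exprD.
  have : (-1) ^+ l * (-1) ^+ l = 1 :> R by rewrite -exprD addnn -mul2n exprM sqrrN !expr1n.
  move: (Num.sqrt _) ((-1) ^+ l) ((-1) ^+ k) (w _ _) => c e f v ee.
  have vE : v = e * e * v by rewrite ee mul1r.
  rewrite [in LHS]vE; ring.
rewrite E1 E2.
have : (-1) ^+ d * (-1) ^+ d = 1 :> R by rewrite -exprD addnn -mul2n exprM sqrrN !expr1n.
rewrite exprS; move: ((-1) ^+ d) => e ee.
move: (\sum_(_ <= _ < _) _) => S.
apply/eqP; rewrite -subr_eq0; apply/eqP; transitivity ((e * e - 1) * S); first by ring.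
by rewrite ee subrr mul0r.
Qed.

End SplineMoments.

(** * Gaussian noise *)
Section GaussianBox.
Context {R : realType}.
Local Notation mu := (@lebesgue_measure R).

Let normal_pdf_shift (c s u x : R) : 0 < s -> 0 <= u -> ~ (c - u <= x <= c + u) ->
  normal_pdf c s x <=
  expR (- (u ^+ 2 / (s ^+ 2 *+ 2))) * (normal_pdf (c + u) s x + normal_pdf (c - u) s x).
Proof.
move=> s0 u0 hx; have sn : s != 0 by rewrite gt_eqF.
have s2 : 0 < s ^+ 2 *+ 2 by rewrite mulrn_wgt0// exprn_gt0.
have shift v : u ^+ 2 + (x - v) ^+ 2 <= (x - c) ^+ 2 ->
    normal_pdf c s x <= expR (- (u ^+ 2 / (s ^+ 2 *+ 2))) * normal_pdf v s x.
  move=> h; rewrite !normal_pdfE// mulrCA ler_wpM2l ?normal_peak_ge0//.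
  rewrite /normal_fun -expRD ler_expR !mulNr -opprD lerN2 -mulrDl.
  by rewrite ler_wpM2r// invr_ge0 ltW.
have e0 := expR_ge0 (- (u ^+ 2 / (s ^+ 2 *+ 2))).
rewrite mulrDr; case: (leP x (c + u)) => h1; last first.
  apply: (le_trans (shift (c + u) _)); first by nra.
  by rewrite lerDl mulr_ge0// normal_pdf_ge0.
have h2 : x < c - u by rewrite ltNge; apply/negP => h; apply: hx; rewrite h h1.
apply: (le_trans (shift (c - u) _)); first by nra.
by rewrite lerDr mulr_ge0// normal_pdf_ge0.
Qed.

(** Outside the interval the density is at most [exp (- u^2 / (2 s^2))] times one of
    the densities recentred at its end points, each of total mass one. *)
Lemma normal_tail (c s u : R) : 0 < s -> 0 <= u ->
  1 - 2 * expR (- (u ^+ 2 / (s ^+ 2 *+ 2))) <= fine (normal_prob c s `[c - u, c + u]).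
Proof.
move=> s0 u0; set e := expR _.
have e0 : 0 <= e by exact: expR_ge0.
pose I : set R := `[c - u, c + u]%classic.
have mI : measurable I by exact: measurable_itv.
have finI : normal_prob c s I \is a fin_num by exact: fin_num_measure.
have tail : (normal_prob c s (~` I) <= (2 * e)%:E)%E.
  pose g x := e * (normal_pdf (c + u) s x + normal_pdf (c - u) s x).
  have mp v : measurable_fun setT (EFin \o normal_pdf v s).
    by apply/measurable_EFinP; exact: measurable_normal_pdf.
  have mg : measurable_fun setT (EFin \o g).
    apply/measurable_EFinP; apply: measurable_funM => //.
    by apply: measurable_funD; exact: measurable_normal_pdf.
  have g0 x : (0 <= (g x)%:E)%E.
    by rewrite lee_fin mulr_ge0// addr_ge0// normal_pdf_ge0.
  have -> : (2 * e)%:E = (\int[mu]_x (g x)%:E)%E.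
    under eq_integral do rewrite /g EFinM EFinD.
    rewrite ge0_integralZl//; last 2 first.
    - by apply: emeasurable_funD; exact: mp.
    - by move=> x _; rewrite -EFinD lee_fin addr_ge0// normal_pdf_ge0.
    rewrite ge0_integralD//; last 4 first.
    - by move=> x _; rewrite lee_fin normal_pdf_ge0.
    - exact: mp.
    - by move=> x _; rewrite lee_fin normal_pdf_ge0.
    - exact: mp.
    by rewrite !integral_normal_pdf -EFinD -EFinM mulrC.
  apply: (@le_trans _ _ (\int[mu]_(x in ~` I) (g x)%:E)%E); last first.
    apply: ge0_subset_integral => //; exact: measurableC.
  apply: ge0_le_integral => //.
  - exact: measurableC.
  - by move=> x _; rewrite lee_fin normal_pdf_ge0.
  - by apply: measurable_funTS; exact: mp.
  - exact: measurable_funTS.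
  - move=> x Ix; rewrite lee_fin; apply: normal_pdf_shift => //.
move: tail; rewrite probability_setC// -/I -[X in (_ - X)%E](fineK finI).
rewrite -[X in (X - _)%E]/(1%:E) -EFinB lee_fin.
move: (fine _) => y; lra.
Qed.

Let prod_ge_union n (x : 'I_n -> R) (q : R) : (forall i, 0 <= x i <= 1) ->
  (forall i, 1 - q <= x i) -> 1 - n%:R * q <= \prod_(i < n) x i.
Proof.
move=> x01 xq.
suff : 0 <= \prod_(i < n) x i <= 1 /\ 1 - n%:R * q <= \prod_(i < n) x i by case.
elim: n x x01 xq => [|n ih] x x01 xq.
  by rewrite big_ord0 mul0r subr0 ler01 lexx.
rewrite big_ord_recr /=.
have [||/andP[p0 p1] h] := ih (x \o widen_ord (leqnSn n)).
- by move=> i; exact: x01.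
- by move=> i; exact: xq.
have /andP[y0 y1] := x01 ord_max; have yq := xq ord_max.
move: p0 p1 h y0 y1 yq => /=; move: (\prod_(_ < _) _) (x _) => p y p0 p1 h y0 y1 yq.
split; first by rewrite mulr_ge0//= mulr_ile1.
rewrite -natr1; nra.
Qed.

Lemma gaussian_box (disp : measure_display) (Omega : measurableType disp)
    (Pr : probability Omega R) n (X : 'I_n -> Omega -> R) (mean : 'I_n -> R) (s u : R) :
  isotropic_gaussian Pr X mean s -> 0 < s -> 0 <= u ->
  let E := [set om | forall i, `|X i om - mean i| <= u] in
  measurable E /\
  ((1 - n%:R * (2 * expR (- (u ^+ 2 / (s ^+ 2 *+ 2)))))%:E <= Pr E)%E.
Proof.
move=> [mX law] s0 u0 E.
pose A i : set R := `[mean i - u, mean i + u]%classic.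
have EE : E = [set om | forall i, A i (X i om)].
  apply/seteqP; split=> om /= h i; have := h i;
    by rewrite /A /= in_itv /= ler_distl.
have mA i : measurable (A i) by exact: measurable_itv.
split.
  rewrite EE (_ : [set om | _] = \bigcap_(i in setT) (X i @^-1` A i)); last first.
    by apply/seteqP; split=> om h i; [move=> _; exact: h|exact: (h i I)].
  apply: fin_bigcap_measurable => // i _.
  by rewrite -[_ @^-1` _]setTI; exact: mX.
rewrite EE law// lee_fin; apply: prod_ge_union => i; last exact: normal_tail.
apply/andP; split; first by rewrite fine_ge0.
rewrite -lee_fin fineK; first by apply: probability_le1; exact: mA.
by apply: fin_num_measure; exact: mA.
Qed.

(** As [2 (m - d)] is less than [N = 5 (m + d + 1)], one factor [N^-1] of
    [N^-(1 + alpha)] absorbs the number of coordinates. *)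
Lemma gaussian_level (m d : nat) (al : R) : (d < m)%N -> 0 < al ->
  (m - d)%:R * (2 * expR (- ((1 + al) * ln (5 * (m + d + 1)%:R)))) <
  (1 / (5 * (m + d)%:R)) `^ al :> R.
Proof.
move=> dm al0.
have md0 : (0 : R) < (m + d)%:R by rewrite ltr0n; lia.
have N0 : (0 : R) < 5 * (m + d + 1)%:R by rewrite mulr_gt0// ltr0n; lia.
have M0 : (0 : R) < 5 * (m + d)%:R by rewrite mulr_gt0.
set L := ln _.
have eL : expR L = 5 * (m + d + 1)%:R by rewrite lnK.
have lt : (m - d)%:R * 2 < expR L.
  rewrite eL natrB ?(ltnW dm)// !natrD.
  have := ler0n R m; have := ler0n R d; lra.
rewrite mulrA; apply: (@lt_le_trans _ _ (expR L * expR (- ((1 + al) * L)))).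
  by rewrite ltr_pM2r// expR_gt0.
rewrite -expRD /powR gt_eqF ?divr_gt0//.
rewrite ler_expR div1r lnV ?posrE// mulrN mulrDl mul1r opprD addrA subrr sub0r lerN2.
by rewrite ler_wpM2l ?(ltW al0)// ler_ln ?posrE// ler_pM2l// ler_nat addn1.
Qed.

End GaussianBox.

(** * Splines from the output of the procedure *)
Section Recovery.
Context {R : realType}.

Lemma jump_atom (d k : nat) (P : nat -> {poly R}) (a c : R) :
  P k - P k.-1 = (a / d`!%:R) *: ('X - c%:P) ^+ d -> jump d P k = a.
Proof.
have topE p : top_deriv d p = p`_d *+ d`!.
  by rewrite /top_deriv horner_coef0 coef_derivn addn0 ffactnn.
rewrite /jump !topE -mulrnBl -coefB => ->; rewrite coefZ -[LHS]mulr_natr.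
have /eqP : ('X - c%:P) ^+ d \is monic by rewrite monic_exp// monicXsubC.
rewrite /lead_coef size_exp_XsubC /= => ->.
by rewrite mulr1 divfK// pnatr_eq0 -lt0n fact_gt0.
Qed.

Lemma sum_tail_const (m d : nat) (K : R) :
  \sum_(j < m.+1 | (d < j)%N) K = (m - d)%:R * K.
Proof.
rewrite -(big_mkord (fun j => d < j)%N (fun=> K)).
rewrite -(big_nat_widenl d.+1 0 m.+1 xpredT (fun=> K))// sumr_const_nat subSS.
by rewrite mulr_natl.
Qed.

(** The derivative measure of the spline satisfies the constraint, so the minimizer does
    at least as well; for measures with distinct atoms everything is explicit. *)
Lemma discrete_optimality (m d s s' : nat) (t a t' a' y : nat -> R) (lam : R) :
  (forall k, (1 <= k <= s)%N -> -1 < t k < 1) ->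
  (forall k, (1 <= k < s)%N -> t k < t k.+1) ->
  (forall k, (1 <= k <= s')%N -> -1 <= t' k <= 1) ->
  (forall k, (1 <= k < s')%N -> t' k < t' k.+1) ->
  is_solution d m (discrete_charge s t a) y lam (discrete_charge s' t' a') ->
  (2^-1 * \sum_(j < m.+1) (\sum_(1 <= k < s'.+1) a' k * phi j (t' k) - y j) ^+ 2 +
     lam * \sum_(1 <= k < s'.+1) `|a' k| <=
   2^-1 * \sum_(j < m.+1) (\sum_(1 <= i < s.+1) a i * phi j (t i) - y j) ^+ 2 +
     lam * \sum_(1 <= i < s.+1) `|a i|) /\
  (forall j, (j <= d)%N -> \sum_(1 <= k < s'.+1) a' k * phi j (t' k) =
     \sum_(1 <= i < s.+1) a i * phi j (t i)).
Proof.
move=> ht tinc ht' tinc' [[_ low] opt].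
have tW k : (1 <= k <= s)%N -> -1 <= t k <= 1.
  by move=> /ht /andP[h1 h2]; rewrite !ltW.
have tI := knots_inj tinc; have tI' := knots_inj tinc'.
split=> [|j /low]; last by rewrite !moment_discrete.
have : constraint_set d (discrete_charge s t a) (discrete_charge s t a).
  by split=> //; exact: on_interval_discrete.
move/opt; rewrite /objective !tv_norm_discrete//.
under eq_bigr do rewrite moment_discrete//.
by under [X in _ <= _ * X + _]eq_bigr do rewrite moment_discrete//.
Qed.

End Recovery.

Theorem theorem2 (R : realType) (disp : measure_display)
    (Omega : measurableType disp) (Pr : probability Omega R)
    (d m : nat) (hdm : (d < m)%N)
    (s : nat) (t : nat -> R) (P : nat -> {poly R})
    (hspline : is_spline d s t P)
    (hsep : ((5 * pi / m%:R)%:E <=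
             mine (Delta (knot_set s t)) (2%:E * epsilon (knot_set s t)))%E)
    (sigma alpha : R) (hsigma : 0 < sigma) (halpha : 0 < alpha)
    (Q : Omega -> {poly R})
    (hQ : forall omega, (size (Q omega) <= m - d)%N)
    (hgauss : isotropic_gaussian Pr
       (fun (i : 'I_(m - d)) omega =>
          theta d (d.+1 + i)%N (fun x => (Q omega).[x]))
       (fun i : 'I_(m - d) => theta d (d.+1 + i)%N (piecewise s t P))
       sigma) :
  let lam := lambda_of d m sigma alpha in
  exists E : set Omega,
    [/\ measurable E,
        ((1 - (1 / (5 * (m + d)%:R)) `^ alpha)%:E < Pr E)%E
      & forall omega, E omega ->
        forall (s' : nat) (t' : nat -> R) (P' : nat -> {poly R}),
        recovery_output d m s t P (Q omega) lam s' t' P' ->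
        \sum_(1 <= k < s'.+1)
           `|jump d P' k| *
             Num.min (m%:R ^+ 2 * dist_to (knot_set s t) (t' k) ^+ 2) (c0 ^+ 2)
          <= c1 * lam
        /\
        forall i, (1 <= i <= s)%N -> `|jump d P i| > c2 * lam ->
          exists2 k, (1 <= k <= s')%N &
            rho (t i) (t' k) <=
              Num.sqrt (c1 * lam / (`|jump d P i| - c2 * lam)) * (1 / m%:R)].
Proof.
(* [u] bounds the noise in each coordinate; then its norm is at most [lam / 4] *)
move=> lam; pose L : R := ln (5 * (m + d + 1)%:R).
have L0 : 0 < L.
  apply: ln_gt0; rewrite addn1 -natrM ltr1n; lia.
pose v : R := 2 * (1 + alpha) * L.
have v0 : 0 < v by rewrite /v !mulr_gt0// ltr_wpDr// ltW.
pose u : R := sigma * Num.sqrt v.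
have u0 : 0 < u by rewrite mulr_gt0// sqrtr_gt0.
have usq : u ^+ 2 = sigma ^+ 2 * v by rewrite exprMn sqr_sqrtr// ltW.
have md0 : (0 : R) < (m - d)%:R by rewrite ltr0n subn_gt0.
have lamE : lam = 4 * u * Num.sqrt (m - d)%:R.
  rewrite /lam /lambda_of /u -!mulrA -(sqrtrM _ (ltW v0)); congr (4 * (sigma * Num.sqrt _)).
  by rewrite /v -/L; ring.
have lam0 : 0 < lam by rewrite lamE !mulr_gt0// sqrtr_gt0.
have lam4 : (lam / 4) ^+ 2 = (m - d)%:R * u ^+ 2.
  have -> : lam / 4 = u * Num.sqrt (m - d)%:R by rewrite lamE; field.
  by rewrite exprMn sqr_sqrtr ?(ltW md0)// mulrC.
have [mE PE] := gaussian_box hgauss hsigma (ltW u0).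
set E := [set om | _] in mE PE; exists E; split=> //.
  apply: lt_le_trans PE; rewrite lte_fin ltrD2l ltrN2.
  have -> : u ^+ 2 / (sigma ^+ 2 *+ 2) = (1 + alpha) * L.
    by rewrite usq /v -mulr_natr; field; rewrite gt_eqF.
  exact: gaussian_level.
move=> om Eom s' t' P' [a' [[ht' tinc'] sol _ pieces _]].
have [ht tinc _ _] := hspline.
have hD : ((5 * pi / m%:R)%:E <= Delta (knot_set s t))%E.
  by apply: (le_trans hsep); rewrite ge_min lexx.
have m0 : (0 < m)%N by exact: leq_ltn_trans hdm.
have [opt low] := discrete_optimality ht tinc ht' tinc' sol.
set y := observation _ _ _ _ in opt.
have noise : \sum_(j < m.+1 | (d < j)%N)
    (y j - \sum_(1 <= i < s.+1) jump d P i * phi j (t i)) ^+ 2 <= (lam / 4) ^+ 2.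
  rewrite lam4 -sum_tail_const; apply: ler_sum => j dj.
  rewrite /y (observation_moment hspline)// addrAC subrr add0r exprMn.
  rewrite -exprM mulnC exprM sqrrN !expr1n mul1r -real_normK ?num_real//.
  rewrite lerXn2r ?nnegrE ?(ltW u0)//.
  have jd : (j - d.+1 < m - d)%N by rewrite -(subSS d m) ltn_sub2r.
  by have := Eom (Ordinal jd); rewrite /= subnKC.
split=> [|i hi hj].
  rewrite (eq_big_nat _ _ (F2 := fun k => `|a' k| *
    Num.min (m%:R ^+ 2 * dist_to (knot_set s t) (t' k) ^+ 2) (c0 ^+ 2))).
    exact: (global_control m0 hD ht tinc ht' lam0 opt low noise).
  by move=> k hk; rewrite (jump_atom (pieces k _)).
exact: (large_jump_localization m0 hD ht tinc ht' lam0 opt low noise).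
Qed.
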